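(* Fix an integer $p\geq 3$ and $\beta>\beta^*(p)$. Let $\bm X=(X_1,\ldots,X_N)$ be a sample from $\mathbb{P}_{\beta,0,p}$ and let $\hat\beta$ be the maximum pseudolikelihood estimate of $\beta$. Let $m_*$ be the unique positive global maximizer of $H_{\beta,0,p}$. Then $$\sup_{x\in\mathbb{R}}\left|\mathbb{P}\left(\sqrt N(\hat\beta-\beta)\leq x\right)-\mathbb{P}\left(Z\leq x\right)\right| = O\left(\frac{\log N}{\sqrt N}\right),$$ where $Z\sim N\left(0,-\frac{H_{\beta,0,p}''(m_* )}{p^2 m_*^{2p-2}}\right)$.
   Context: For $p\geq 2$ and $\beta>0$, $\mathbb{P}_{\beta,0,p}$ is the probability measure on $\{-1,1\}^N$ given by $$\mathbb{P}_{\beta,0,p}(\bm X) = \frac{\exp\left\{\beta N^{1-p}\sum_{1\leq i_1,\ldots,i_p\leq N} X_{i_1}\cdots X_{i_p}\right\}}{2^N Z_N(\beta,0,p)},$$ with $Z_N$ the normalizing constant. Let $I(x)=\frac12\{(1+x)\log(1+x)+(1-x)\log(1-x)\}$ and $H_{\beta,0,p}(x)=\beta x^p-I(x)$ for $x\in[-1,1]$. Define $\beta^*(p):=\inf\{\beta\geq 0:\ \sup_{x\in[0,1]}H_{\beta,0,p}(x)>0\}$. The pseudolikelihood is $L(\beta\mid\bm X)=\prod_{i=1}^N \mathbb{P}_{\beta,0,p}\left(X_i\mid (X_j)_{j\neq i}\right)$, and the maximum pseudolikelihood estimate is $\hat\beta:=\arg\max_{\beta\in\mathbb{R}}L(\beta\mid\bm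 X)$. *)

(* Defs.v *)
From Stdlib Require Import Reals List.
From Coquelicot Require Import Coquelicot.
Import ListNotations.
Open Scope R_scope.

Definition Ient (x : R) : R :=
  / 2 * ((1 + x) * ln (1 + x) + (1 - x) * ln (1 - x)).
Definition Hfun (beta : R) (p : nat) (x : R) : R := beta * x ^ p - Ient x.

(* beta^*(p) = inf { beta >= 0 : sup_{x in [0,1]} H_{beta,0,p}(x) > 0 } ;
   sup_{[0,1]} H > 0  iff  some x in [0,1] has H(x) > 0. *)
Definition beta_star (p : nat) : Rbar :=
  Glb_Rbar (fun b => 0 <= b /\ exists x, 0 <= x <= 1 /\ Hfun b p x > 0).

Fixpoint sumlist (l : list R) : R :=
  match l with [] => 0 | a :: l => a + sumlist l end.
Fixpoint prodlist (l : list R) : R :=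
  match l with [] => 1 | a :: l => a * prodlist l end.

Fixpoint configs (N : nat) : list (list R) :=
  match N with
  | O => [[]]
  | S n => flat_map (fun l => [1 :: l; -1 :: l]) (configs n)
  end.

Fixpoint tuples (N p : nat) : list (list nat) :=
  match p with
  | O => [[]]
  | S q => flat_map (fun t => map (fun i => i :: t) (seq 0 N)) (tuples N q)
  end.

Definition hamil (beta : R) (p : nat) (X : list R) : R :=
  let N := length X in
  beta * / (INR N) ^ (p - 1) *
  sumlist (map (fun t => prodlist (map (fun i => nth i X 0) t)) (tuples N p)).

Definition ZN (beta : R) (p N : nat) : R :=
  sumlist (map (fun Y => exp (hamil beta p Y) / 2 ^ N) (configs N)).
Definition Pmeas (beta : R) (p : nat) (X : list R) : R :=
  exp (hamil beta p X) / (2 ^ length X * ZN beta p (length X)).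

Fixpoint flip (i : nat) (X : list R) : list R :=
  match X, i with
  | [], _ => []
  | a :: l, O => (- a) :: l
  | a :: l, S j => a :: flip j l
  end.

Definition condP (beta : R) (p : nat) (i : nat) (X : list R) : R :=
  Pmeas beta p X / (Pmeas beta p X + Pmeas beta p (flip i X)).

Definition PL (p : nat) (X : list R) (beta : R) : R :=
  prodlist (map (fun i => condP beta p i X) (seq 0 (length X))).

Definition is_mple (p : nat) (X : list R) (b : R) : Prop :=
  forall b', PL p X b' <= PL p X b.

Definition cdf_stat (beta : R) (p N : nat) (bhat : list R -> R) (x : R) : R :=
  sumlist (map (fun X => if Rle_dec (sqrt (INR N) * (bhat X - beta)) x
                         then Pmeas beta p X else 0) (configs N)).

Definition normal_cdf (v x : R) : R :=
  real (Lim (fun a => RInt (fun t => exp (- t ^ 2 / (2 * v)) / sqrt (2 * PI * v)) a x)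
            m_infty).

(* Main.v *)
Require Import Defs.
From Stdlib Require Import Reals List Factorial Lra Lia Psatz.
From Coquelicot Require Import Coquelicot.
Import ListNotations.
Open Scope R_scope.

(** The law of [X] and its pseudolikelihood depend on [X] only through the magnetization [x]
    (up to sign when [p] is even).

    Magnetization: the weight of the level with [k] ones is [C(N,k) exp(N beta x_k^p)], and its
    logarithm has increments [2 H'(x_k) + O(1/N)].  Summing them from the level nearest to [m] shows,
    without Stirling's constant, that the weight is proportional to
    [exp(-s^2/2) (1 + O((1 + |s|^3)/sqrt N))] with [s = sqrt(-H''(m) N) (x_k - m)], for
    [|s| <= sqrt(A ln N)]; outside this window the crude bound [ln n! = n ln n - n + O(ln n)]
    together with [H x <= H m - c (x - m)^2] makes the weights [O(N^-2)] relative to the maximum.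
    A Riemann sum comparison then gives the Berry-Esseen bound for [s].

    Estimator: the log-pseudolikelihood is concave, and evaluating its derivative at
    [g(x) +- C/N], where [g x = artanh x / (p x^(p-1))], brackets the maximizer.  Since [g m = beta]
    and [g'(m) = -H''(m)/(p m^(p-1))], in the window [sqrt N (bhat - beta)] differs from a multiple
    of [s] by [O((1 + s^2)/sqrt N) = O(ln N / sqrt N)]; this is where the logarithm comes from. *)

(** The condition on beta enters as [H m > 0 = H 0]: if [phi] were nonpositive at [m], then [H]
    would decrease from 0 all the way to [m]. Positivity thus forces [phi p m > 0], hence
    [H''(m) < 0] and strictness of the maximum. No normalizing constant is evaluated. The weights
    are Gaussian up to an unknown factor, and the total mass, approximated with the same factor,
    divides it out; the only constant to be known is the Gaussian integral [sqrt (2 * PI)]. Even [p]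
    is an obstacle, since the mass splits between neighbourhoods of [m] and [-m]. A global flip
    preserves both weight and pseudolikelihood, so levels [k] and [N - k] lead to the same estimate,
    and the resulting factor 2 cancels in the quotient. The estimate is an arbitrary choice among
    maximizers, specified only where one exists, so it need not be a function of the magnetization.
    Its distribution function is therefore squeezed between two sums over levels. Existence of a
    maximizer is proved inside the windows; outside them only the smallness of the mass is used. *)

Lemma exp_le_mono x y : x <= y -> exp x <= exp y.
Proof. intros [H| ->]; [left; now apply exp_increasing|right; easy]. Qed.

Lemma is_derive_continuity_pt (f : R -> R) x l : is_derive f x l -> continuity_pt f x.
Proof.
  intros H. apply continuity_pt_filterlim, (ex_derive_continuous (V := R_NormedModule)). now exists l.
Qed.

(** Equalities produced by Coquelicot's structures live in a carrier type; restating them in [R]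
    lets [ring] and [field] recognize them. *)
Ltac eqR := match goal with |- @eq _ ?a ?b => change (@eq R a b) end.

(** * The function [H] *)

(** One application of the mean value theorem, then the difference quotient of [f1] at [x0] with
    tolerance 1, which gives the constant [Rabs l + 1]. Differentiability of [f1] at the single
    point [x0] is enough. *)
Lemma taylor2_local (f f1 : R -> R) (x0 : R) :
  locally x0 (fun y => is_derive f y (f1 y)) -> ex_derive f1 x0 ->
  exists d K, 0 < d /\ 0 <= K /\ forall y, Rabs (y - x0) <= d ->
    Rabs (f y - f x0 - f1 x0 * (y - x0)) <= K * (y - x0) ^ 2.
Proof.
  intros [d1 Hd1] [l Hl].
  apply is_derive_Reals in Hl.
  destruct (Hl 1 Rlt_0_1) as [d2 Hd2].
  assert (Hd1' : 0 < d1) by apply cond_pos. assert (Hd2' : 0 < d2) by apply cond_pos.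
  exists (Rmin d1 d2 / 2), (Rabs l + 1).
  assert (Hm : 0 < Rmin d1 d2) by (apply Rmin_case; lra).
  assert (Hm1 := Rmin_l d1 d2). assert (Hm2 := Rmin_r d1 d2).
  split; [lra|]. split; [assert (H := Rabs_pos l); lra|].
  intros y Hy.
  assert (Hc : forall c, Rmin x0 y <= c <= Rmax x0 y -> Rabs (c - x0) <= Rabs (y - x0)).
  { intros c Hc. unfold Rmin, Rmax in Hc. destruct (Rle_dec x0 y).
    - rewrite !Rabs_pos_eq; lra.
    - rewrite (Rabs_left1 (c - x0)), (Rabs_left1 (y - x0)); lra. }
  destruct (MVT_gen f x0 y f1) as [c [Hcc He]].
  - intros c Hcc. apply Hd1. change (Rabs (c - x0) < d1).
    assert (Rabs (c - x0) <= Rabs (y - x0)) by (apply Hc; lra). lra.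
  - intros c Hcc. apply continuity_pt_filterlim, (ex_derive_continuous (V := R_NormedModule)).
    exists (f1 c). apply Hd1. change (Rabs (c - x0) < d1).
    assert (Rabs (c - x0) <= Rabs (y - x0)) by (apply Hc; lra). lra.
  - rewrite He. replace (f1 c * (y - x0) - f1 x0 * (y - x0)) with ((f1 c - f1 x0) * (y - x0)) by ring.
    rewrite Rabs_mult, <- pow2_abs. simpl. rewrite Rmult_1_r, <- Rmult_assoc.
    apply Rmult_le_compat_r; [apply Rabs_pos|].
    specialize (Hc c Hcc).
    destruct (Req_dec c x0) as [->|Hne].
    { rewrite Rminus_diag, Rabs_R0. assert (H := Rabs_pos l); assert (H' := Rabs_pos (y - x0)). nra. }
    assert (Hne' : c - x0 <> 0) by lra.
    specialize (Hd2 (c - x0) Hne'). replace (x0 + (c - x0)) with c in Hd2 by ring.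
    assert (Hq : Rabs ((f1 c - f1 x0) / (c - x0)) <= Rabs l + 1).
    { replace ((f1 c - f1 x0) / (c - x0)) with ((f1 c - f1 x0) / (c - x0) - l + l) by ring.
      eapply Rle_trans; [apply Rabs_triang|]. lra. }
    replace (f1 c - f1 x0) with ((f1 c - f1 x0) / (c - x0) * (c - x0)) by (now field).
    rewrite Rabs_mult. assert (H := Rabs_pos l). assert (H1 := Rabs_pos (c - x0)).
    apply Rmult_le_compat; try apply Rabs_pos; easy.
Qed.

(** The strict location of [c] matters: [H] is only continuous at 1, and the sign arguments below
    are strict. *)
Lemma MVT_interior (f f1 : R -> R) (a b : R) :
  a < b -> (forall x, a < x < b -> is_derive f x (f1 x)) ->
  (forall x, a <= x <= b -> continuity_pt f x) ->
  exists c, a < c < b /\ f b - f a = f1 c * (b - a).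
Proof.
  intros Hab Hd Hc.
  assert (pr : forall c, a < c < b -> derivable_pt f c).
  { intros c Hcc. exists (f1 c). apply is_derive_Reals, Hd, Hcc. }
  destruct (MVT f id a b pr (fun c _ => derivable_pt_id c) Hab Hc) as [c [P Hcc]].
  { intros c _. apply derivable_continuous_pt, derivable_pt_id. }
  exists c. split; [easy|].
  rewrite derive_pt_id in Hcc. unfold id in Hcc.
  assert (He : derive_pt f c (pr c P) = f1 c).
  { apply derive_pt_eq_0, is_derive_Reals, Hd, P. }
  rewrite He in Hcc. lra.
Qed.

(** * Derivatives and critical points of [H] *)

Definition ath (x : R) : R := / 2 * (ln (1 + x) - ln (1 - x)).
Definition dH (b : R) (p : nat) (x : R) : R := b * (INR p * x ^ (p - 1)) - ath x.
Definition d2H (b : R) (p : nat) (x : R) : R :=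
  b * (INR p * (INR (p - 1) * x ^ (p - 2))) - / (1 - x ^ 2).

Lemma is_derive_ath x : -1 < x < 1 -> is_derive ath x (/ (1 - x ^ 2)).
Proof.
  intros Hx. unfold ath. auto_derive; [lra|]. field. repeat split; nra.
Qed.

Lemma is_derive_Hfun b p x : -1 < x < 1 -> is_derive (Hfun b p) x (dH b p x).
Proof.
  intros Hx. unfold Hfun, Ient, dH, ath. auto_derive; [lra|].
  replace (Nat.pred p) with (p - 1)%nat by lia. change (1 + - x) with (1 - x). field. lra.
Qed.

Lemma is_derive_dH b p x : -1 < x < 1 -> is_derive (dH b p) x (d2H b p x).
Proof.
  intros Hx. unfold dH, d2H.
  apply (is_derive_minus (V := R_NormedModule)); [|now apply is_derive_ath].
  auto_derive; [easy|]. replace (Nat.pred (p - 1)) with (p - 2)%nat by lia. ring.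
Qed.

Lemma Derive_n_Hfun b p x : -1 < x < 1 -> Derive_n (Hfun b p) 2 x = d2H b p x.
Proof.
  intros Hx. simpl.
  rewrite (Derive_ext_loc _ (dH b p)).
  - apply is_derive_unique, is_derive_dH, Hx.
  - assert (Hd : 0 < Rmin (x + 1) (1 - x)) by (apply Rmin_case; lra).
    exists (mkposreal _ Hd). intros y Hy. apply is_derive_unique, is_derive_Hfun.
    assert (Hy' : Rabs (y - x) < Rmin (x + 1) (1 - x)) by exact Hy.
    assert (H1 := Rmin_l (x + 1) (1 - x)). assert (H2 := Rmin_r (x + 1) (1 - x)).
    apply Rabs_def2 in Hy'. lra.
Qed.

Lemma ath_0 : ath 0 = 0.
Proof. unfold ath. rewrite Rplus_0_r, Rminus_0_r. ring. Qed.

(** Up to the factor [x ^ p], the derivative of [artanh x / x ^ (p - 1)]. At a critical point [m] of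
    [H] it equals [- m * H''(m)], so its sign decides the type of the critical point. *)
Definition phi (p : nat) (x : R) : R := x / (1 - x ^ 2) - INR (p - 1) * ath x.

Lemma is_derive_phi p x : (3 <= p)%nat -> -1 < x < 1 ->
  is_derive (phi p) x ((INR p * x ^ 2 - INR (p - 2)) / (1 - x ^ 2) ^ 2).
Proof.
  intros Hp Hx. unfold phi.
  assert (0 < 1 - x ^ 2) by nra.
  evar_last.
  - apply (is_derive_minus (V := R_NormedModule)).
    + instantiate (1 := (1 + x ^ 2) / (1 - x ^ 2) ^ 2). auto_derive; [simpl in *; lra|].
      field. simpl in *; lra.
    + apply (is_derive_scal ath), is_derive_ath, Hx.
  - unfold minus, plus, opp; simpl. rewrite !minus_INR by lia. simpl. field. simpl in *; lra.
Qed.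

(* [phi' >= 0] persists to the right, so once [phi] has climbed back to [0] it stays positive. *)
Lemma phi_pos_after p x y : (3 <= p)%nat -> 0 < x < y -> y < 1 -> 0 <= phi p x -> 0 < phi p y.
Proof.
  intros Hp Hx Hy H.
  assert (Hp0 : 0 < INR p) by (apply lt_0_INR; lia).
  assert (Hcont : forall z, -1 < z < 1 -> continuity_pt (phi p) z).
  { intros z Hz. apply continuity_pt_filterlim, (ex_derive_continuous (V := R_NormedModule)).
    eexists; now apply is_derive_phi. }
  destruct (MVT_interior (phi p) (fun x => (INR p * x ^ 2 - INR (p - 2)) / (1 - x ^ 2) ^ 2) 0 x) as [c [Hc Ec]].
  - lra.
  - intros; apply is_derive_phi; lra || easy.
  - intros; apply Hcont; lra.
  - destruct (MVT_interior (phi p) (fun x => (INR p * x ^ 2 - INR (p - 2)) / (1 - x ^ 2) ^ 2) x y) as [d [Hd Ed]].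
    + lra.
    + intros; apply is_derive_phi; lra || easy.
    + intros; apply Hcont; lra.
    + assert (P0 : phi p 0 = 0) by (unfold phi; rewrite ath_0; field; lra).
      assert (Hc2 : 0 <= INR p * c ^ 2 - INR (p - 2)).
      { destruct (Rle_lt_dec 0 (INR p * c ^ 2 - INR (p - 2))) as [|Hn]; [easy|exfalso].
        assert (0 < (1 - c ^ 2) ^ 2) by (apply pow_lt; nra).
        assert ((INR p * c ^ 2 - INR (p - 2)) / (1 - c ^ 2) ^ 2 < 0).
        { apply Rlt_div_l; lra. }
        nra. }
      assert (Hd2 : 0 < (INR p * d ^ 2 - INR (p - 2)) / (1 - d ^ 2) ^ 2).
      { apply Rdiv_lt_0_compat; [|apply pow_lt; nra].
        assert (c ^ 2 < d ^ 2) by nra. nra. }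
      nra.
Qed.

(** Dividing [H'] by [x ^ (p - 1)] makes [b] enter as a constant level: critical points in (0,1) are
    the solutions of [hr p x = b * INR p], whatever [b] is. *)
Definition hr (p : nat) (x : R) : R := ath x / x ^ (p - 1).

Lemma is_derive_hr p x : (3 <= p)%nat -> 0 < x < 1 -> is_derive (hr p) x (phi p x / x ^ p).
Proof.
  intros Hp Hx. unfold hr.
  destruct p as [|[|q]]; try lia.
  assert (0 < x ^ q) by (apply pow_lt; lra).
  assert (0 < 1 - x ^ 2) by nra.
  replace (S (S q) - 1)%nat with (S q) by lia.
  evar_last.
  - apply is_derive_div; [apply is_derive_ath; lra| |].
    + instantiate (1 := INR (S q) * x ^ q). auto_derive; [easy|]. simpl Nat.pred. change (1 * (INR (S q) * x ^ q) = INR (S q) * x ^ q). ring.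
    + apply Rgt_not_eq, pow_lt; lra.
  - unfold phi. replace (S (S q) - 1)%nat with (S q) by lia.
    change (x ^ S q) with (x * x ^ q). change (x ^ S (S q)) with (x * (x * x ^ q)).
    field. simpl in *. repeat split; lra.
Qed.

Lemma dH_hr b p x : 0 < x -> dH b p x = x ^ (p - 1) * (b * INR p - hr p x).
Proof.
  intros Hx. unfold dH, hr. field. apply Rgt_not_eq, pow_lt, Hx.
Qed.

(** Since [ln] is 0 on nonpositive reals, the function vanishes to the left of 0. To its right
    [- ln y <= 2 / sqrt y] gives [|y ln y| <= 2 sqrt y], whence the radius [(e / 2) ^ 2].
    Consequently [H] is continuous at the endpoints too. *)
Lemma continuity_xlnx t : continuity_pt (fun t => t * ln t) t.
Proof.
  destruct (Rtotal_order t 0) as [Ht|[->|Ht]].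
  - assert (Hl : forall y, y < 0 -> y * ln y = 0).
    { intros y Hy. unfold ln. destruct (Rlt_dec 0 y); [exfalso; lra|ring]. }
    apply (continuity_pt_ext_loc (fun _ => 0)).
    + assert (Hp : 0 < - t) by lra. exists (mkposreal _ Hp). intros y Hy.
      assert (Hy' : Rabs (y - t) < - t) by exact Hy.
      apply Rabs_def2 in Hy'. rewrite Hl; lra.
    + apply continuity_pt_const. intros ? ?; easy.
  - intros e He. exists (Rmin 1 ((e / 2) ^ 2)). split.
    { assert (0 < (e / 2) ^ 2) by (apply pow_lt; lra). apply Rmin_case; lra. }
    assert (Hm1 := Rmin_l 1 ((e / 2) ^ 2)). assert (Hm2 := Rmin_r 1 ((e / 2) ^ 2)).
    intros y [_ Hy]. unfold dist in *; simpl in *; unfold Rdist in *.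
    rewrite Rminus_0_r in Hy. rewrite Rmult_0_l, Rminus_0_r.
    destruct (Rle_lt_dec y 0) as [H|H].
    + assert (E : y * ln y = 0). { unfold ln. destruct (Rlt_dec 0 y); [exfalso; lra|ring]. }
      rewrite E, Rabs_R0; easy.
    + rewrite (Rabs_pos_eq y) in Hy by lra.
      assert (H1 : y < 1) by lra.
      assert (Hs : 0 < sqrt y) by now apply sqrt_lt_R0.
        assert (Hss : sqrt y * sqrt y = y) by (apply sqrt_sqrt; lra).
        assert (L0 : ln y < 0) by (rewrite <- ln_1; apply ln_increasing; lra).
        assert (Ll : - ln y <= 2 / sqrt y).
        { rewrite <- Hss at 1. rewrite ln_mult by easy.
          assert (Hq := exp_ineq1_le (- ln (sqrt y))).
          rewrite exp_Ropp, exp_ln in Hq by easy.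
unfold Rdiv. lra. }
        rewrite Rabs_left by nra.
        assert (y * (- ln y) <= 2 * sqrt y).
        { replace (2 * sqrt y) with (y * (2 / sqrt y)).
          - apply Rmult_le_compat_l; lra.
          - rewrite <- Hss at 1. field. lra. }
        assert (sqrt y < e / 2).
        { apply Rsqr_incrst_0; try lra. unfold Rsqr. rewrite Hss. nra. }
        lra.
  - apply continuity_pt_mult; [apply derivable_continuous_pt, derivable_pt_id|].
    apply derivable_continuous_pt. exists (/ t). now apply derivable_pt_lim_ln.
Qed.

Lemma continuity_Hfun b p x : continuity_pt (Hfun b p) x.
Proof.
  unfold Hfun, Ient.
  apply continuity_pt_minus.
  - apply continuity_pt_mult; [apply continuity_pt_const; intros ? ?; easy|].
    apply derivable_continuous_pt, derivable_pt_pow.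
  - apply continuity_pt_mult; [apply continuity_pt_const; intros ? ?; easy|].
    apply continuity_pt_plus.
    + apply (continuity_pt_comp (fun x => 1 + x) (fun t => t * ln t)); [|apply continuity_xlnx].
      apply continuity_pt_plus; [apply continuity_pt_const; intros ? ?; easy|apply derivable_continuous_pt, derivable_pt_id].
    + apply (continuity_pt_comp (fun x => 1 - x) (fun t => t * ln t)); [|apply continuity_xlnx].
      apply continuity_pt_minus; [apply continuity_pt_const; intros ? ?; easy|apply derivable_continuous_pt, derivable_pt_id].
Qed.

Lemma Hfun_0 b p : (3 <= p)%nat -> Hfun b p 0 = 0.
Proof.
  intros Hp. unfold Hfun, Ient. rewrite Rplus_0_r, Rminus_0_r, ln_1, pow_i by lia. ring.
Qed.

(** Beyond [m] the function [phi] stays positive, so [hr] rises strictly above its critical level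
    [b * INR p]. *)
Lemma dH_decreasing_after b p m x : (3 <= p)%nat -> 0 < m < x -> x < 1 ->
  dH b p m = 0 -> 0 < phi p m -> dH b p x < 0.
Proof.
  intros Hp Hm Hx Hd Hphi.
  rewrite dH_hr in Hd by lra. rewrite dH_hr by lra.
  assert (Pm : 0 < m ^ (p - 1)) by (apply pow_lt; lra).
  assert (Px : 0 < x ^ (p - 1)) by (apply pow_lt; lra).
  destruct (MVT_interior (hr p) (fun x => phi p x / x ^ p) m x) as [c [Hc Ec]].
  - lra.
  - intros; apply is_derive_hr; lra || easy.
  - intros; eapply is_derive_continuity_pt, is_derive_hr; lra || easy.
  - assert (0 < phi p c / c ^ p).
    { apply Rdiv_lt_0_compat; [apply (phi_pos_after p m c); lra || easy|apply pow_lt; lra]. }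
    assert (b * INR p - hr p m = 0) by (destruct (Rmult_integral _ _ Hd); lra).
    assert (hr p m < hr p x) by nra. nra.
Qed.

Lemma Hfun_decreasing_after b p m x : (3 <= p)%nat -> 0 < m < x -> x <= 1 ->
  dH b p m = 0 -> 0 < phi p m -> Hfun b p x < Hfun b p m.
Proof.
  intros Hp Hm Hx Hd Hphi.
  destruct (MVT_interior (Hfun b p) (dH b p) m x) as [c [Hc Ec]].
  - lra.
  - intros; apply is_derive_Hfun; lra.
  - intros; apply continuity_Hfun.
  - assert (dH b p c < 0) by (apply (dH_decreasing_after b p m c); lra || easy). nra.
Qed.

(** If [phi p m <= 0], then [phi < 0] on (0,m), because a nonnegative value would persist to the
    right. Then [hr] decreases to its critical level at [m], so [H' < 0] on (0,m) and
    [H m < H 0 = 0]. *)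
Lemma critical_phi_pos b p m : (3 <= p)%nat -> 0 < m < 1 ->
  dH b p m = 0 -> 0 <= Hfun b p m -> 0 < phi p m.
Proof.
  intros Hp Hm Hd HH.
  destruct (Rlt_le_dec 0 (phi p m)) as [|Hn]; [easy|exfalso].
  destruct (MVT_interior (Hfun b p) (dH b p) 0 m) as [c [Hc Ec]].
  - lra.
  - intros; apply is_derive_Hfun; lra.
  - intros; apply continuity_Hfun.
  - rewrite Hfun_0 in Ec by easy.
    rewrite dH_hr in Hd by lra. rewrite dH_hr in Ec by lra.
    assert (Pm : 0 < m ^ (p - 1)) by (apply pow_lt; lra).
    assert (Pc : 0 < c ^ (p - 1)) by (apply pow_lt; lra).
    destruct (MVT_interior (hr p) (fun x => phi p x / x ^ p) c m) as [d [Hd' Ed]].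
    + lra.
    + intros; apply is_derive_hr; lra || easy.
    + intros; eapply is_derive_continuity_pt, is_derive_hr; lra || easy.
    + assert (Hphi : phi p d < 0).
      { destruct (Rlt_le_dec (phi p d) 0) as [|Hq]; [easy|].
        assert (Hb := phi_pos_after p d m Hp ltac:(lra) ltac:(lra) Hq). lra. }
      assert (phi p d / d ^ p < 0).
      { apply Rlt_div_l; [apply pow_lt; lra|lra]. }
      assert (b * INR p - hr p m = 0) by (destruct (Rmult_integral _ _ Hd); lra).
      assert (hr p m < hr p c) by nra.
      assert (b * INR p - hr p c < 0) by lra.
      assert (c ^ (p - 1) * (b * INR p - hr p c) < 0) by nra. nra.
Qed.

Lemma max_critical b p m : 0 < m < 1 ->
  (forall y, 0 <= y <= 1 -> Hfun b p y <= Hfun b p m) -> dH b p m = 0.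
Proof.
  intros Hm Hmax.
  assert (Hd := is_derive_Hfun b p m ltac:(lra)). apply is_derive_Reals in Hd.
  rewrite <- (derive_pt_eq_0 (Hfun b p) m (dH b p m) (exist _ _ Hd) Hd).
  apply (deriv_maximum (Hfun b p) 0 1); [lra|lra|]. intros; apply Hmax; lra.
Qed.

(** A competitor would itself be a maximizer on [0,1], hence critical with [phi > 0], hence strictly
    above everything to its right. Of two maximizers, the left one would exceed the right one. *)
Lemma Hfun_strict_max b p m : (3 <= p)%nat -> 0 < m < 1 ->
  (forall y, 0 <= y <= 1 -> Hfun b p y <= Hfun b p m) -> 0 < Hfun b p m ->
  forall x, 0 <= x <= 1 -> x <> m -> Hfun b p x < Hfun b p m.
Proof.
  intros Hp Hm Hmax HH x Hx Hne.
  destruct (Rlt_le_dec (Hfun b p x) (Hfun b p m)) as [|Hge]; [easy|exfalso].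
  assert (Hdec : forall z, 0 < z < 1 -> Hfun b p m <= Hfun b p z -> forall y, z < y <= 1 -> Hfun b p y < Hfun b p z).
  { intros z Hz Hzm y Hy.
    assert (Hd : dH b p z = 0).
    { apply max_critical; [easy|]. intros y' Hy'. specialize (Hmax y' Hy'). lra. }
    apply Hfun_decreasing_after; try lra; try easy.
    apply (critical_phi_pos b); lra || easy. }
  destruct (Rtotal_order x m) as [Hlt|[|Hlt]]; [|easy|].
  - destruct (Req_dec x 0) as [->|]; [rewrite Hfun_0 in Hge by easy; lra|].
    specialize (Hdec x ltac:(lra) Hge m ltac:(lra)). specialize (Hmax x Hx). lra.
  - specialize (Hdec m ltac:(lra) ltac:(lra) x ltac:(lra)). lra.
Qed.

Lemma d2H_neg b p m : (3 <= p)%nat -> 0 < m < 1 -> dH b p m = 0 -> 0 < phi p m -> d2H b p m < 0.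
Proof.
  intros Hp Hm Hd Hphi.
  assert (E : m * d2H b p m = - phi p m).
  { unfold d2H, phi, dH in *. replace (ath m) with (b * (INR p * m ^ (p - 1))) by lra.
    replace (p - 1)%nat with (S (p - 2)) by lia. change (m ^ S (p - 2)) with (m * m ^ (p - 2)).
    field. nra. }
  nra.
Qed.

(** Near [m] the quadratic bound comes from the Taylor expansion of [H']; away from [m] a positive
    gap exists by compactness and strictness. *)
Lemma Hfun_quadratic_max b p m : (3 <= p)%nat -> 0 < m < 1 ->
  (forall y, 0 <= y <= 1 -> Hfun b p y <= Hfun b p m) -> 0 < Hfun b p m ->
  exists c, 0 < c /\ forall x, 0 <= x <= 1 -> Hfun b p x <= Hfun b p m - c * (x - m) ^ 2.
Proof.
  intros Hp Hm Hmax HH.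
  assert (Hd : dH b p m = 0) by now apply max_critical.
  assert (Hphi : 0 < phi p m) by (apply (critical_phi_pos b); lra || easy).
  assert (H2 := d2H_neg b p m Hp Hm Hd Hphi).
  assert (Hs := Hfun_strict_max b p m Hp Hm Hmax HH).
  assert (Hloc : locally m (fun y => is_derive (dH b p) y (d2H b p y))).
  { assert (Hq : 0 < Rmin m (1 - m)) by (apply Rmin_case; lra).
    exists (mkposreal _ Hq). intros y Hy.
    assert (Hy' : Rabs (y - m) < Rmin m (1 - m)) by exact Hy. apply Rabs_def2 in Hy'.
    assert (A := Rmin_l m (1 - m)). assert (B := Rmin_r m (1 - m)).
    apply is_derive_dH. lra. }
  destruct (taylor2_local (dH b p) (d2H b p) m Hloc) as [d [K [Hd0 [HK Ht]]]].
  { unfold d2H. auto_derive. nra. }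
  set (L := - d2H b p m) in *. assert (HL : 0 < L) by (unfold L; lra).
  (* The radius keeps the Taylor bound valid, makes its remainder at most half of the linear term,
     and keeps the neighbourhood inside (0,1). *)
  set (e := Rmin (Rmin d (L / (2 * (K + 1)))) (Rmin m (1 - m) / 2)).
  assert (HLK : 0 < L / (2 * (K + 1))) by (apply Rdiv_lt_0_compat; lra).
  assert (He : 0 < e).
  { unfold e. repeat apply Rmin_case; lra. }
  assert (He1 : e <= d) by (unfold e; eapply Rle_trans; [apply Rmin_l|apply Rmin_l]).
  assert (He2 : e <= L / (2 * (K + 1))) by (unfold e; eapply Rle_trans; [apply Rmin_l|apply Rmin_r]).
  assert (He3 : e <= Rmin m (1 - m) / 2) by (unfold e; apply Rmin_r).
  assert (A := Rmin_l m (1 - m)). assert (B := Rmin_r m (1 - m)).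
  assert (HKe : K * e <= L / 2).
  { apply Rle_trans with ((K + 1) * (L / (2 * (K + 1)))); [|right; field; lra].
    apply Rmult_le_compat; lra. }
  assert (Hnear : forall x, Rabs (x - m) <= e -> Hfun b p x <= Hfun b p m - L / 4 * (x - m) ^ 2).
  { intros x Hx. apply Rabs_le_between in Hx.
    (* A quarter of [L] leaves room: the linear part of [G'] is [- L / 2 * (y - m)], which absorbs
       the remainder, so [G] increases up to [m] and decreases after it. *)
    set (G := fun x => Hfun b p x + L / 4 * (x - m) ^ 2).
    assert (HG : forall y, Rabs (y - m) <= e -> is_derive G y (dH b p y + L / 2 * (y - m))).
    { intros y Hy. apply Rabs_le_between in Hy. unfold G.
      apply (is_derive_plus (V := R_NormedModule)); [apply is_derive_Hfun; lra|].
      auto_derive; [easy|]. simpl. field. }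
    assert (Hsg : forall y, Rabs (y - m) <= e -> Rabs (dH b p y + L * (y - m)) <= L / 2 * Rabs (y - m)).
    { intros y Hy. specialize (Ht y ltac:(lra)). rewrite Hd in Ht.
      replace (dH b p y + L * (y - m)) with (dH b p y - 0 - d2H b p m * (y - m)) by (unfold L; ring).
      eapply Rle_trans; [apply Ht|]. rewrite <- pow2_abs. simpl. rewrite Rmult_1_r, <- Rmult_assoc.
      apply Rmult_le_compat_r; [apply Rabs_pos|]. nra. }
    assert (HGm : G m = Hfun b p m) by (unfold G; ring).
    enough (G x <= G m) by (unfold G in *; lra).
    destruct (Rtotal_order x m) as [Hlt|[->|Hlt]]; [|lra|].
    - destruct (MVT_interior G (fun y => dH b p y + L / 2 * (y - m)) x m) as [c [Hc Ec]].
      + easy.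
      + intros y Hy; apply HG. apply Rabs_le; lra.
      + intros y Hy; eapply is_derive_continuity_pt, HG, Rabs_le; lra.
      + specialize (Hsg c ltac:(apply Rabs_le; lra)). rewrite (Rabs_left (c - m)) in Hsg by lra.
        apply Rabs_le_between in Hsg. nra.
    - destruct (MVT_interior G (fun y => dH b p y + L / 2 * (y - m)) m x) as [c [Hc Ec]].
      + easy.
      + intros y Hy; apply HG. apply Rabs_le; lra.
      + intros y Hy; eapply is_derive_continuity_pt, HG, Rabs_le; lra.
      + specialize (Hsg c ltac:(apply Rabs_le; lra)). rewrite (Rabs_pos_eq (c - m)) in Hsg by lra.
        apply Rabs_le_between in Hsg. nra. }
  assert (Hfar : forall u v, 0 <= u <= v -> v <= 1 -> (v <= m - e \/ m + e <= u) ->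
     exists g, 0 < g /\ forall x, u <= x <= v -> Hfun b p x <= Hfun b p m - g).
  { intros u v Huv Hv Hor.
    destruct (continuity_ab_maj (Hfun b p) u v) as [z [Hz1 Hz2]]; [lra|intros; apply continuity_Hfun|].
    exists (Hfun b p m - Hfun b p z). split.
    - specialize (Hs z ltac:(lra) ltac:(lra)). lra.
    - intros x Hx. specialize (Hz1 x Hx). lra. }
  destruct (Hfar 0 (m - e)) as [g1 [Hg1 Hf1]]; [lra|lra|lra|].
  destruct (Hfar (m + e) 1) as [g2 [Hg2 Hf2]]; [lra|lra|lra|].
  (* A constant gap dominates a quadratic one because [(x - m) ^ 2 <= 1] on [0,1]. *)
  exists (Rmin (L / 4) (Rmin g1 g2)). split; [repeat apply Rmin_case; lra|].
  assert (C1 := Rmin_l (L / 4) (Rmin g1 g2)). assert (C2 := Rmin_r (L / 4) (Rmin g1 g2)).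
  assert (C3 := Rmin_l g1 g2). assert (C4 := Rmin_r g1 g2).
  set (c := Rmin (L / 4) (Rmin g1 g2)) in *.
  assert (Hc0 : 0 < c) by (unfold c; repeat apply Rmin_case; lra).
  intros x Hx.
  assert (Hsq : 0 <= (x - m) ^ 2 <= 1) by (split; [apply pow2_ge_0|simpl; nra]).
  destruct (Rle_lt_dec (Rabs (x - m)) e) as [Hle|Hgt].
  - specialize (Hnear x Hle). nra.
  - destruct (Rle_lt_dec x m).
    + rewrite Rabs_left1 in Hgt by lra. specialize (Hf1 x ltac:(lra)). nra.
    + rewrite Rabs_pos_eq in Hgt by lra. specialize (Hf2 x ltac:(lra)). nra.
Qed.

(** An infimum below [b] provides some [b0 < b] with [H_{b0}] positive at a point [x >= 0]; there
    [H] is monotone in the coefficient. *)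
Lemma Hfun_max_pos b p m : (3 <= p)%nat -> Rbar_lt (beta_star p) (Finite b) ->
  (forall y, -1 <= y <= 1 -> Hfun b p y <= Hfun b p m) -> 0 < b /\ 0 < Hfun b p m.
Proof.
  intros Hp Hb Hmax.
  assert (Hex : exists b0 x, 0 <= b0 < b /\ 0 <= x <= 1 /\ Hfun b0 p x > 0).
  { apply Classical_Prop.NNPP. intros Hno.
    apply (Rbar_lt_not_le _ _ Hb).
    unfold beta_star.
    apply (proj2 (Glb_Rbar_correct (fun b => 0 <= b /\ exists x, 0 <= x <= 1 /\ Hfun b p x > 0))).
    intros b0 [Hb0 [x Hx]]. simpl.
    destruct (Rle_lt_dec b b0) as [|Hlt]; [easy|exfalso]. apply Hno. exists b0, x. easy. }
  destruct Hex as [b0 [x [Hb0 [Hx HH]]]]. split; [lra|].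
  specialize (Hmax x ltac:(lra)).
  assert (Hfun b0 p x <= Hfun b p x).
  { unfold Hfun. assert (0 <= x ^ p) by (apply pow_le; lra). nra. }
  lra.
Qed.

(** * The Gaussian distribution function *)

Definition gauss (s : R) : R := exp (- s ^ 2 / 2).
(** Unnormalized Gaussian distribution function, of total mass [sqrt (2 * PI)]. The half mass is put
    in by hand instead of an improper integral; [Phi_tail] shows that it is the right constant. *)
Definition Phi (x : R) : R := RInt gauss 0 x + sqrt (2 * PI) / 2.

Lemma gauss_pos s : 0 < gauss s.
Proof. apply exp_pos. Qed.

Lemma gauss_le_1 s : gauss s <= 1.
Proof.
  unfold gauss. rewrite <- exp_0. apply exp_le_mono. assert (0 <= s ^ 2) by apply pow2_ge_0. lra.
Qed.

Lemma is_derive_gauss s : is_derive gauss s (- s * gauss s).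
Proof. unfold gauss; auto_derive; [easy|]. simpl. unfold Rdiv. ring_simplify.
 replace (- s ^ 2 / 2) with (- (s * (s * 1)) * / 2) by (simpl; field). field. Qed.

Lemma continuous_gauss s : continuous gauss s.
Proof.
  apply (ex_derive_continuous (V := R_NormedModule)).
  exists (- s * gauss s). apply is_derive_gauss.
Qed.

Lemma is_derive_Phi x : is_derive Phi x (gauss x).
Proof.
  unfold Phi.
  replace (gauss x) with (plus (gauss x) 0) by (unfold plus; simpl; ring).
  apply (is_derive_plus (V := R_NormedModule)); [|apply (is_derive_const (V := R_NormedModule))].
  apply (is_derive_RInt (V := R_NormedModule) gauss _ 0 x).
  - apply filter_forall; intros y. apply (RInt_correct (V := R_CompleteNormedModule)).
    apply (ex_RInt_continuous (V := R_CompleteNormedModule)); intros; apply continuous_gauss.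
  - apply continuous_gauss.
Qed.

Lemma gauss_lipschitz a b : Rabs (gauss b - gauss a) <= Rabs (b - a).
Proof.
  destruct (MVT_gen gauss a b (fun s => - s * gauss s)) as [c [_ Hc]].
  - intros; apply is_derive_gauss.
  - intros; apply continuity_pt_filterlim, continuous_gauss.
  - rewrite Hc, Rabs_mult. rewrite <- (Rmult_1_l (Rabs (b - a))) at 2.
    apply Rmult_le_compat_r; [apply Rabs_pos|].
    rewrite Rabs_mult, Rabs_Ropp, (Rabs_pos_eq (gauss c)) by (left; apply gauss_pos).
    unfold gauss. replace (- c ^ 2 / 2) with (- (c ^ 2 / 2)) by field.
    rewrite exp_Ropp.
    assert (H := exp_ineq1_le (c ^ 2 / 2)).
    assert (Rabs c <= exp (c ^ 2 / 2)).
    { replace (c ^ 2) with (Rabs c ^ 2) in * by apply pow2_abs.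
      assert (0 <= (Rabs c - 1) ^ 2) by apply pow2_ge_0. nra. }
    assert (0 < exp (c ^ 2 / 2)) by apply exp_pos.
    apply (Rmult_le_reg_r (exp (c ^ 2 / 2))); [easy|].
    rewrite Rmult_assoc, Rinv_l by lra. lra.
Qed.

Lemma Phi_MVT a b : exists c, Rmin a b <= c <= Rmax a b /\ Phi b - Phi a = gauss c * (b - a).
Proof.
  destruct (MVT_gen Phi a b gauss) as [c Hc].
  - intros; apply is_derive_Phi.
  - intros. apply continuity_pt_filterlim, (ex_derive_continuous (V := R_NormedModule)).
    exists (gauss x). apply is_derive_Phi.
  - now exists c.
Qed.

Lemma Phi_increasing a b : a <= b -> Phi a <= Phi b.
Proof.
  intros Hab. destruct (Phi_MVT a b) as [c [_ H]]. assert (Hc := gauss_pos c). nra.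
Qed.

Lemma Phi_lipschitz a b : Rabs (Phi b - Phi a) <= Rabs (b - a).
Proof.
  destruct (Phi_MVT a b) as [c [_ H]]. rewrite H, Rabs_mult, (Rabs_pos_eq (gauss c)).
  - assert (Hc := gauss_le_1 c). assert (H0 := Rabs_pos (b - a)). nra.
  - left; apply gauss_pos.
Qed.

Lemma Phi_step a h : 0 <= h -> Rabs (Phi (a + h) - Phi a - h * gauss a) <= h ^ 2.
Proof.
  intros Hh. destruct (Phi_MVT a (a + h)) as [c [Hc H]]. rewrite H.
  replace (gauss c * (a + h - a) - h * gauss a) with (h * (gauss c - gauss a)) by ring.
  rewrite Rabs_mult, (Rabs_pos_eq h) by easy.
  assert (Hl := gauss_lipschitz a c).
  rewrite Rmin_left, Rmax_right in Hc by lra.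
  rewrite (Rabs_pos_eq (c - a)) in Hl by lra. nra.
Qed.

(* Gaussian integral: [gq x ^ 2 + gk x] has zero derivative, so it is constantly [PI / 4]. *)
Definition gq (x : R) : R := RInt (fun t => exp (- t ^ 2)) 0 x.
Definition gk (x : R) : R := RInt (fun t => exp (- (x ^ 2 * (1 + t ^ 2))) / (1 + t ^ 2)) 0 1.

Lemma continuous_exp_sq s : continuous (fun t => exp (- t ^ 2)) s.
Proof.
  apply (ex_derive_continuous (V := R_NormedModule)). auto_derive. easy.
Qed.

Lemma is_derive_gq x : is_derive gq x (exp (- x ^ 2)).
Proof.
  apply (is_derive_RInt (V := R_NormedModule) (fun t => exp (- t ^ 2)) _ 0 x).
  - apply filter_forall; intros y. apply (RInt_correct (V := R_CompleteNormedModule)).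
    apply (ex_RInt_continuous (V := R_CompleteNormedModule)); intros; apply continuous_exp_sq.
  - apply continuous_exp_sq.
Qed.

(** Differentiating under the integral brings down the factor [1 + t ^ 2], which the denominator of
    [gk] is there to cancel. *)
Lemma is_derive_gk x :
  is_derive gk x (RInt (fun t => - 2 * x * exp (- (x ^ 2 * (1 + t ^ 2)))) 0 1).
Proof.
  assert (Hd : forall y t, is_derive (fun z => exp (- (z ^ 2 * (1 + t ^ 2))) / (1 + t ^ 2)) y
     (- 2 * y * exp (- (y ^ 2 * (1 + t ^ 2))))).
  { intros y t. assert (0 < 1 + t ^ 2) by (assert (H := pow2_ge_0 t); lra).
    auto_derive; [simpl in *; lra|]. simpl in *. field. simpl; lra. }
  apply (is_derive_ext_loc gk); [now apply filter_forall|].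
  erewrite RInt_ext.
  - apply (is_derive_RInt_param (fun x t => exp (- (x ^ 2 * (1 + t ^ 2))) / (1 + t ^ 2)) 0 1 x).
    + apply filter_forall; intros y t _. eexists; apply Hd.
    + intros t _.
      apply continuity_2d_pt_ext with (f := fun u v => - 2 * u * exp (- (u ^ 2 * (1 + v ^ 2)))).
      { intros u v. symmetry. apply is_derive_unique, Hd. }
      apply continuity_2d_pt_mult.
      * apply continuity_2d_pt_mult; [apply continuity_2d_pt_const|apply continuity_2d_pt_id1].
      * apply continuity_1d_2d_pt_comp.
        { apply derivable_continuous_pt, derivable_pt_exp. }
        apply continuity_2d_pt_opp, continuity_2d_pt_mult.
        { apply (continuity_1d_2d_pt_comp (fun u => u ^ 2) (fun u v => u)).
          - apply derivable_continuous_pt, derivable_pt_pow.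
          - apply continuity_2d_pt_id1. }
        apply continuity_2d_pt_plus; [apply continuity_2d_pt_const|].
        apply (continuity_1d_2d_pt_comp (fun u => u ^ 2) (fun u v => v)).
        { apply derivable_continuous_pt, derivable_pt_pow. }
        apply continuity_2d_pt_id2.
    + apply filter_forall; intros y. apply (ex_RInt_continuous (V := R_CompleteNormedModule)); intros t _.
      apply (ex_derive_continuous (V := R_NormedModule)). auto_derive.
      assert (H := pow2_ge_0 t). simpl in H. lra.
  - intros t _. symmetry. apply is_derive_unique, Hd.
Qed.

Lemma gq_gk x : gq x ^ 2 + gk x = PI / 4.
Proof.
  assert (H0 : gq 0 ^ 2 + gk 0 = PI / 4).
  { unfold gq. rewrite RInt_point. unfold gk.
    rewrite RInt_ext with (g := fun t => / (1 + t ^ 2)).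
    - rewrite (is_RInt_unique _ _ _ (atan 1 - atan 0)).
      + rewrite atan_1, atan_0. unfold zero; simpl. lra.
      + apply (is_RInt_derive (V := R_CompleteNormedModule) atan).
        * intros t _. apply (proj2 (is_derive_Reals atan t _)).
          apply derivable_pt_lim_atan.
        * intros t _. apply (ex_derive_continuous (V := R_NormedModule)). auto_derive.
          assert (H := pow2_ge_0 t). simpl in H. lra.
    - intros t _. replace (- (0 ^ 2 * (1 + t ^ 2))) with 0 by ring. rewrite exp_0. eqR. field.
      assert (H := pow2_ge_0 t). lra. }
  rewrite <- H0.
  assert (Hd : forall y : R, is_derive (fun x => gq x ^ 2 + gk x) y 0).
  { intros y.
    evar_last.
    - apply (is_derive_plus (V := R_NormedModule)).
      + apply (is_derive_pow gq 2). apply is_derive_gq.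
      + apply is_derive_gk.
    (* The substitution [u = y t] identifies the integral of [y exp (-(y t)^2)] over [0,1] with
       [gq y]; the derivatives of the two summands are then opposite. The added zeros give the
       bounds the affine form of the substitution rule. *)
    - assert (Hc : - (2 * exp (- y ^ 2) * gq y) = RInt (fun t => - 2 * y * exp (- (y ^ 2 * (1 + t ^ 2)))) 0 1).
      { unfold gq.
        replace (RInt (fun t => exp (- t ^ 2)) 0 y) with (RInt (fun t => exp (- t ^ 2)) (y * 0 + 0) (y * 1 + 0)) by (f_equal; ring).
        rewrite <- (RInt_comp_lin (V := R_CompleteNormedModule)).
        - assert (E2 : RInt (fun t => - 2 * y * exp (- (y ^ 2 * (1 + t ^ 2)))) 0 1 =
            - 2 * exp (- y ^ 2) * RInt (fun t => scal y (exp (- (y * t + 0) ^ 2))) 0 1).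
          { rewrite <- (RInt_scal (V := R_CompleteNormedModule) (fun t => scal y (exp (- (y * t + 0) ^ 2)))).
            - apply RInt_ext. intros t _. unfold scal; simpl; unfold mult; simpl.
              replace (- (y * (y * 1) * (1 + t * (t * 1)))) with (- (y * (y * 1)) + - ((y * t + 0) * ((y * t + 0) * 1))) by ring.
              rewrite exp_plus. ring.
            - apply (ex_RInt_continuous (V := R_CompleteNormedModule)); intros t _.
              apply (ex_derive_continuous (V := R_NormedModule)).
              unfold scal; simpl; unfold mult; simpl. auto_derive. easy. }
          rewrite E2. match goal with |- - (_ * ?a) = _ * ?b => change a with b end. ring.
        - apply (ex_RInt_continuous (V := R_CompleteNormedModule)); intros; apply continuous_exp_sq. }
      rewrite <- Hc. unfold plus; simpl. ring. }
  destruct (MVT_gen (fun x => gq x ^ 2 + gk x) 0 x (fun _ => 0)) as [c [_ Hc]].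
  - intros; apply Hd.
  - intros y _. eapply is_derive_continuity_pt, Hd.
  - lra.
Qed.

Lemma gk_bound x : 0 <= gk x <= exp (- x ^ 2).
Proof.
  assert (He : ex_RInt (fun t => exp (- (x ^ 2 * (1 + t ^ 2))) / (1 + t ^ 2)) 0 1).
  { apply (ex_RInt_continuous (V := R_CompleteNormedModule)); intros t _.
    apply (ex_derive_continuous (V := R_NormedModule)). auto_derive.
    assert (H := pow2_ge_0 t). simpl in H. lra. }
  split.
  - apply RInt_ge_0; [lra|easy|]. intros t _. assert (H := pow2_ge_0 t).
    apply Rlt_le, Rdiv_lt_0_compat; [apply exp_pos|lra].
  - replace (exp (- x ^ 2)) with (RInt (fun _ => exp (- x ^ 2)) 0 1).
    2:{ rewrite RInt_const. unfold scal; simpl; unfold mult; simpl; ring. }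
    apply RInt_le; [lra|easy|apply ex_RInt_const|].
    intros t _. assert (H := pow2_ge_0 t). assert (Hx := pow2_ge_0 x).
    apply Rle_trans with (exp (- (x ^ 2 * (1 + t ^ 2)))).
    + assert (Hp := exp_pos (- (x ^ 2 * (1 + t ^ 2)))).
      apply Rle_div_l; [lra|]. nra.
    + apply exp_le_mono. nra.
Qed.

Lemma gq_nonneg x : 0 <= x -> 0 <= gq x.
Proof.
  intros Hx. apply RInt_ge_0; [easy| |intros; left; apply exp_pos].
  apply (ex_RInt_continuous (V := R_CompleteNormedModule)); intros; apply continuous_exp_sq.
Qed.

Lemma gq_opp x : gq (- x) = - gq x.
Proof.
  unfold gq.
  replace (RInt (fun t => exp (- t ^ 2)) 0 (- x)) with (RInt (fun t => exp (- t ^ 2)) (-1 * 0 + 0) (-1 * x + 0)) by (f_equal; ring).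
  rewrite <- (RInt_comp_lin (V := R_CompleteNormedModule)).
  - rewrite (RInt_scal (V := R_CompleteNormedModule)).
    + rewrite (RInt_ext (V := R_CompleteNormedModule) _ (fun t => exp (- t ^ 2))).
      * unfold scal; simpl; unfold mult; simpl; ring.
      * intros t _. now replace ((-1 * t + 0) ^ 2) with (t ^ 2) by ring.
    + apply (ex_RInt_continuous (V := R_CompleteNormedModule)); intros t _.
      apply (ex_derive_continuous (V := R_NormedModule)). auto_derive. easy.
  - apply (ex_RInt_continuous (V := R_CompleteNormedModule)); intros; apply continuous_exp_sq.
Qed.

Lemma RInt_gauss_gq x : RInt gauss 0 x = sqrt 2 * gq (x / sqrt 2).
Proof.
  assert (H2 : 0 < sqrt 2) by (apply sqrt_lt_R0; lra).
  assert (Hss : sqrt 2 * sqrt 2 = 2) by (apply sqrt_sqrt; lra).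
  rewrite (is_RInt_unique gauss 0 x (minus (sqrt 2 * gq (x / sqrt 2)) (sqrt 2 * gq (0 / sqrt 2)))).
  - unfold gq at 2. replace (0 / sqrt 2) with 0 by (field; lra). rewrite RInt_point.
    unfold minus, plus, opp, zero; simpl. ring.
  - apply (is_RInt_derive (V := R_CompleteNormedModule) (fun x => sqrt 2 * gq (x / sqrt 2))).
    + intros t _. evar_last.
      * apply (is_derive_scal (fun t => gq (t / sqrt 2))).
        apply (is_derive_comp gq (fun t => t / sqrt 2)).
        -- apply is_derive_gq.
        -- instantiate (1 := / sqrt 2). auto_derive; [easy|]. ring.
      * unfold scal; simpl; unfold mult; simpl. unfold gauss.
        replace (- (t / sqrt 2 * (t / sqrt 2 * 1))) with (- t ^ 2 / 2).
        -- field. lra.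
        -- rewrite <- Hss at 1. field. lra.
    + intros; apply continuous_gauss.
Qed.

Lemma Phi_opp x : Phi (- x) = sqrt (2 * PI) - Phi x.
Proof.
  unfold Phi. rewrite !RInt_gauss_gq.
  replace (- x / sqrt 2) with (- (x / sqrt 2)) by (field; apply Rgt_not_eq, sqrt_lt_R0; lra).
  rewrite gq_opp. lra.
Qed.

Lemma sqrt_2PI_ge : 2 <= sqrt (2 * PI).
Proof.
  assert (H := PI2_3_2). apply Rle_trans with (sqrt (2 * 2)).
  - rewrite sqrt_square; lra.
  - apply sqrt_le_1; lra.
Qed.

(** With [h = sqrt (2 * PI) / 2] and [J] the integral from 0 to [x], the tail is [h - J], and the
    Gaussian identity reads [(h - J) (h + J) = 2 gk (x / sqrt 2)]. As [h + J >= 1], the tail is at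
    most [2 gk], which is at most [2 gauss x]. *)
Lemma Phi_tail x : 0 <= x -> 0 <= Phi (- x) <= 2 * gauss x.
Proof.
  intros Hx.
  assert (H2 : 0 < sqrt 2) by (apply sqrt_lt_R0; lra).
  assert (Hss : sqrt 2 * sqrt 2 = 2) by (apply sqrt_sqrt; lra).
  assert (HP := sqrt_2PI_ge). assert (HPP : sqrt (2 * PI) * sqrt (2 * PI) = 2 * PI).
  { apply sqrt_sqrt. assert (H := PI_RGT_0). lra. }
  rewrite Phi_opp. unfold Phi. rewrite RInt_gauss_gq.
  assert (Hq := gq_gk (x / sqrt 2)). assert (Hk := gk_bound (x / sqrt 2)).
  assert (Hn : 0 <= gq (x / sqrt 2)).
  { apply gq_nonneg. apply Rmult_le_pos; [easy|]. left. now apply Rinv_0_lt_compat. }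
  replace (exp (- (x / sqrt 2) ^ 2)) with (gauss x) in Hk.
  2:{ unfold gauss. f_equal. rewrite <- Hss at 1. field. lra. }
  set (J := sqrt 2 * gq (x / sqrt 2)) in *.
  assert (HJ : J * J = PI / 2 - 2 * gk (x / sqrt 2)).
  { unfold J. replace (sqrt 2 * gq (x / sqrt 2) * (sqrt 2 * gq (x / sqrt 2))) with
      (sqrt 2 * sqrt 2 * gq (x / sqrt 2) ^ 2) by ring. rewrite Hss. lra. }
  assert (0 <= J) by (apply Rmult_le_pos; lra).
  set (h := sqrt (2 * PI) / 2) in *.
  assert (Hh : h * h = PI / 2) by (unfold h; lra).
  assert (Hh1 : 1 <= h) by (unfold h; lra).
  replace (sqrt (2 * PI) - (J + h)) with (h - J) by (unfold h; lra).
  assert (Hd : (h - J) * (h + J) = 2 * gk (x / sqrt 2)) by (replace ((h - J) * (h + J)) with (h * h - J * J) by ring; lra).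
  split.
  - destruct (Rle_lt_dec 0 (h - J)); [easy|nra].
  - destruct (Rle_lt_dec (h - J) (2 * gauss x)); [easy|]. assert (Hg := gauss_pos x). nra.
Qed.

Lemma gauss_le_inv x : 0 < x -> gauss x <= 2 / x ^ 2.
Proof.
  intros Hx. unfold gauss. replace (- x ^ 2 / 2) with (- (x ^ 2 / 2)) by field.
  rewrite exp_Ropp. assert (H := exp_ineq1_le (x ^ 2 / 2)).
  assert (0 < x ^ 2) by (apply pow_lt; lra).
  replace (2 / x ^ 2) with (/ (x ^ 2 / 2)) by (field; lra).
  apply Rinv_le_contravar; lra.
Qed.

Lemma normal_cdf_Phi v x : 0 < v -> normal_cdf v x = Phi (x / sqrt v) / sqrt (2 * PI).
Proof.
  intros Hv.
  assert (Hs : 0 < sqrt v) by (now apply sqrt_lt_R0).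
  assert (Hss : sqrt v * sqrt v = v) by (apply sqrt_sqrt; lra).
  assert (HP := sqrt_2PI_ge).
  assert (HI : forall a, RInt (fun t => exp (- t ^ 2 / (2 * v)) / sqrt (2 * PI * v)) a x =
     Phi (x / sqrt v) / sqrt (2 * PI) - Phi (a / sqrt v) / sqrt (2 * PI)).
  { intros a. apply is_RInt_unique.
    apply (is_RInt_derive (V := R_CompleteNormedModule) (fun t => Phi (t / sqrt v) / sqrt (2 * PI))).
    - intros t _. evar_last.
      + apply (is_derive_ext (fun t => / sqrt (2 * PI) * Phi (t / sqrt v))).
        { intros; unfold Rdiv; apply Rmult_comm. }
        apply (is_derive_scal (fun t => Phi (t / sqrt v))).
        apply (is_derive_comp Phi (fun t => t / sqrt v)).
        * apply is_derive_Phi.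
        * instantiate (1 := / sqrt v). auto_derive; [easy|]. ring.
      + unfold scal; simpl; unfold mult; simpl. unfold gauss.
        rewrite (sqrt_mult (2 * PI) v) by (try lra; assert (H := PI_RGT_0); lra).
        replace (- (t / sqrt v) ^ 2 / 2) with (- t ^ 2 / (2 * v)).
        * simpl. field. lra.
        * rewrite <- Hss at 1. field. lra.
    - intros t _. apply (ex_derive_continuous (V := R_NormedModule)). auto_derive.
      easy. }
  unfold normal_cdf.
  rewrite (is_lim_unique _ m_infty (Phi (x / sqrt v) / sqrt (2 * PI))); [easy|].
  apply is_lim_spec. intros [e He]. simpl.
  (* This makes [u > 1 + 4 / e], so [u ^ 2 > 4 / e], and the tail bound [2 gauss u <= 4 / u ^ 2]
     falls below [e]. *)
  exists (- (sqrt v * (1 + 4 / e))). intros y Hy. rewrite HI.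
  replace (Phi (x / sqrt v) / sqrt (2 * PI) - Phi (y / sqrt v) / sqrt (2 * PI) - Phi (x / sqrt v) / sqrt (2 * PI))
    with (- (Phi (y / sqrt v) / sqrt (2 * PI))) by ring.
  assert (He4 : 0 < 4 / e) by (apply Rdiv_lt_0_compat; lra).
  set (u := - y / sqrt v).
  assert (Hu : 1 + 4 / e < u).
  { apply Rlt_div_r; [easy|]. lra. }
  replace (y / sqrt v) with (- u) by (unfold u; field; lra).
  assert (Ht := Phi_tail u ltac:(lra)).
  assert (Hg := gauss_le_inv u ltac:(lra)).
  rewrite Rabs_Ropp, Rabs_pos_eq.
  - apply Rlt_div_l; [lra|].
    assert (Hi : 2 / u ^ 2 < e / 2).
    { apply Rlt_div_l; [apply pow_lt; lra|].
      assert (4 / e < u ^ 2) by (simpl; nra).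
      assert (E4 : e / 2 * (4 / e) = 2) by (field; lra). rewrite <- E4 at 1. apply Rmult_lt_compat_l; lra. }
    nra.
  - apply Rmult_le_pos; [lra|]. left; apply Rinv_0_lt_compat; lra.
Qed.

(** * Riemann sums of the Gaussian density *)

Lemma sum_telescope_bound (a F G : nat -> R) (N : nat) :
  (forall k, (k <= N)%nat -> Rabs (a k - (F (S k) - F k)) <= G (S k) - G k) ->
  Rabs (sum_f_R0 a N - (F (S N) - F O)) <= G (S N) - G O.
Proof.
  induction N as [|N IH]; intros H; simpl.
  - now apply H.
  - replace (sum_f_R0 a N + a (S N) - (F (S (S N)) - F 0%nat)) with
      ((sum_f_R0 a N - (F (S N) - F 0%nat)) + (a (S N) - (F (S (S N)) - F (S N)))) by ring.
    eapply Rle_trans; [apply Rabs_triang|].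
    assert (H1 := H (S N) ltac:(lia)). assert (H2 := IH ltac:(intros; apply H; lia)). lra.
Qed.

Definition clamp (a b x : R) : R := Rmax a (Rmin b x).

Lemma clamp_low a b x : a <= b -> x <= a -> clamp a b x = a.
Proof. intros H1 H2. unfold clamp. rewrite Rmin_right, Rmax_left; lra. Qed.

Lemma clamp_high a b x : a <= b -> b <= x -> clamp a b x = b.
Proof. intros H1 H2. unfold clamp. rewrite Rmin_left, Rmax_right; lra. Qed.

Lemma clamp_mid a b x : a <= x <= b -> clamp a b x = x.
Proof. intros H. unfold clamp. rewrite Rmin_right, Rmax_right; lra. Qed.

Lemma clamp_increasing a b x y : x <= y -> clamp a b x <= clamp a b y.
Proof.
  intros H. unfold clamp. apply Rle_max_compat_l, Rle_min_compat_l, H.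
Qed.

Lemma clamp_lipschitz a b x h : a <= b -> 0 <= h -> clamp a b (x + h) - clamp a b x <= h.
Proof.
  intros Hab Hh. unfold clamp, Rmax, Rmin.
  destruct (Rle_dec b (x + h)), (Rle_dec b x);
    repeat match goal with |- context [Rle_dec ?u ?v] => destruct (Rle_dec u v) end; lra.
Qed.

(** Unit jumps used as error budget: along an increasing grid each rises only once, which pays for
    the one cell straddling [-om] and the one straddling [t]. The weak and strict inequalities match
    the closed conditions [-om <= x] and [x <= t] of the sum. *)
Definition step_ge (c x : R) : R := if Rle_dec c x then 1 else 0.
Definition step_gt (c x : R) : R := if Rle_dec x c then 0 else 1.

Lemma step_ge_1 c x : c <= x -> step_ge c x = 1.
Proof. intros H. unfold step_ge. destruct (Rle_dec c x); lra. Qed.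
Lemma step_ge_0 c x : x < c -> step_ge c x = 0.
Proof. intros H. unfold step_ge. destruct (Rle_dec c x); lra. Qed.
Lemma step_gt_0 c x : x <= c -> step_gt c x = 0.
Proof. intros H. unfold step_gt. destruct (Rle_dec x c); lra. Qed.
Lemma step_gt_1 c x : c < x -> step_gt c x = 1.
Proof. intros H. unfold step_gt. destruct (Rle_dec x c); lra. Qed.
Lemma step_gt_increasing c x y : x <= y -> step_gt c x <= step_gt c y.
Proof. intros H. unfold step_gt. destruct (Rle_dec x c), (Rle_dec y c); lra. Qed.

(* The clamped difference of [Phi] and all error terms telescope in [x]. *)
Lemma riemann_cell (om t h e x w : R) :
  0 <= h -> 0 <= e -> - om <= t <= om ->
  (- om <= x <= om -> Rabs (w - gauss x) <= e) ->
  Rabs ((if Rle_dec (- om) x then if Rle_dec x t then h * w else 0 else 0)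
        - (Phi (clamp (- om) t (x + h)) - Phi (clamp (- om) t x))) <=
  ((h + e) * clamp (- om) om (x + h) + h * (1 + e) * (step_ge (- om) (x + h) + step_gt t (x + h)))
  - ((h + e) * clamp (- om) om x + h * (1 + e) * (step_ge (- om) x + step_gt t x)).
Proof.
  intros Hh He Ht Hw.
  set (A := h + e). set (B := h * (1 + e)).
  assert (HA : 0 <= A) by (unfold A; lra).
  assert (HB : h <= B) by (unfold B; nra).
  assert (Hc := clamp_increasing (- om) om x (x + h) ltac:(lra)).
  assert (Hi := step_gt_increasing t x (x + h) ltac:(lra)).
  assert (HAc : 0 <= A * (clamp (- om) om (x + h) - clamp (- om) om x)) by (apply Rmult_le_pos; lra).
  assert (HBi : 0 <= B * (step_gt t (x + h) - step_gt t x)) by (apply Rmult_le_pos; lra).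
  destruct (Rle_dec (- om) x) as [H1|H1]; [destruct (Rle_dec x t) as [H2|H2]|].
  - rewrite (step_ge_1 _ x), (step_ge_1 _ (x + h)) by lra.
    specialize (Hw ltac:(lra)).
    rewrite (clamp_mid _ t x) by lra.
    destruct (Rle_lt_dec (x + h) t) as [H3|H3].
    + rewrite (step_gt_0 _ x), (step_gt_0 _ (x + h)) by lra.
      rewrite !clamp_mid by lra.
      assert (Hst := Phi_step x h Hh).
      replace (h * w - (Phi (x + h) - Phi x)) with (h * (w - gauss x) - (Phi (x + h) - Phi x - h * gauss x)) by ring.
      eapply Rle_trans; [apply Rabs_triang|]. rewrite Rabs_Ropp, Rabs_mult, (Rabs_pos_eq h) by easy.
      unfold A. nra.
    + rewrite (step_gt_0 _ x), (step_gt_1 _ (x + h)) in * by lra.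
      rewrite (clamp_high _ t (x + h)) by lra.
      assert (HL := Phi_lipschitz x t). rewrite (Rabs_pos_eq (t - x)) in HL by lra.
      assert (HI := Phi_increasing x t H2). rewrite Rabs_pos_eq in HL by lra.
      assert (Hg1 := gauss_le_1 x). assert (Hg2 := gauss_pos x).
      apply Rabs_le_between in Hw.
      assert (- (h * e) <= h * w <= B) by (unfold B; nra).
      assert (B = h + h * e) by (unfold B; ring).
      apply Rabs_le. lra.
  - rewrite (clamp_high _ t x), (clamp_high _ t (x + h)) by lra.
    rewrite (step_ge_1 _ x), (step_ge_1 _ (x + h)) by lra.
    rewrite !Rminus_diag, Rabs_R0. lra.
  - rewrite (step_ge_0 _ x) by lra. rewrite (clamp_low _ t x) by lra.
    destruct (Rle_lt_dec (- om) (x + h)) as [H3|H3].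
    + rewrite (step_ge_1 _ (x + h)) by lra.
      assert (Hl := clamp_lipschitz (- om) t x h ltac:(lra) Hh). rewrite (clamp_low _ t x) in Hl by lra.
      assert (Hl2 : - om <= clamp (- om) t (x + h)) by apply Rmax_l.
      assert (HL := Phi_lipschitz (- om) (clamp (- om) t (x + h))).
      rewrite (Rabs_pos_eq (_ - - om)) in HL by lra.
      rewrite Rminus_0_l, Rabs_Ropp. lra.
    + rewrite (step_ge_0 _ (x + h)), (clamp_low _ t (x + h)) by lra.
      rewrite !Rminus_diag, Rabs_R0. lra.
Qed.

(** Point [k] stands for the cell from [s k] to [s k + h], so the last cell ends at the fictitious
    level [S N]. The bound is the telescoped budget: length [2 * om] at rate [h + e], plus two
    boundary cells. *)
Lemma riemann_gauss (N : nat) (s : nat -> R) (h om e t : R) (w : nat -> R) :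
  0 <= h -> 0 <= e -> - om <= t <= om ->
  (forall k, s (S k) = s k + h) ->
  s O <= - om -> om <= s (S N) ->
  (forall k, (k <= N)%nat -> - om <= s k <= om -> Rabs (w k - gauss (s k)) <= e) ->
  Rabs (sum_f_R0 (fun k => if Rle_dec (- om) (s k) then if Rle_dec (s k) t then h * w k else 0 else 0) N
        - (Phi t - Phi (- om))) <= 2 * om * (h + e) + 2 * (h * (1 + e)).
Proof.
  intros Hh He Ht Hs H0 HN Hw.
  assert (HF := sum_telescope_bound
    (fun k => if Rle_dec (- om) (s k) then if Rle_dec (s k) t then h * w k else 0 else 0)
    (fun k => Phi (clamp (- om) t (s k)))
    (fun k => (h + e) * clamp (- om) om (s k) + h * (1 + e) * (step_ge (- om) (s k) + step_gt t (s k))) N).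
  cbv beta in HF. rewrite (clamp_low _ t (s O)), (clamp_high _ t (s (S N))) in HF by lra.
  eapply Rle_trans; [apply HF|].
  - intros k Hk. rewrite Hs. apply riemann_cell; auto.
  - rewrite (clamp_low _ om (s O)), (clamp_high _ om (s (S N))) by lra.
    assert (HB : 0 <= h * (1 + e)) by (apply Rmult_le_pos; lra).
    unfold step_ge, step_gt.
    repeat match goal with |- context [Rle_dec ?a ?b] => destruct (Rle_dec a b) end; lra.
Qed.

(** * Configurations, the measure and the pseudolikelihood *)

Lemma sumlist_app l1 l2 : sumlist (l1 ++ l2) = sumlist l1 + sumlist l2.
Proof. induction l1 as [|a l1 IH]; simpl; [ring|rewrite IH; ring]. Qed.

Lemma sumlist_flat_map {A B : Type} (f : B -> R) (g : A -> list B) (l : list A) :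
  sumlist (map f (flat_map g l)) = sumlist (map (fun x => sumlist (map f (g x))) l).
Proof.
  induction l as [|a l IH]; simpl; [easy|]. now rewrite map_app, sumlist_app, IH.
Qed.

Lemma sumlist_map_ext_in {A : Type} (f g : A -> R) (l : list A) :
  (forall x, In x l -> f x = g x) -> sumlist (map f l) = sumlist (map g l).
Proof. intros H. now rewrite (map_ext_in f g). Qed.

Lemma sumlist_map_le {A : Type} (f g : A -> R) (l : list A) :
  (forall x, In x l -> f x <= g x) -> sumlist (map f l) <= sumlist (map g l).
Proof.
  induction l as [|a l IH]; simpl; intros H; [lra|].
  assert (H1 := H a (or_introl eq_refl)). assert (H2 := IH (fun x Hx => H x (or_intror Hx))). lra.
Qed.

Lemma sumlist_map_scal_r {A : Type} (f : A -> R) (c : R) (l : list A) :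
  sumlist (map (fun x => f x * c) l) = sumlist (map f l) * c.
Proof. induction l as [|a l IH]; simpl; [ring|rewrite IH; ring]. Qed.

Lemma map_nth_seq_id (X : list R) : map (fun i => nth i X 0) (seq 0 (length X)) = X.
Proof.
  induction X as [|a X IH]; simpl; [easy|]. f_equal.
  rewrite <- seq_shift, map_map. exact IH.
Qed.

(** Each further index contributes a free sum over the sites, so the sum over tuples factorizes;
    this is what makes the model depend on the total spin alone. *)
Lemma sum_tuples (X : list R) (p : nat) :
  sumlist (map (fun t => prodlist (map (fun i => nth i X 0) t)) (tuples (length X) p)) = sumlist X ^ p.
Proof.
  induction p as [|p IH]; simpl; [ring|].
  rewrite sumlist_flat_map, <- IH.
  erewrite sumlist_map_ext_in.
  2:{ intros t _. rewrite map_map. simpl. rewrite sumlist_map_scal_r, map_nth_seq_id. apply Rmult_comm. }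
  rewrite sumlist_map_scal_r. ring.
Qed.

(** The Hamiltonian for [b = 1] as a function of the total spin. The argument is real so that the
    values [y - 2] and [y + 2] after one flip can be inserted directly. *)
Definition energy (p N : nat) (y : R) : R := / INR N ^ (p - 1) * y ^ p.

Lemma hamil_energy b p X : hamil b p X = b * energy p (length X) (sumlist X).
Proof. unfold hamil, energy. rewrite sum_tuples. ring. Qed.

Lemma flip_length i X : length (flip i X) = length X.
Proof. revert i; induction X as [|a X IH]; intros [|i]; simpl; auto. Qed.

Lemma sumlist_flip i X : sumlist (flip i X) = sumlist X - 2 * nth i X 0.
Proof.
  revert i; induction X as [|a X IH]; intros [|i]; simpl; try ring. rewrite IH. ring.
Qed.

(** * Reduction to the number of ones *)

Fixpoint npos (X : list R) : nat :=
  match X with [] => O | a :: l => if Rlt_dec 0 a then S (npos l) else npos l end.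

Lemma npos_cons_1 X : npos (1 :: X) = S (npos X).
Proof. simpl. destruct (Rlt_dec 0 1); [easy|exfalso; lra]. Qed.
Lemma npos_cons_m1 X : npos (-1 :: X) = npos X.
Proof. simpl. destruct (Rlt_dec 0 (-1)); [exfalso; lra|easy]. Qed.

Lemma configs_spec N X : In X (configs N) -> length X = N /\ List.Forall (fun a => a = 1 \/ a = -1) X.
Proof.
  revert X; induction N as [|N IH]; intros X H.
  - simpl in H. destruct H as [<-|[]]. easy.
  - cbn [configs] in H. apply in_flat_map in H as [Y [HY HX]].
    destruct (IH Y HY) as [H1 H2].
    destruct HX as [<-|[<-|[]]]; simpl; (split; [now rewrite H1|constructor; auto]).
Qed.

Lemma npos_le X : (npos X <= length X)%nat.
Proof. induction X as [|a X IH]; simpl; [lia|]. destruct (Rlt_dec 0 a); lia. Qed.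

Lemma sumlist_npos X : List.Forall (fun a => a = 1 \/ a = -1) X ->
  sumlist X = 2 * INR (npos X) - INR (length X).
Proof.
  induction 1 as [|a X Ha _ IH]; [simpl; ring|].
  change (length (a :: X)) with (S (length X)). change (sumlist (a :: X)) with (a + sumlist X).
  destruct Ha as [-> | ->]; rewrite ?npos_cons_1, ?npos_cons_m1, ?S_INR, IH; ring.
Qed.

Lemma prodlist_pow (f : R -> R) X : List.Forall (fun a => a = 1 \/ a = -1) X ->
  prodlist (map f X) = f 1 ^ npos X * f (-1) ^ (length X - npos X).
Proof.
  induction 1 as [|a X Ha _ IH]; [simpl; ring|].
  change (length (a :: X)) with (S (length X)).
  change (prodlist (map f (a :: X))) with (f a * prodlist (map f X)). rewrite IH.
  assert (Hl := npos_le X).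
  destruct Ha as [-> | ->]; rewrite ?npos_cons_1, ?npos_cons_m1.
  - simpl. ring.
  - replace (S (length X) - npos X)%nat with (S (length X - npos X)) by lia. simpl. ring.
Qed.

Lemma configs_nonempty N : configs N <> [].
Proof.
  induction N as [|N IH]; simpl; [easy|]. destruct (configs N); [easy|]. easy.
Qed.

Lemma ZN_pos b p N : 0 < ZN b p N.
Proof.
  unfold ZN. assert (H := configs_nonempty N). destruct (configs N) as [|X l]; [easy|].
  simpl. apply Rplus_lt_le_0_compat.
  - apply Rdiv_lt_0_compat; [apply exp_pos|apply pow_lt; lra].
  - clear H. induction l as [|Y l IH]; simpl; [lra|].
    apply Rplus_le_le_0_compat; [|easy].
    apply Rlt_le, Rdiv_lt_0_compat; [apply exp_pos|apply pow_lt; lra].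
Qed.

Lemma condP_energy b p i X :
  condP b p i X = / (1 + exp (b * (energy p (length X) (sumlist X - 2 * nth i X 0)
                                   - energy p (length X) (sumlist X)))).
Proof.
  unfold condP, Pmeas. rewrite flip_length, !hamil_energy, flip_length, sumlist_flip.
  set (a := energy p (length X) (sumlist X)). set (c := energy p (length X) _).
  replace (b * (c - a)) with (b * c + - (b * a)) by ring.
  rewrite exp_plus, exp_Ropp.
  assert (Ha := exp_pos (b * a)). assert (Hc := exp_pos (b * c)).
  assert (HZ := ZN_pos b p (length X)).
  assert (H2 : 0 < 2 ^ length X) by (apply pow_lt; lra).
  field. repeat split; lra.
Qed.

(** Minus the log-pseudolikelihood: [n1] sites carry 1 and [n2] carry -1, and [d1], [d2] are the
    energy changes on flipping a site of either kind. As a sum of softplus functions it is convex in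
    [b]. *)
Definition nlogPL (n1 n2 d1 d2 b : R) : R := n1 * ln (1 + exp (b * d1)) + n2 * ln (1 + exp (b * d2)).

Lemma PL_nlogPL p X b : List.Forall (fun a => a = 1 \/ a = -1) X ->
  let N := length X in let y := 2 * INR (npos X) - INR N in
  PL p X b = exp (- nlogPL (INR (npos X)) (INR (N - npos X))
    (energy p N (y - 2) - energy p N y) (energy p N (y + 2) - energy p N y) b).
Proof.
  intros HX N y. unfold PL.
  set (f := fun x => / (1 + exp (b * (energy p N (y - 2 * x) - energy p N y)))).
  rewrite (map_ext _ (fun i => f (nth i X 0))).
  2:{ intros i. rewrite condP_energy, (sumlist_npos X HX). easy. }
  rewrite <- (map_map (fun i => nth i X 0) f), map_nth_seq_id, prodlist_pow by easy.
  assert (Hf : forall x k, f x ^ k = exp (- (INR k * ln (1 + exp (b * (energy p N (y - 2 * x) - energy p N y)))))).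
  { intros x k. unfold f. set (u := exp _). assert (Hu : 0 < u) by apply exp_pos.
    rewrite pow_inv, <- (Rpower_pow k (1 + u)) by lra. unfold Rpower. now rewrite exp_Ropp. }
  rewrite !Hf, <- exp_plus. f_equal. unfold nlogPL.
  replace (y - 2 * 1) with (y - 2) by ring. replace (y - 2 * -1) with (y + 2) by ring. change (length X) with N. ring.
Qed.

(** Pascal's rule in summed form: a prepended spin either raises the number of ones or keeps it. *)
Lemma sum_binomial_succ (f : nat -> R) (N : nat) :
  sum_f_R0 (fun k => Binomial.C N k * (f (S k) + f k)) N = sum_f_R0 (fun k => Binomial.C (S N) k * f k) (S N).
Proof.
  rewrite (decomp_sum (fun k => Binomial.C (S N) k * f k) (S N)) by lia. cbn [Nat.pred].

  destruct N as [|N].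
  - simpl. unfold Binomial.C. simpl. field.
  - rewrite (tech5 (fun i => Binomial.C (S (S N)) (S i) * f (S i))).
    rewrite (sum_eq (fun i => Binomial.C (S (S N)) (S i) * f (S i)) (fun i => Binomial.C (S N) i * f (S i) + Binomial.C (S N) (S i) * f (S i)) N).
    2:{ intros i Hi. rewrite <- pascal by lia. ring. }
    rewrite (sum_eq (fun k => Binomial.C (S N) k * (f (S k) + f k)) (fun k => Binomial.C (S N) k * f (S k) + Binomial.C (S N) k * f k) (S N)).
    2:{ intros; ring. }
    rewrite !sum_plus. rewrite (tech5 (fun k => Binomial.C (S N) k * f (S k))).
    rewrite (decomp_sum (fun k => Binomial.C (S N) k * f k)) by lia. cbn [Nat.pred].
    assert (E : forall n, Binomial.C n n = 1).
    { intros n. unfold Binomial.C. rewrite Nat.sub_diag. simpl. field. apply INR_fact_neq_0. }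
    assert (E0 : forall n, Binomial.C n 0 = 1).
    { intros n. unfold Binomial.C. rewrite Nat.sub_0_r. simpl. field. apply INR_fact_neq_0. }
    rewrite ?E, ?E0. ring.
Qed.

Lemma sum_configs (f : nat -> R) (N : nat) :
  sumlist (map (fun X => f (npos X)) (configs N)) = sum_f_R0 (fun k => Binomial.C N k * f k) N.
Proof.
  revert f; induction N as [|N IH]; intros f.
  - simpl. unfold Binomial.C. simpl. field.
  - rewrite <- sum_binomial_succ, <- IH. cbn [configs]. rewrite sumlist_flat_map.
    apply sumlist_map_ext_in. intros X _. cbn [map]. rewrite npos_cons_1, npos_cons_m1. simpl. ring.
Qed.

Definition weight (b : R) (p N k : nat) : R := Binomial.C N k * exp (b * energy p N (2 * INR k - INR N)).

Lemma C_pos n k : 0 < Binomial.C n k.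
Proof.
  unfold Binomial.C. apply Rdiv_lt_0_compat; [|apply Rmult_lt_0_compat]; apply INR_fact_lt_0.
Qed.

Lemma weight_pos b p N k : 0 < weight b p N k.
Proof. apply Rmult_lt_0_compat; [apply C_pos|apply exp_pos]. Qed.

Lemma ZN_weight b p N : 2 ^ N * ZN b p N = sum_f_R0 (weight b p N) N.
Proof.
  unfold ZN, weight.
  rewrite <- (sum_configs (fun k => exp (b * energy p N (2 * INR k - INR N)))).
  unfold Rdiv. rewrite sumlist_map_scal_r.
  rewrite (sumlist_map_ext_in (fun x => exp (hamil b p x)) (fun X => exp (b * energy p N (2 * INR (npos X) - INR N)))).
  - field. apply pow_nonzero. lra.
  - intros X HX. destruct (configs_spec N X HX) as [H1 H2].
    rewrite hamil_energy, (sumlist_npos X H2), H1. easy.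
Qed.

(** The estimate may differ between configurations of the same level, so the distribution function
    is not itself a sum over levels. Bounding the event by functions of [npos] makes it comparable
    to such sums. *)
Lemma cdf_stat_bounds b p N bhat x (lo up : nat -> R) :
  (forall X, In X (configs N) ->
     lo (npos X) <= (if Rle_dec (sqrt (INR N) * (bhat X - b)) x then 1 else 0) <= up (npos X)) ->
  sum_f_R0 (fun k => weight b p N k * lo k) N / sum_f_R0 (weight b p N) N <= cdf_stat b p N bhat x
  <= sum_f_R0 (fun k => weight b p N k * up k) N / sum_f_R0 (weight b p N) N.
Proof.
  intros H.
  assert (HZ : 0 < sum_f_R0 (weight b p N) N).
  { rewrite <- ZN_weight. apply Rmult_lt_0_compat; [apply pow_lt; lra|apply ZN_pos]. }
  assert (HS : forall f, sum_f_R0 (fun k => weight b p N k * f k) N / sum_f_R0 (weight b p N) N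
    = sumlist (map (fun X => Pmeas b p X * f (npos X)) (configs N))).
  { intros f. unfold weight at 1.
    rewrite (sum_eq _ (fun k => Binomial.C N k * (exp (b * energy p N (2 * INR k - INR N)) * f k))) by (intros; ring).
    rewrite <- (sum_configs (fun k => exp (b * energy p N (2 * INR k - INR N)) * f k)).
    unfold Rdiv. rewrite <- sumlist_map_scal_r. apply sumlist_map_ext_in. intros X HX.
    destruct (configs_spec N X HX) as [H1 H2].
    unfold Pmeas. rewrite H1, ZN_weight, hamil_energy, (sumlist_npos X H2), H1. field. lra. }
  assert (HP : forall X, In X (configs N) -> 0 < Pmeas b p X).
  { intros X HX. destruct (configs_spec N X HX) as [H1 H2].
    unfold Pmeas. rewrite H1, ZN_weight. apply Rdiv_lt_0_compat; [apply exp_pos|easy]. }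
  rewrite !HS. unfold cdf_stat. split; apply sumlist_map_le; intros X HX;
    specialize (H X HX); specialize (HP X HX); destruct (Rle_dec _ x); nra.
Qed.

(** * Weights of the magnetization levels *)

Lemma ln_le_minus_1 x : 0 < x -> ln x <= x - 1.
Proof. intros Hx. assert (H := exp_ineq1_le (ln x)). rewrite exp_ln in H; lra. Qed.

Lemma ln_succ_bounds (n : nat) : (1 <= n)%nat ->
  / (INR n + 1) <= ln (INR n + 1) - ln (INR n) <= / INR n.
Proof.
  intros Hn. assert (0 < INR n) by (apply lt_0_INR; lia). split.
  - assert (E := ln_le_minus_1 (INR n / (INR n + 1)) ltac:(apply Rdiv_lt_0_compat; lra)).
    rewrite ln_div in E by lra.
    replace (INR n / (INR n + 1) - 1) with (- / (INR n + 1)) in E by (field; lra). lra.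
  - assert (E := ln_le_minus_1 ((INR n + 1) / INR n) ltac:(apply Rdiv_lt_0_compat; lra)).
    rewrite ln_div in E by lra.
    replace ((INR n + 1) / INR n - 1) with (/ INR n) in E by (field; lra). lra.
Qed.

(** Induction comparing increments through [1/(n+1) <= ln (n+1) - ln n <= 1/n]; the logarithmic
    slack is affordable because only the far levels and one reference level rely on it. *)
Lemma ln_fact_bounds (n : nat) : (1 <= n)%nat ->
  INR n * ln (INR n) - INR n <= ln (INR (fact n)) <= INR n * ln (INR n) - INR n + 1 + ln (INR n).
Proof.
  intros Hn. induction n as [|n IH]; [lia|].
  destruct (Nat.eq_dec n 0) as [->|Hn0].
  - simpl. rewrite ln_1. lra.
  - specialize (IH ltac:(lia)). assert (Hs := ln_succ_bounds n ltac:(lia)).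
    assert (0 < INR n) by (apply lt_0_INR; lia).
    change (fact (S n)) with (S n * fact n)%nat. rewrite mult_INR, ln_mult; try apply lt_0_INR; try lia.
    2:{ apply lt_O_fact. }
    rewrite S_INR.
    assert (INR n * (ln (INR n + 1) - ln (INR n)) <= 1).
    { apply Rle_trans with (INR n * / INR n); [apply Rmult_le_compat_l; lra|right; field; lra]. }
    assert (1 <= (INR n + 1) * (ln (INR n + 1) - ln (INR n))).
    { apply Rle_trans with ((INR n + 1) * / (INR n + 1)); [right; field; lra|apply Rmult_le_compat_l; lra]. }
    lra.
Qed.

(** A bound uniform in [n]; the case [n = 0] fits because [0 * ln 0] is 0. *)
Lemma ln_fact_error (n N : nat) : (n <= N)%nat -> (1 <= N)%nat ->
  0 <= ln (INR (fact n)) - (INR n * ln (INR n) - INR n) <= 1 + ln (INR N).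
Proof.
  intros H1 H2.
  assert (0 <= ln (INR N)) by (rewrite <- ln_1; apply ln_le; [lra|apply (le_INR 1); lia]).
  destruct (Nat.eq_dec n 0) as [->|Hn0].
  - simpl. rewrite ln_1. lra.
  - assert (H3 := ln_fact_bounds n ltac:(lia)).
    assert (ln (INR n) <= ln (INR N)) by (apply ln_le; [apply lt_0_INR; lia|now apply le_INR]). lra.
Qed.

Definition mag (N k : nat) : R := (2 * INR k - INR N) / INR N.

Lemma energy_mag p N k : (1 <= p)%nat -> (1 <= N)%nat ->
  energy p N (2 * INR k - INR N) = INR N * mag N k ^ p.
Proof.
  intros Hp HN. assert (0 < INR N) by (apply lt_0_INR; lia).
  unfold energy. replace (2 * INR k - INR N) with (INR N * mag N k) by (unfold mag; field; lra).
  rewrite Rpow_mult_distr. replace p with (S (p - 1)) at 2 by lia. simpl. field.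
  apply pow_nonzero. lra.
Qed.

Lemma mag_bounds N k : (1 <= N)%nat -> (k <= N)%nat -> -1 <= mag N k <= 1.
Proof.
  intros HN Hk. assert (0 < INR N) by (apply lt_0_INR; lia). assert (INR k <= INR N) by now apply le_INR.
  assert (0 <= INR k) by apply pos_INR.
  unfold mag. split; [apply Rle_div_r|apply Rle_div_l]; lra.
Qed.

Lemma mag_S N k : (1 <= N)%nat -> mag N (S k) = mag N k + 2 / INR N.
Proof. intros HN. assert (0 < INR N) by (apply lt_0_INR; lia). unfold mag. rewrite S_INR. field. lra. Qed.

Lemma ln_weight b p N k : (1 <= p)%nat -> (1 <= N)%nat -> (k <= N)%nat ->
  ln (weight b p N k) = ln (INR (fact N)) - ln (INR (fact k)) - ln (INR (fact (N - k)))
    + b * (INR N * mag N k ^ p).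
Proof.
  intros Hp HN Hk. unfold weight.
  assert (F : forall n, 0 < INR (fact n)) by (intros; apply INR_fact_lt_0).
  rewrite ln_mult, ln_exp, energy_mag by (try apply C_pos; try apply exp_pos; lia).
  unfold Binomial.C. rewrite ln_div, ln_mult by (try apply Rmult_lt_0_compat; apply F). ring.
Qed.

(** The terms [n ln n - n] of the three factorials assemble into [N (ln 2 - I x)]. This also covers
    [k = 0] and [k = N]. *)
Lemma ln_weight_crude b p N k : (1 <= p)%nat -> (1 <= N)%nat -> (k <= N)%nat ->
  Rabs (ln (weight b p N k) - INR N * (ln 2 + Hfun b p (mag N k))) <= 2 * (1 + ln (INR N)).
Proof.
  intros Hp HN Hk. rewrite ln_weight by easy.
  assert (H1 := ln_fact_error N N ltac:(lia) HN).
  assert (H2 := ln_fact_error k N ltac:(lia) HN).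
  assert (H3 := ln_fact_error (N - k) N ltac:(lia) HN).
  assert (HN0 : 0 < INR N) by (apply lt_0_INR; lia).
  (* Applied with [j = k] and [j = N - k], for which [2 j / N] is [1 + x] and [1 - x]. *)
  assert (E : forall j, (j <= N)%nat -> INR N * (2 * INR j / INR N * ln (2 * INR j / INR N)) =
     2 * (INR j * (ln 2 + ln (INR j) - ln (INR N)))).
  { intros j Hj. destruct (Nat.eq_dec j 0) as [->|Hj0]; [simpl; field; lra|].
    assert (0 < INR j) by (apply lt_0_INR; lia).
    rewrite ln_div, ln_mult by lra. field. lra. }
  assert (E1 := E k Hk). assert (E2 := E (N - k)%nat ltac:(lia)).
  replace (2 * INR k / INR N) with (1 + mag N k) in E1 by (unfold mag; field; lra).
  rewrite minus_INR in * by easy.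
  replace (2 * (INR N - INR k) / INR N) with (1 - mag N k) in E2 by (unfold mag; field; lra).
  unfold Hfun, Ient. apply Rabs_le.
  set (u := (1 + mag N k) * ln (1 + mag N k)) in *. set (v := (1 - mag N k) * ln (1 - mag N k)) in *.
  replace (INR N * (ln 2 + (b * mag N k ^ p - / 2 * (u + v)))) with
    (INR N * ln 2 + b * (INR N * mag N k ^ p) - / 2 * (INR N * u + INR N * v)) by ring.
  rewrite E1, E2. split; lra.
Qed.

Lemma pow_bounds p x y : 0 <= x <= y -> INR p * x ^ (p - 1) * (y - x) <= y ^ p - x ^ p <= INR p * y ^ (p - 1) * (y - x).
Proof.
  intros H. destruct (MVT_gen (fun z => z ^ p) x y (fun z => INR p * z ^ (p - 1))) as [c [Hc E]].
  - intros. auto_derive; [easy|]. replace (Nat.pred p) with (p - 1)%nat by lia. ring.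
  - intros. apply derivable_continuous_pt, derivable_pt_pow.
  - rewrite Rmin_left, Rmax_right in Hc by lra. rewrite E.
    assert (0 <= INR p) by apply pos_INR.
    assert (x ^ (p - 1) <= c ^ (p - 1)) by (apply pow_incr; lra).
    assert (c ^ (p - 1) <= y ^ (p - 1)) by (apply pow_incr; lra).
    split; apply Rmult_le_compat_r; try lra; apply Rmult_le_compat_l; lra.
Qed.

Lemma pow_lip p x y : 0 <= x <= y -> y <= 1 -> 0 <= y ^ p - x ^ p <= INR p * (y - x).
Proof.
  intros H H1. assert (Hb := pow_bounds p x y H). assert (0 <= INR p) by apply pos_INR.
  assert (0 <= x ^ (p - 1)) by (apply pow_le; lra).
  assert (y ^ (p - 1) <= 1) by (rewrite <- (pow1 (p - 1)); apply pow_incr; lra).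
  assert (Hq : 0 <= INR p * (y - x)) by (apply Rmult_le_pos; lra).
  split; [|assert (Hq2 : 0 <= INR p * (y - x) * (1 - y ^ (p - 1))) by (apply Rmult_le_pos; lra); lra].
  assert (0 <= INR p * x ^ (p - 1) * (y - x)); [|lra]. apply Rmult_le_pos; [apply Rmult_le_pos|]; lra.
Qed.

(** The mean value bounds squeeze the increment between the slopes at both ends, and these slopes
    differ by [O(y - x)] on [0,1]. *)
Lemma pow_increment p x y : 0 <= x <= y -> y <= 1 ->
  0 <= y ^ p - x ^ p - INR p * x ^ (p - 1) * (y - x) <= INR p * INR p * (y - x) ^ 2 /\
  0 <= INR p * y ^ (p - 1) * (y - x) - (y ^ p - x ^ p) <= INR p * INR p * (y - x) ^ 2.
Proof.
  intros H H1. assert (Hb := pow_bounds p x y H). assert (Hl := pow_lip (p - 1) x y H H1).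
  assert (0 <= INR p) by apply pos_INR.
  assert (INR (p - 1) <= INR p) by (apply le_INR; lia).
  assert (y ^ (p - 1) - x ^ (p - 1) <= INR p * (y - x)) by nra.
  assert (INR p * (y - x) * (y ^ (p - 1) - x ^ (p - 1)) <= INR p * (y - x) * (INR p * (y - x))).
  { apply Rmult_le_compat_l; nra. }
  split; split; try lra; nra.
Qed.

(** The binomial ratio [(N - k) / (k + 1)] gives [ln (1 - x) - ln (1 + x + 2/N)], that is
    [-2 artanh x] up to [2/N]; the energy gives [b N ((x + 2/N)^p - x^p)], which is [2 b p x^(p-1)]
    up to [O(1/N)]. *)
Lemma ln_weight_ratio b p N k : (1 <= p)%nat -> (1 <= N)%nat -> (k < N)%nat -> 0 <= mag N k ->
  Rabs (ln (weight b p N (S k)) - ln (weight b p N k) - 2 * dH b p (mag N k))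
  <= (2 + 4 * (Rabs b * (INR p * INR p))) / INR N.
Proof.
  intros Hp HN Hk Hx. rewrite !ln_weight by lia.
  assert (F : forall n, 0 < INR (fact n)) by (intros; apply INR_fact_lt_0).
  assert (HN0 : 0 < INR N) by (apply lt_0_INR; lia).
  assert (HkN : INR k + 1 <= INR N) by (rewrite <- S_INR; apply le_INR; lia).
  assert (E1 : ln (INR (fact (S k))) = ln (INR k + 1) + ln (INR (fact k))).
  { change (fact (S k)) with (S k * fact k)%nat. rewrite mult_INR, ln_mult; [|apply lt_0_INR; lia|apply F].
    now rewrite S_INR. }
  assert (E2 : ln (INR (fact (N - k))) = ln (INR N - INR k) + ln (INR (fact (N - S k)))).
  { replace (N - k)%nat with (S (N - S k)) by lia.
    change (fact (S (N - S k))) with (S (N - S k) * fact (N - S k))%nat.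
    rewrite mult_INR, ln_mult; [|apply lt_0_INR; lia|apply F].
    replace (S (N - S k)) with (N - k)%nat by lia. now rewrite minus_INR by lia. }
  rewrite E1, E2. rewrite mag_S by easy.
  set (x := mag N k) in *.
  assert (Hxk : INR k = INR N * (1 + x) / 2) by (unfold x, mag; field; lra).
  assert (H2N : 0 < 2 / INR N) by (apply Rdiv_lt_0_compat; lra).
  assert (Hx1 : x + 2 / INR N <= 1).
  { unfold x. rewrite <- mag_S by easy. apply mag_bounds; lia. }
  assert (E3 : ln (INR k + 1) = ln (INR N / 2) + ln (1 + x + 2 / INR N)).
  { rewrite <- ln_mult by lra. f_equal. rewrite Hxk. field. lra. }
  assert (E4 : ln (INR N - INR k) = ln (INR N / 2) + ln (1 - x)).
  { rewrite <- ln_mult by lra. f_equal. rewrite Hxk. field. }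
  rewrite E3, E4. unfold dH, ath.
  assert (Hln : 0 <= ln (1 + x + 2 / INR N) - ln (1 + x) <= 2 / INR N).
  { split.
    - assert (ln (1 + x) <= ln (1 + x + 2 / INR N)) by (apply ln_le; lra). lra.
    - assert (E := ln_le_minus_1 ((1 + x + 2 / INR N) / (1 + x)) ltac:(apply Rdiv_lt_0_compat; lra)).
      rewrite ln_div in E by lra. eapply Rle_trans; [apply E|].
      replace ((1 + x + 2 / INR N) / (1 + x) - 1) with (2 / INR N / (1 + x)) by (field; lra).
      apply Rle_div_l; nra. }
  destruct (pow_increment p x (x + 2 / INR N) ltac:(lra) Hx1) as [Hpw _].
  replace (x + 2 / INR N - x) with (2 / INR N) in Hpw by ring.
  set (D := (x + 2 / INR N) ^ p - x ^ p - INR p * x ^ (p - 1) * (2 / INR N)) in *.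
  match goal with |- Rabs ?e <= _ => replace e with
     (- (ln (1 + x + 2 / INR N) - ln (1 + x)) + b * (INR N * D)) end.
  2:{ unfold D. field. lra. }
  eapply Rle_trans; [apply Rabs_triang|].
  rewrite Rabs_Ropp, Rabs_pos_eq, !Rabs_mult, (Rabs_pos_eq D), (Rabs_pos_eq (INR N)) by lra.
  replace ((2 + 4 * (Rabs b * (INR p * INR p))) / INR N) with
    (2 / INR N + Rabs b * (INR N * (INR p * INR p * (2 / INR N) ^ 2))) by (field; lra).
  apply Rplus_le_compat; [lra|]. apply Rmult_le_compat_l; [apply Rabs_pos|].
  apply Rmult_le_compat_l; lra.
Qed.

Lemma steps_bound (r : nat -> R) (B : R) (i j : nat) : (i <= j)%nat ->
  (forall t, (i <= t < j)%nat -> Rabs (r (S t) - r t) <= B) ->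
  Rabs (r j - r i) <= B * (INR j - INR i).
Proof.
  intros Hij. induction Hij as [|j Hij IH]; intros H.
  - rewrite !Rminus_diag, Rabs_R0. lra.
  - specialize (IH ltac:(intros; apply H; lia)). specialize (H j ltac:(lia)).
    rewrite S_INR. replace (r (S j) - r i) with ((r (S j) - r j) + (r j - r i)) by ring.
    eapply Rle_trans; [apply Rabs_triang|]. lra.
Qed.

Lemma exists_mag_near N m : (1 <= N)%nat -> 0 < m < 1 ->
  exists k, (k <= N)%nat /\ mag N k <= m < mag N k + 2 / INR N.
Proof.
  intros HN Hm. assert (HN0 : 0 < INR N) by (apply lt_0_INR; lia).
  assert (H2N : 0 < 2 / INR N) by (apply Rdiv_lt_0_compat; lra).
  assert (Hind : forall n, m < mag N n -> exists k, (k < n)%nat /\ mag N k <= m < mag N k + 2 / INR N).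
  { induction n as [|n IH]; intros H.
    - exfalso. unfold mag in H. simpl in H. replace ((2 * 0 - INR N) / INR N) with (-1) in H by (field; lra). lra.
    - destruct (Rle_lt_dec (mag N n) m) as [Hle|Hgt].
      + exists n. rewrite <- mag_S by easy. split; [lia|lra].
      + destruct (IH Hgt) as [k [Hk1 Hk2]]. exists k. split; [lia|easy]. }
  destruct (Hind N) as [k [Hk1 Hk2]].
  - unfold mag. replace ((2 * INR N - INR N) / INR N) with 1 by (field; lra). lra.
  - exists k. split; [lia|easy].
Qed.

Definition score (L m : R) (N k : nat) : R := sqrt (L * INR N) * (mag N k - m).

(* Increments of [ln weight + score^2 / 2] are [O(1/N + (x - m)^2)], with no Stirling formula involved. *)
Lemma ln_weight_gauss b p m : (3 <= p)%nat -> 0 < m < 1 -> dH b p m = 0 -> d2H b p m < 0 ->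
  let L := - d2H b p m in
  exists d K, 0 < d /\ 0 <= K /\ forall N k0 k, (1 <= N)%nat -> (k0 <= N)%nat -> (k <= N)%nat ->
    mag N k0 <= m < mag N k0 + 2 / INR N -> Rabs (mag N k - m) + 2 / INR N <= d ->
    Rabs (ln (weight b p N k) + score L m N k ^ 2 / 2 - (ln (weight b p N k0) + score L m N k0 ^ 2 / 2))
    <= K * (/ INR N + (Rabs (mag N k - m) + 2 / INR N) ^ 2) * (INR N * (Rabs (mag N k - m) + 2 / INR N)).
Proof.
  intros Hp Hm Hd H2 L. assert (HL : 0 < L) by (unfold L; lra).
  destruct (taylor2_local (dH b p) (d2H b p) m) as [d1 [K1 [Hd1 [HK1 Ht]]]].
  { assert (Hq : 0 < Rmin m (1 - m)) by (apply Rmin_case; lra).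
    exists (mkposreal _ Hq). intros y Hy.
    assert (Hy' : Rabs (y - m) < Rmin m (1 - m)) by exact Hy. apply Rabs_def2 in Hy'.
    assert (A := Rmin_l m (1 - m)). assert (B := Rmin_r m (1 - m)).
    apply is_derive_dH. lra. }
  { unfold d2H. auto_derive. nra. }
  set (K2 := 2 + 4 * (Rabs b * (INR p * INR p))).
  assert (HK2 : 2 <= K2).
  { unfold K2. assert (0 <= Rabs b * (INR p * INR p)); [|lra].
    apply Rmult_le_pos; [apply Rabs_pos|]. apply Rmult_le_pos; apply pos_INR. }
  exists (Rmin d1 m), (K2 + 2 * L + 2 * K1).
  split; [apply Rmin_case; lra|]. split; [lra|].
  intros N k0 k HN Hk0 Hk Hm0 Hdk.
  assert (A1 := Rmin_l d1 m). assert (A2 := Rmin_r d1 m).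
  assert (HN0 : 0 < INR N) by (apply lt_0_INR; lia).
  assert (HNi : 0 < / INR N) by now apply Rinv_0_lt_compat.
  assert (H2N : 0 < 2 / INR N) by (apply Rdiv_lt_0_compat; lra).
  (* [a] bounds the distance to [m] of every level between [k0] and [k]; the summand [2/N] accounts
     for [k0] itself. *)
  set (a := Rabs (mag N k - m) + 2 / INR N) in *.
  set (r := fun k => ln (weight b p N k) + score L m N k ^ 2 / 2).
  assert (Hstep : forall t, (t < N)%nat -> Rabs (mag N t - m) <= a ->
     Rabs (r (S t) - r t) <= (K2 + 2 * L + 2 * K1) * (/ INR N + a ^ 2)).
  { intros t Ht1 Ht2.
    assert (Ht0 : 0 <= mag N t).
    { assert (Ht2' := Ht2). apply Rabs_le_between in Ht2'. lra. }
    assert (R1 := ln_weight_ratio b p N t ltac:(lia) HN Ht1 Ht0). fold K2 in R1.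
    specialize (Ht (mag N t) ltac:(lra)). rewrite Hd in Ht.
    (* Half of this increment is [2 L (x - m)] plus [O(1/N)], which cancels the linear part
       [-2 L (x - m)] of [2 H']. *)
    assert (Hsq : score L m N (S t) ^ 2 - score L m N t ^ 2 = 4 * L * (mag N t - m) + 4 * L * / INR N).
    { unfold score. rewrite !Rpow_mult_distr, mag_S, pow2_sqrt by (easy || (apply Rmult_le_pos; lra)). field. lra. }
    unfold r.
    match goal with |- Rabs ?e <= _ => replace e with
     ((ln (weight b p N (S t)) - ln (weight b p N t) - 2 * dH b p (mag N t))
      + 2 * (dH b p (mag N t) - 0 - d2H b p m * (mag N t - m)) + 2 * L * / INR N) end.
    2:{ unfold L in *. lra. }
    eapply Rle_trans; [apply Rabs_triang|]. eapply Rle_trans; [apply Rplus_le_compat_r, Rabs_triang|].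
    rewrite (Rabs_mult 2), (Rabs_pos_eq 2), (Rabs_pos_eq (2 * L * / INR N)) by nra.
    assert ((mag N t - m) ^ 2 <= a ^ 2).
    { rewrite <- pow2_abs. apply pow_incr. split; [apply Rabs_pos|easy]. }
    unfold Rdiv in R1. assert (0 <= a ^ 2) by apply pow2_ge_0.
    assert (K1 * (mag N t - m) ^ 2 <= K1 * a ^ 2) by (apply Rmult_le_compat_l; lra).
    assert (0 <= K2 * a ^ 2) by (apply Rmult_le_pos; lra).
    assert (0 <= L * a ^ 2) by (apply Rmult_le_pos; lra).
    assert (0 <= K1 * / INR N) by (apply Rmult_le_pos; lra). nra. }
  assert (Hmono : forall i j, (i <= j)%nat -> mag N i <= mag N j).
  { intros i j Hij. unfold mag. apply Rmult_le_compat_r; [lra|]. apply le_INR in Hij. lra. }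
  assert (HB : 0 <= (K2 + 2 * L + 2 * K1) * (/ INR N + a ^ 2)).
  { apply Rmult_le_pos; [lra|]. assert (0 <= a ^ 2) by apply pow2_ge_0. lra. }
  assert (Hxk : forall j, INR j = INR N * (1 + mag N j) / 2) by (intros; unfold mag; field; lra).
  assert (Habs := Rabs_pos (mag N k - m)).
  fold (r k). fold (r k0).
  assert (Ha : 0 <= INR N * a) by (apply Rmult_le_pos; unfold a; lra).
  destruct (Nat.le_ge_cases k0 k) as [Hle|Hle].
  - assert (Hmk := Hmono k0 k Hle).
    eapply Rle_trans; [apply (steps_bound r ((K2 + 2 * L + 2 * K1) * (/ INR N + a ^ 2)) k0 k Hle)|].
    + intros t Ht1. apply Hstep; [lia|].
      assert (B1 := Hmono k0 t ltac:(lia)). assert (B2 := Hmono t k ltac:(lia)).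
      unfold a. apply Rabs_le. assert (B3 := Rle_abs (mag N k - m)). lra.
    + apply Rmult_le_compat_l; [easy|]. rewrite (Hxk k), (Hxk k0).
      assert (B4 : mag N k - mag N k0 <= a) by (unfold a; assert (B3 := Rle_abs (mag N k - m)); lra).
      apply (Rmult_le_compat_l (INR N)) in B4; [|lra]. lra.
  - assert (Hmk := Hmono k k0 Hle). rewrite Rabs_minus_sym.
    eapply Rle_trans; [apply (steps_bound r ((K2 + 2 * L + 2 * K1) * (/ INR N + a ^ 2)) k k0 Hle)|].
    + intros t Ht1. apply Hstep; [lia|].
      assert (B1 := Hmono k t ltac:(lia)). assert (B2 := Hmono t k0 ltac:(lia)).
      unfold a. apply Rabs_le. assert (B3 := Rle_abs (- (mag N k - m))). rewrite Rabs_Ropp in B3. lra.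
    + apply Rmult_le_compat_l; [easy|]. rewrite (Hxk k), (Hxk k0).
      assert (B4 : mag N k0 - mag N k <= a).
      { unfold a. assert (B3 := Rle_abs (- (mag N k - m))). rewrite Rabs_Ropp in B3. lra. }
      apply (Rmult_le_compat_l (INR N)) in B4; [|lra]. lra.
Qed.

(** * Bracketing the maximum pseudolikelihood estimate *)

Definition dnlogPL (n1 n2 d1 d2 b : R) : R :=
  n1 * (d1 / (1 + exp (- (b * d1)))) + n2 * (d2 / (1 + exp (- (b * d2)))).

Lemma is_derive_nlogPL n1 n2 d1 d2 b : is_derive (nlogPL n1 n2 d1 d2) b (dnlogPL n1 n2 d1 d2 b).
Proof.
  unfold nlogPL, dnlogPL. rewrite !exp_Ropp.
  assert (H1 := exp_pos (b * d1)). assert (H2 := exp_pos (b * d2)).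
  auto_derive; [repeat split; lra|]. field. repeat split; lra.
Qed.

(** Each term [d / (1 + exp (- b d))] is nondecreasing in [b] for either sign of [d]; this is the
    concavity of the log-pseudolikelihood. *)
Lemma dnlogPL_increasing n1 n2 d1 d2 b b' : 0 <= n1 -> 0 <= n2 -> b <= b' ->
  dnlogPL n1 n2 d1 d2 b <= dnlogPL n1 n2 d1 d2 b'.
Proof.
  intros H1 H2 Hb.
  assert (Hd : forall d, d / (1 + exp (- (b * d))) <= d / (1 + exp (- (b' * d)))).
  { intros d. assert (E1 := exp_pos (- (b * d))). assert (E2 := exp_pos (- (b' * d))).
    unfold Rdiv. destruct (Rle_lt_dec 0 d).
    - apply Rmult_le_compat_l; [easy|]. apply Rinv_le_contravar; [lra|].
      apply Rplus_le_compat_l, exp_le_mono. nra.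
    - apply Rmult_le_compat_neg_l; [lra|]. apply Rinv_le_contravar; [lra|].
      apply Rplus_le_compat_l, exp_le_mono. nra. }
  unfold dnlogPL. apply Rplus_le_compat; apply Rmult_le_compat_l; auto.
Qed.

(** Monotonicity of the derivative extends its signs beyond [lo] and [hi], so a minimum over the
    bracket is global. Existence belongs to the conclusion because the estimate is specified only
    when a maximizer exists. *)
Lemma nlogPL_min_bracket n1 n2 d1 d2 lo hi : 0 <= n1 -> 0 <= n2 -> lo < hi ->
  dnlogPL n1 n2 d1 d2 lo < 0 -> 0 < dnlogPL n1 n2 d1 d2 hi ->
  (exists b, forall b', nlogPL n1 n2 d1 d2 b <= nlogPL n1 n2 d1 d2 b') /\
  forall b, (forall b', nlogPL n1 n2 d1 d2 b <= nlogPL n1 n2 d1 d2 b') -> lo < b < hi.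
Proof.
  intros H1 H2 Hlh Hlo Hhi.
  set (f := nlogPL n1 n2 d1 d2) in *. set (f' := dnlogPL n1 n2 d1 d2) in *.
  assert (Hd : forall b, is_derive f b (f' b)) by (intros; apply is_derive_nlogPL).
  assert (Hc : forall b, continuity_pt f b) by (intros; eapply is_derive_continuity_pt, Hd).
  assert (Hi : forall b b', b <= b' -> f' b <= f' b') by (intros; now apply dnlogPL_increasing).
  split.
  - destruct (continuity_ab_min f lo hi) as [z [Hz1 Hz2]]; [lra|auto|].
    exists z. intros b'.
    destruct (Rlt_le_dec b' lo) as [Hl|Hl]; [|destruct (Rlt_le_dec hi b') as [Hr|Hr]].
    + destruct (MVT_interior f f' b' lo Hl) as [c [Hc1 Hc2]]; auto.
      specialize (Hz1 lo ltac:(lra)). specialize (Hi c lo ltac:(lra)). nra.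
    + destruct (MVT_interior f f' hi b' Hr) as [c [Hc1 Hc2]]; auto.
      specialize (Hz1 hi ltac:(lra)). specialize (Hi hi c ltac:(lra)). nra.
    + apply Hz1. lra.
  - intros b Hb.
    assert (Hb0 : f' b = 0).
    { assert (Hdb := Hd b). apply is_derive_Reals in Hdb.
      rewrite <- (derive_pt_eq_0 f b (f' b) (exist _ _ Hdb) Hdb).
      apply (deriv_minimum f (b - 1) (b + 1)); [lra|lra|]. intros; apply Hb. }
    split.
    + destruct (Rlt_le_dec lo b) as [|Hle]; [easy|]. specialize (Hi b lo Hle). lra.
    + destruct (Rlt_le_dec b hi) as [|Hle]; [easy|]. specialize (Hi hi b Hle). lra.
Qed.

Lemma logistic_ge u : 0 <= u -> forall d A, d <= A -> 0 <= d ->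
  / (1 + exp (u * A)) <= / (1 + exp (u * d)) /\
  exp (u * d) / (1 + exp (u * d)) <= / (1 + exp (- (u * A))).
Proof.
  intros Hu d A Hd H0. assert (exp (u * d) <= exp (u * A)) by (apply exp_le_mono; nra).
  assert (E1 := exp_pos (u * d)). assert (E2 := exp_pos (u * A)). split.
  - apply Rinv_le_contravar; lra.
  - rewrite exp_Ropp. replace (/ (1 + / exp (u * A))) with (exp (u * A) / (1 + exp (u * A))) by (field; lra).
    apply Rle_div_l; [lra|]. unfold Rdiv. rewrite Rmult_assoc, (Rmult_comm (/ _)), <- Rmult_assoc.
    apply (Rle_div_r _ _ (1 + exp (u * A))); [lra|]. nra.
Qed.

(** Replacing both exponents by the common lower bound [d] extracts one logistic factor [q]; what
    remains is the comparison of [n1 * A] with [n2 * exp (b * d) * B]. *)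
Lemma dnlogPL_pos n1 n2 A B b d : 0 < n1 -> 0 < n2 -> 0 <= b -> 0 < d -> d <= A <= B ->
  n1 < n2 * exp (b * d) -> 0 < dnlogPL n1 n2 (- A) B b.
Proof.
  intros H1 H2 Hb Hd [HA HB] H. unfold dnlogPL.
  replace (- (b * - A)) with (b * A) by ring.
  destruct (logistic_ge b Hb d A HA ltac:(lra)) as [E1 _].
  destruct (logistic_ge b Hb d B ltac:(lra) ltac:(lra)) as [_ E2].
  assert (Ed := exp_pos (b * d)).
  set (q := / (1 + exp (b * d))) in *. assert (Hq : 0 < q) by (apply Rinv_0_lt_compat; lra).
  assert (S1 : n1 * (A * / (1 + exp (b * A))) <= n1 * (A * q)).
  { apply Rmult_le_compat_l; [lra|]. apply Rmult_le_compat_l; lra. }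
  assert (S2 : n2 * (B * (exp (b * d) * q)) <= n2 * (B * / (1 + exp (- (b * B))))).
  { apply Rmult_le_compat_l; [lra|]. apply Rmult_le_compat_l; [lra|exact E2]. }
  assert (S3 : n1 * (A * q) < n2 * exp (b * d) * (A * q)).
  { apply Rmult_lt_compat_r; [|easy]. apply Rmult_lt_0_compat; lra. }
  assert (S4 : n2 * exp (b * d) * (A * q) <= n2 * exp (b * d) * (B * q)).
  { apply Rmult_le_compat_l; [apply Rmult_le_pos; lra|]. apply Rmult_le_compat_r; lra. }
  unfold Rdiv. lra.
Qed.

(** The same reduction with the common upper bound [D]. In the application [B] is the larger
    increment, which now works against the claim, so [A] and [B] stay in the hypothesis. *)
Lemma dnlogPL_neg n1 n2 A B b D : 0 < n1 -> 0 < n2 -> 0 <= b -> 0 < A -> A <= D -> 0 < B <= D ->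
  n2 * B * exp (b * D) < n1 * A -> dnlogPL n1 n2 (- A) B b < 0.
Proof.
  intros H1 H2 Hb HA HAD HB H. unfold dnlogPL.
  replace (- (b * - A)) with (b * A) by ring.
  destruct (logistic_ge b Hb A D HAD ltac:(lra)) as [E1 _].
  destruct (logistic_ge b Hb B D ltac:(lra) ltac:(lra)) as [_ E2].
  assert (ED := exp_pos (b * D)). assert (EB := exp_pos (b * B)).
  set (q := / (1 + exp (b * D))) in *. assert (Hq : 0 < q) by (apply Rinv_0_lt_compat; lra).
  assert (E3 : / (1 + exp (- (b * B))) <= exp (b * D) * q).
  { unfold q. replace (exp (b * D) * / (1 + exp (b * D))) with (/ (1 + exp (- (b * D)))).
    2:{ rewrite exp_Ropp. field. lra. }
    assert (exp (- (b * D)) <= exp (- (b * B))) by (apply exp_le_mono; nra).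
    assert (E5 := exp_pos (- (b * D))). apply Rinv_le_contravar; lra. }
  assert (S1 : n1 * (A * q) <= n1 * (A * / (1 + exp (b * A)))).
  { apply Rmult_le_compat_l; [lra|]. apply Rmult_le_compat_l; lra. }
  assert (S2 : n2 * (B * / (1 + exp (- (b * B)))) <= n2 * (B * (exp (b * D) * q))).
  { apply Rmult_le_compat_l; [lra|]. apply Rmult_le_compat_l; lra. }
  assert (S3 : n2 * B * exp (b * D) * q < n1 * A * q) by (now apply Rmult_lt_compat_r).
  unfold Rdiv. lra.
Qed.

(** The coefficient [b] for which [x] is a critical point of [H_b]; it is [hr] divided by [p]. *)
Definition invert (p : nat) (x : R) : R := ath x / (INR p * x ^ (p - 1)).

Lemma ath_increasing x y : -1 < x -> x <= y -> y < 1 -> ath x <= ath y.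
Proof.
  intros H1 H2 H3. unfold ath.
  assert (ln (1 + x) <= ln (1 + y)) by (apply ln_le; lra).
  assert (ln (1 - y) <= ln (1 - x)) by (apply ln_le; lra). lra.
Qed.

Lemma ath_pos x : 0 < x < 1 -> 0 < ath x.
Proof.
  intros H. unfold ath. assert (ln (1 - x) < ln (1 + x)) by (apply ln_increasing; lra). lra.
Qed.

(** The right side is the ratio of ones to minus ones at magnetization [x]; this is how [artanh]
    enters the likelihood equation. *)
Lemma exp_2_ath x : -1 < x < 1 -> exp (2 * ath x) = (1 + x) / (1 - x).
Proof.
  intros H. unfold ath. replace (2 * (/ 2 * (ln (1 + x) - ln (1 - x)))) with (ln (1 + x) + - ln (1 - x)) by field.
  rewrite exp_plus, exp_Ropp, !exp_ln by lra. field. lra.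
Qed.

Lemma energy_scale p N y : (1 <= p)%nat -> (1 <= N)%nat -> energy p N y = INR N * (y / INR N) ^ p.
Proof.
  intros Hp HN. assert (0 < INR N) by (apply lt_0_INR; lia).
  unfold energy, Rdiv. rewrite Rpow_mult_distr, pow_inv.
  destruct p as [|q]; [lia|]. replace (S q - 1)%nat with q by lia.
  change (INR N ^ S q) with (INR N * INR N ^ q). field. split; [apply pow_nonzero|]; lra.
Qed.

Definition elow (p N : nat) (x : R) : R := energy p N (INR N * x - 2) - energy p N (INR N * x).
Definition ehigh (p N : nat) (x : R) : R := energy p N (INR N * x + 2) - energy p N (INR N * x).

Lemma energy_increments p N x : (1 <= p)%nat -> (1 <= N)%nat -> 2 / INR N <= x -> x + 2 / INR N <= 1 ->
  let a := 2 * INR p * x ^ (p - 1) in let c := 4 * (INR p * INR p) in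
  a - c / INR N <= - elow p N x <= a /\ a <= ehigh p N x <= a + c / INR N.
Proof.
  intros Hp HN H1 H2 a c. assert (HN0 : 0 < INR N) by (apply lt_0_INR; lia).
  assert (H2N : 0 < 2 / INR N) by (apply Rdiv_lt_0_compat; lra).
  unfold elow, ehigh. rewrite !energy_scale by easy.
  replace ((INR N * x - 2) / INR N) with (x - 2 / INR N) by (field; lra).
  replace ((INR N * x + 2) / INR N) with (x + 2 / INR N) by (field; lra).
  replace (INR N * x / INR N) with x by (field; lra).
  destruct (pow_increment p (x - 2 / INR N) x ltac:(lra) ltac:(lra)) as [_ L].
  destruct (pow_increment p x (x + 2 / INR N) ltac:(lra) ltac:(lra)) as [R _].
  replace (x - (x - 2 / INR N)) with (2 / INR N) in L by ring.
  replace (x + 2 / INR N - x) with (2 / INR N) in R by ring.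
  assert (Ea : a = INR N * (INR p * x ^ (p - 1) * (2 / INR N))) by (unfold a; field; lra).
  assert (Ec : c / INR N = INR N * (INR p * INR p * (2 / INR N) ^ 2)) by (unfold c; field; lra).
  rewrite Ea, Ec.
  set (u := INR p * x ^ (p - 1) * (2 / INR N)) in *. set (w := INR p * INR p * (2 / INR N) ^ 2) in *.
  set (xl := (x - 2 / INR N) ^ p) in *. set (xr := (x + 2 / INR N) ^ p) in *. set (xx := x ^ p) in *.
  repeat split; nra.
Qed.

Lemma eventually_INR (K : R) : exists N0, forall N, (N0 <= N)%nat -> K <= INR N.
Proof.
  destruct (INR_unbounded K) as [n Hn]. exists n. intros N HN. apply le_INR in HN. lra.
Qed.

(** If both flips changed the energy by exactly [a = 2 p x^(p-1)] in absolute value, the zero of the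
    derivative would solve [exp (a b) = (1 + x) / (1 - x)], that is [b = invert p x]. The true
    changes differ from [a] by at most [c / N], which moves the zero by [O(1/N)]. *)
Lemma dnlogPL_bracket p m : (3 <= p)%nat -> 0 < m < 1 ->
  exists C N0, 0 < C /\ forall N x, (N0 <= N)%nat -> Rabs (x - m) <= Rmin m (1 - m) / 2 ->
    dnlogPL (INR N * (1 + x) / 2) (INR N * (1 - x) / 2) (elow p N x) (ehigh p N x) (invert p x - C / INR N) < 0 /\
    0 < dnlogPL (INR N * (1 + x) / 2) (INR N * (1 - x) / 2) (elow p N x) (ehigh p N x) (invert p x + C / INR N).
Proof.
  intros Hp Hm.
  assert (Hp0 : 0 < INR p) by (apply lt_0_INR; lia).
  set (c := 4 * (INR p * INR p)). assert (Hc : 0 < c) by (unfold c; apply Rmult_lt_0_compat; [lra|now apply Rmult_lt_0_compat]).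
  set (a0 := 2 * INR p * (m / 2) ^ (p - 1)).
  assert (Ha0 : 0 < a0) by (unfold a0; repeat apply Rmult_lt_0_compat; try lra; apply pow_lt; lra).
  set (g0 := 2 * ath ((1 + m) / 2) / a0). set (g1 := ath (m / 2) / INR p).
  assert (Hg1 : 0 < g1) by (apply Rdiv_lt_0_compat; [apply ath_pos; lra|easy]).
  assert (Hg0 : 0 < g0).
  { apply Rdiv_lt_0_compat; [|easy]. assert (H := ath_pos ((1 + m) / 2) ltac:(lra)). lra. }
  (* [a0] is a lower bound for [a], and [g0], [g1] bound [invert] from above and below. The term
     [g0 * c] pays for the error in the exponent and [4 * c / a0] for the ratio of the two energy
     changes; the factor 2 pays for the product of [C / N] with [c / N]. *)
  set (C := 2 * (g0 * c + 4 * c / a0) / a0 + 1).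
  assert (Hca : 0 < 4 * c / a0) by (apply Rdiv_lt_0_compat; lra).
  assert (HC : 1 < C).
  { unfold C. assert (0 < 2 * (g0 * c + 4 * c / a0) / a0); [|lra]. apply Rdiv_lt_0_compat; [|lra].
    assert (0 < g0 * c) by (now apply Rmult_lt_0_compat). lra. }
  assert (HCa : 2 * (g0 * c + 4 * c / a0) < C * a0).
  { unfold C. rewrite Rmult_plus_distr_r. replace (2 * (g0 * c + 4 * c / a0) / a0 * a0) with (2 * (g0 * c + 4 * c / a0)) by (field; lra). lra. }
  (* In order, the terms ensure that the energy changes stay above [a0 / 2], that the lower bracket
     stays positive, and that [x - 2/N] and [x + 2/N] stay in [0,1]. *)
  destruct (eventually_INR (1 + 2 * c / a0 + 2 * C / g1 + 4 / m + 4 / (1 - m))) as [N0 HN0].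
  exists C, N0. split; [lra|]. intros N x HN Hx. specialize (HN0 N HN).
  assert (P1 : 0 < 2 * c / a0) by (apply Rdiv_lt_0_compat; lra).
  assert (P2 : 0 < 2 * C / g1) by (apply Rdiv_lt_0_compat; lra).
  assert (P3 : 0 < 4 / m) by (apply Rdiv_lt_0_compat; lra).
  assert (P4 : 0 < 4 / (1 - m)) by (apply Rdiv_lt_0_compat; lra).
  assert (HNp : 0 < INR N) by lra.
  assert (HN1 : (1 <= N)%nat) by (apply INR_le; simpl; lra).
  assert (Q1 : c / INR N <= a0 / 2).
  { apply Rle_div_l; [easy|]. assert (2 * c / a0 * (a0 / 2) = c) by (field; lra). nra. }
  assert (Q2 : C / INR N < g1).
  { apply Rlt_div_l; [easy|]. assert (2 * C / g1 * g1 = 2 * C) by (field; lra). nra. }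
  assert (Q3 : 2 / INR N <= m / 2).
  { apply Rle_div_l; [easy|]. assert (4 / m * (m / 2) = 2) by (field; lra). nra. }
  assert (Q4 : 2 / INR N <= (1 - m) / 2).
  { apply Rle_div_l; [easy|]. assert (4 / (1 - m) * ((1 - m) / 2) = 2) by (field; lra). nra. }
  assert (A := Rmin_l m (1 - m)). assert (B := Rmin_r m (1 - m)). apply Rabs_le_between in Hx.
  assert (Hx1 : m / 2 <= x <= (1 + m) / 2) by lra.
  set (a := 2 * INR p * x ^ (p - 1)).
  assert (Hxp : (m / 2) ^ (p - 1) <= x ^ (p - 1) <= 1).
  { split; [apply pow_incr; lra|]. rewrite <- (pow1 (p - 1)). apply pow_incr; lra. }
  assert (Hxp0 : 0 < (m / 2) ^ (p - 1)) by (apply pow_lt; lra).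
  assert (Ha : a0 <= a) by (unfold a, a0; apply Rmult_le_compat_l; lra).
  destruct (energy_increments p N x ltac:(lia) HN1 ltac:(lra) ltac:(lra)) as [I1 I2].
  fold a in I1, I2. fold c in I1, I2.
  set (EA := - elow p N x) in *. set (EB := ehigh p N x) in *.
  replace (elow p N x) with (- EA) by (unfold EA; ring).
  assert (Hag : a * invert p x = 2 * ath x) by (unfold a, invert; field; lra).
  assert (Hathx : 0 < ath x) by (apply ath_pos; lra).
  assert (Hgl : g1 <= invert p x).
  { unfold g1, invert. assert (M := ath_increasing (m / 2) x ltac:(lra) ltac:(lra) ltac:(lra)).
    unfold Rdiv. apply Rmult_le_compat; try lra.
    - left; apply ath_pos; lra.
    - left; now apply Rinv_0_lt_compat.
    - apply Rinv_le_contravar; [apply Rmult_lt_0_compat; lra|].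
      rewrite <- (Rmult_1_r (INR p)) at 2. apply Rmult_le_compat_l; lra. }
  assert (Hgu : invert p x <= g0).
  { assert (M := ath_increasing x ((1 + m) / 2) ltac:(lra) ltac:(lra) ltac:(lra)).
    unfold g0. apply (Rle_div_r _ _ a0); [easy|].
    assert (invert p x * a0 <= invert p x * a) by (apply Rmult_le_compat_l; lra). lra. }
  set (g := invert p x) in *.
  assert (HNi : 0 < / INR N) by now apply Rinv_0_lt_compat.
  assert (Hx2 := exp_2_ath x ltac:(lra)).
  assert (Hgc : g * c <= g0 * c) by (apply Rmult_le_compat_r; lra).
  assert (Hg0c : 0 < g0 * c) by (apply Rmult_lt_0_compat; lra).
  assert (HCa' : C * a0 <= C * a) by (apply Rmult_le_compat_l; lra).
  assert (CN : 0 < C / INR N) by (apply Rdiv_lt_0_compat; lra).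
  assert (cN : 0 < c / INR N) by (apply Rdiv_lt_0_compat; lra).
  assert (Hn1 : 0 < INR N * (1 + x) / 2) by (apply Rdiv_lt_0_compat; [apply Rmult_lt_0_compat|]; lra).
  assert (Hn2 : 0 < INR N * (1 - x) / 2) by (apply Rdiv_lt_0_compat; [apply Rmult_lt_0_compat|]; lra).
  split.
  - apply (dnlogPL_neg _ _ EA EB _ (a + c / INR N)); try lra.
    (* The increments differ by at most [2 c / N], and [EA >= a0 / 2]. *)
    + assert (HB : EB <= EA * exp (4 * c / a0 / INR N)).
      { assert (E := exp_ineq1_le (4 * c / a0 / INR N)).
        assert (EA * (1 + 4 * c / a0 / INR N) <= EA * exp (4 * c / a0 / INR N)) by (apply Rmult_le_compat_l; lra).
        assert (a0 / 2 * (4 * c / a0 / INR N) = 2 * (c / INR N)) by (field; lra).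
        assert (0 < 4 * c / a0 / INR N) by (apply Rdiv_lt_0_compat; lra).
        assert (a0 / 2 * (4 * c / a0 / INR N) <= EA * (4 * c / a0 / INR N)) by (apply Rmult_le_compat_r; lra).
        lra. }
      assert (Hexp : exp (4 * c / a0 / INR N) * exp ((g - C / INR N) * (a + c / INR N)) < (1 + x) / (1 - x)).
      { rewrite <- exp_plus, <- Hx2. apply exp_increasing. rewrite <- Hag.
        assert (K : 0 < (C * a - g * c - 4 * c / a0) * / INR N) by (apply Rmult_lt_0_compat; lra).
        assert (K2 := Rmult_lt_0_compat _ _ CN cN).
        assert (E : 4 * c / a0 / INR N + (g - C / INR N) * (a + c / INR N) =
          a * g - (C * a - g * c - 4 * c / a0) * / INR N - C / INR N * (c / INR N)) by (field; lra).
        rewrite E. lra. }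
      set (e1 := exp (4 * c / a0 / INR N)) in *. set (e2 := exp ((g - C / INR N) * (a + c / INR N))) in *.
      assert (He2 : 0 < e2) by apply exp_pos.
      apply Rlt_div_r in Hexp; [|lra].
      assert (U1 : INR N * (1 - x) / 2 * EB * e2 <= INR N * (1 - x) / 2 * (EA * e1) * e2).
      { apply Rmult_le_compat_r; [lra|]. apply Rmult_le_compat_l; [lra|easy]. }
      assert (U2 : INR N / 2 * EA * (e1 * e2 * (1 - x)) < INR N / 2 * EA * (1 + x)).
      { apply Rmult_lt_compat_l; [|easy]. apply Rmult_lt_0_compat; lra. }
      lra.
  - apply (dnlogPL_pos _ _ EA EB _ (a - c / INR N)); try lra.
    + assert (Hexp : (1 + x) / (1 - x) < exp ((g + C / INR N) * (a - c / INR N))).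
      { rewrite <- Hx2. apply exp_increasing. rewrite <- Hag.
        assert (K0 : C * (c / INR N) <= C * (a0 / 2)) by (apply Rmult_le_compat_l; lra).
        assert (K : 0 < (C * a - g * c - C * (c / INR N)) * / INR N) by (apply Rmult_lt_0_compat; lra).
        assert (E : (g + C / INR N) * (a - c / INR N) = a * g + (C * a - g * c - C * (c / INR N)) * / INR N) by (field; lra).
        rewrite E. lra. }
      apply Rlt_div_l in Hexp; [|lra].
      assert (INR N / 2 * (1 + x) < INR N / 2 * (exp ((g + C / INR N) * (a - c / INR N)) * (1 - x))).
      { apply Rmult_lt_compat_l; lra. }
      lra.
Qed.

Lemma nlogPL_swap n1 n2 d1 d2 b : nlogPL n1 n2 d1 d2 b = nlogPL n2 n1 d2 d1 b.
Proof. unfold nlogPL. ring. Qed.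

Lemma energy_even p N y : Nat.even p = true -> energy p N (- y) = energy p N y.
Proof.
  intros H. unfold energy. f_equal. apply Nat.even_spec in H as [q ->].
  rewrite !pow_mult. f_equal. simpl. ring.
Qed.

Lemma mag_opp N k : (k <= N)%nat -> mag N (N - k) = - mag N k.
Proof. intros H. unfold mag. rewrite minus_INR by easy. unfold Rdiv. ring. Qed.

(* The pseudolikelihood depends on the configuration only through its number of [1]s, and, for even [p],
   is invariant under a global sign change. *)
Lemma mple_bracket p m : (3 <= p)%nat -> 0 < m < 1 ->
  exists C N0, 0 < C /\ forall N X b k, (N0 <= N)%nat -> In X (configs N) ->
    ((exists b, is_mple p X b) -> is_mple p X b) ->
    k = npos X \/ (Nat.even p = true /\ k = (N - npos X)%nat) ->
    Rabs (mag N k - m) <= Rmin m (1 - m) / 2 ->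
    Rabs (b - invert p (mag N k)) <= C / INR N.
Proof.
  intros Hp Hm. destruct (dnlogPL_bracket p m Hp Hm) as [C [N0 [HC HB]]].
  exists C, (S N0). split; [easy|]. intros N X b k HN HX Hb Hk Hmag.
  destruct (HB N (mag N k) ltac:(lia) Hmag) as [B1 B2].
  destruct (configs_spec N X HX) as [HL HF].
  assert (HN0 : 0 < INR N) by (apply lt_0_INR; lia).
  assert (Hle : (npos X <= N)%nat) by (rewrite <- HL; apply npos_le).
  assert (HkN : (k <= N)%nat) by lia.
  assert (Hx1 : INR N * (1 + mag N k) / 2 = INR k) by (unfold mag; field; lra).
  assert (Hx2 : INR N * (1 - mag N k) / 2 = INR (N - k)) by (rewrite minus_INR by easy; unfold mag; field; lra).
  rewrite Hx1, Hx2 in B1, B2.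
  assert (HPL : forall b, PL p X b = exp (- nlogPL (INR k) (INR (N - k)) (elow p N (mag N k)) (ehigh p N (mag N k)) b)).
  { intros b'. rewrite PL_nlogPL by easy. rewrite HL. f_equal. f_equal. unfold elow, ehigh.
    replace (INR N * mag N k) with (2 * INR k - INR N) by (unfold mag; field; lra).
    destruct Hk as [->|[He ->]]; [easy|].
    rewrite nlogPL_swap. replace (N - (N - npos X))%nat with (npos X) by lia.
    rewrite minus_INR by easy.
    replace (2 * (INR N - INR (npos X)) - INR N - 2) with (- (2 * INR (npos X) - INR N + 2)) by ring.
    replace (2 * (INR N - INR (npos X)) - INR N + 2) with (- (2 * INR (npos X) - INR N - 2)) by ring.
    replace (2 * (INR N - INR (npos X)) - INR N) with (- (2 * INR (npos X) - INR N)) by ring.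
    now rewrite !(energy_even p N) by easy. }
  assert (CN : 0 < C / INR N) by (apply Rdiv_lt_0_compat; lra).
  assert (Hlh : invert p (mag N k) - C / INR N < invert p (mag N k) + C / INR N) by lra.
  destruct (nlogPL_min_bracket _ _ _ _ _ _ (pos_INR k) (pos_INR (N - k)) Hlh B1 B2) as [[b0 Hb0] Hbr].
  assert (Hm1 : forall b, is_mple p X b <-> forall b', nlogPL (INR k) (INR (N - k)) (elow p N (mag N k)) (ehigh p N (mag N k)) b
     <= nlogPL (INR k) (INR (N - k)) (elow p N (mag N k)) (ehigh p N (mag N k)) b').
  { intros b1. unfold is_mple. split; intros H b'; specialize (H b').
    - rewrite !HPL in H. apply Rnot_lt_le. intros Hlt. apply (Rlt_not_le _ _ (exp_increasing _ _ (Ropp_lt_contravar _ _ Hlt))).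
      exact H.
    - rewrite !HPL. apply exp_le_mono. lra. }
  assert (Hbm : is_mple p X b) by (apply Hb; exists b0; now apply Hm1).
  assert (Hbb := Hbr b (proj1 (Hm1 b) Hbm)). apply Rabs_le. lra.
Qed.

(** * Local limit and tails *)

(** With [q = N^(1/8)] both [ln N] and the window width are [O(q)] while [sqrt N = q^4], so even the
    cube of the width is negligible against [sqrt N], and such comparisons become polynomial in
    [q]. *)
Definition root8 (N : nat) : R := sqrt (sqrt (sqrt (INR N))).

Lemma root8_spec N : (1 <= N)%nat -> 1 <= root8 N /\ ln (INR N) <= 8 * root8 N /\ sqrt (INR N) = root8 N ^ 4.
Proof.
  intros HN. assert (H1 : 1 <= INR N) by (apply (le_INR 1); lia).
  assert (S1 : forall y, 1 <= y -> 1 <= sqrt y) by (intros y Hy; rewrite <- sqrt_1; now apply sqrt_le_1_alt).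
  assert (L1 : forall y, 1 <= y -> ln y = 2 * ln (sqrt y)).
  { intros y Hy. rewrite <- (sqrt_sqrt y) at 1 by lra. assert (H := S1 y Hy). rewrite ln_mult by lra. ring. }
  assert (H2 := S1 _ H1). assert (H3 := S1 _ H2). assert (H4 := S1 _ H3). fold (root8 N) in H4.
  split; [easy|]. split.
  - rewrite (L1 _ H1), (L1 _ H2), (L1 _ H3). fold (root8 N). assert (H := ln_le_minus_1 (root8 N) ltac:(lra)). lra.
  - unfold root8 in *. rewrite <- (sqrt_sqrt (sqrt (INR N))) at 1 by lra.
    rewrite <- (sqrt_sqrt (sqrt (sqrt (INR N)))) at 1 2 by lra. ring.
Qed.

Lemma eventually_root8 (K : R) : exists N0, forall N, (N0 <= N)%nat -> K <= root8 N.
Proof.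
  destruct (eventually_INR ((Rmax K 0) ^ 8)) as [N0 H0]. exists N0. intros N HN. specialize (H0 N HN).
  assert (HK := Rmax_l K 0). assert (HK0 := Rmax_r K 0). set (M := Rmax K 0) in *.
  assert (S : forall a y, 0 <= a -> a ^ 2 <= y -> a <= sqrt y).
  { intros a y Ha Hy. rewrite <- (sqrt_pow2 a Ha). now apply sqrt_le_1_alt. }
  apply Rle_trans with M; [easy|]. unfold root8.
  apply S; [easy|]. apply S; [now apply pow_le|]. apply S; [apply pow_le; now apply pow_le|].
  replace (((M ^ 2) ^ 2) ^ 2) with (M ^ 8) by ring. easy.
Qed.

Lemma eventually_ln_ge_1 : exists N0, forall N, (N0 <= N)%nat -> 1 <= ln (INR N).
Proof.
  destruct (eventually_INR (exp 1)) as [N0 H0]. exists N0. intros N HN.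
  rewrite <- (ln_exp 1). apply ln_le; [apply exp_pos|auto].
Qed.

Definition om (A : R) (N : nat) : R := sqrt (A * ln (INR N)).

Lemma om_spec A N : 0 < A -> (1 <= N)%nat -> 0 <= om A N /\ om A N ^ 2 = A * ln (INR N) /\ om A N <= 1 + A * ln (INR N).
Proof.
  intros HA HN. assert (0 <= ln (INR N)) by (rewrite <- ln_1; apply ln_le; [lra|apply (le_INR 1); lia]).
  assert (H0 : 0 <= A * ln (INR N)) by (apply Rmult_le_pos; lra).
  assert (H1 := sqrt_pos (A * ln (INR N))). assert (H2 := pow2_sqrt _ H0). unfold om.
  split; [easy|]. split; [easy|]. rewrite <- H2 at 2.
  assert (0 <= (sqrt (A * ln (INR N)) - 1) ^ 2) by apply pow2_ge_0. nra.
Qed.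

Lemma om_root8 A N : 0 < A -> (1 <= N)%nat -> om A N <= (1 + 8 * A) * root8 N.
Proof.
  intros HA HN. destruct (om_spec A N HA HN) as [_ [_ H]]. destruct (root8_spec N HN) as [H1 [H2 _]].
  assert (A * ln (INR N) <= A * (8 * root8 N)) by (apply Rmult_le_compat_l; lra). lra.
Qed.

Lemma exp_minus_1_bound u : Rabs u <= / 2 -> Rabs (exp u - 1) <= 2 * Rabs u.
Proof.
  intros Hu. assert (H1 := exp_ineq1_le u). assert (H2 := exp_ineq1_le (- u)).
  rewrite exp_Ropp in H2. assert (He := exp_pos u).
  assert (Hb := Rle_abs u). assert (Hb' := Rle_abs (- u)). rewrite Rabs_Ropp in Hb'.
  assert (H3 : exp u * (1 - u) <= 1).
  { apply (Rmult_le_compat_l (exp u)) in H2; [|lra]. rewrite Rinv_r in H2 by lra. lra. }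
  apply Rabs_le. split.
  - lra.
  - unfold Rabs in *. destruct (Rcase_abs u); nra.
Qed.

(** From [t^3 <= 27 exp t] and [|s| - s^2/2 <= 1/2]. The cubic error in the logarithm of the weight
    thus becomes a uniform error once multiplied by the Gaussian. *)
Lemma gauss_cube s c : 0 <= c -> gauss s * (Rabs s + c) ^ 3 <= 27 * exp (c + / 2).
Proof.
  intros Hc. set (t := Rabs s + c). assert (Hs := Rabs_pos s).
  assert (Ht : 0 <= t) by (unfold t; lra).
  assert (E := exp_ineq1_le (t / 3)).
  assert (E3 : t ^ 3 <= 27 * exp t).
  { replace (exp t) with (exp (t / 3) ^ 3).
    - replace (27 * exp (t / 3) ^ 3) with ((3 * exp (t / 3)) ^ 3) by ring. apply pow_incr. lra.
    - simpl. rewrite Rmult_1_r, <- !exp_plus. f_equal. field. }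
  assert (Hg := gauss_pos s).
  apply Rle_trans with (gauss s * (27 * exp t)); [apply Rmult_le_compat_l; lra|].
  unfold gauss. replace (exp (- s ^ 2 / 2) * (27 * exp t)) with (27 * (exp (- s ^ 2 / 2) * exp t)) by ring.
  rewrite <- exp_plus. apply Rmult_le_compat_l; [lra|]. apply exp_le_mono.
  unfold t. rewrite <- (pow2_abs s). assert (0 <= (Rabs s - 1) ^ 2) by apply pow2_ge_0. lra.
Qed.

(** The scale [c0] is common to all levels and is never computed; its crude lower bound serves only
    to discard the far levels. *)
Lemma weight_local b p m A : (3 <= p)%nat -> 0 < m < 1 -> dH b p m = 0 -> d2H b p m < 0 -> 0 < A ->
  let L := - d2H b p m in
  exists C N0, 0 < C /\ forall N, (N0 <= N)%nat -> exists c0, 0 < c0 /\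
    (forall k, (k <= N)%nat -> Rabs (score L m N k) <= om A N ->
       Rabs (weight b p N k / c0 - gauss (score L m N k)) <= C / sqrt (INR N)) /\
    exp (INR N * (ln 2 + Hfun b p m) - C - 2 * (1 + ln (INR N))) <= c0.
Proof.
  intros Hp Hm Hd H2 HA L. assert (HL : 0 < L) by (unfold L; lra).
  assert (HsL : 0 < sqrt L) by now apply sqrt_lt_R0.
  assert (HssL : sqrt L * sqrt L = L) by (apply sqrt_sqrt; lra).
  destruct (ln_weight_gauss b p m Hp Hm Hd H2) as [d [K [Hd0 [HK Hw]]]]. fold L in Hw.
  destruct (taylor2_local (Hfun b p) (dH b p) m) as [d3 [K3 [Hd3 [HK3 Ht]]]].
  { assert (Hq : 0 < Rmin m (1 - m)) by (apply Rmin_case; lra).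
    exists (mkposreal _ Hq). intros y Hy.
    assert (Hy' : Rabs (y - m) < Rmin m (1 - m)) by exact Hy. apply Rabs_def2 in Hy'.
    assert (B1 := Rmin_l m (1 - m)). assert (B2 := Rmin_r m (1 - m)).
    apply is_derive_Hfun. lra. }
  { eexists. apply is_derive_dH. lra. }
  (* In [t = |s| + cc], the part [2 * sqrt L] absorbs the displacement [2/N] and the part 1 ensures
     [t >= 1]. *)
  set (cc := 1 + 2 * sqrt L).
  (* [K' * t^3 / sqrt N] is the bound of [ln_weight_gauss] after inserting [a <= t / sqrt (L N)];
     below, [K''] satisfies [t <= K'' * q] in the window. *)
  set (K' := K * (1 + / L) / sqrt L).
  set (K'' := 1 + 8 * A + cc).
  assert (HiL : 0 < / L) by now apply Rinv_0_lt_compat.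
  assert (HK' : 0 <= K').
  { unfold K'. apply Rmult_le_pos; [apply Rmult_le_pos; lra|left; now apply Rinv_0_lt_compat]. }
  assert (HK'' : 1 < K'') by (unfold K'', cc; lra).
  (* The second term brings the window within radius [d]; the third makes the logarithmic error at
     most 1/2. *)
  destruct (eventually_root8 (1 + K'' / (sqrt L * d) + 2 * (K' * K'' ^ 3))) as [N1 HN1].
  destruct (eventually_INR (1 + 2 / d3)) as [N2 HN2].
  set (C := 1 + 2 * K' * (27 * exp (cc + / 2)) + 4 * K3).
  assert (HE : 0 <= K' * (27 * exp (cc + / 2))) by (apply Rmult_le_pos; [easy|]; assert (H := exp_pos (cc + / 2)); lra).
  exists C, (N1 + N2)%nat. split; [unfold C; lra|].
  intros N HN. specialize (HN1 N ltac:(lia)). specialize (HN2 N ltac:(lia)).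
  assert (Hd3' : 0 < 2 / d3) by (apply Rdiv_lt_0_compat; lra).
  assert (HN0 : 0 < INR N) by lra.
  assert (HNn : (1 <= N)%nat) by (apply INR_le; simpl; lra).
  destruct (root8_spec N HNn) as [Hq1 [Hq2 Hq3]]. set (q := root8 N) in *.
  assert (HsN : 0 < sqrt (INR N)) by now apply sqrt_lt_R0.
  assert (HssN : sqrt (INR N) * sqrt (INR N) = INR N) by (apply sqrt_sqrt; lra).
  assert (HsN1 : 1 <= sqrt (INR N)) by (rewrite Hq3; apply pow_R1_Rle; easy).
  destruct (exists_mag_near N m HNn Hm) as [k0 [Hk0 Hmk0]].
  set (r0 := ln (weight b p N k0) + score L m N k0 ^ 2 / 2).
  (* The scale is the weight of the level next to [m], corrected by the Gaussian factor of that
     level. *)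
  exists (exp r0). split; [apply exp_pos|].
  split.
  - intros k Hk Hs. specialize (Hw N k0 k HNn Hk0 Hk Hmk0). fold r0 in Hw.
    set (s := score L m N k) in *. set (t := Rabs s + cc).
    assert (Hs0 := Rabs_pos s).
    assert (Ht1 : 1 <= t) by (unfold t, cc; lra).
    assert (HtK : t <= K'' * q).
    { assert (H := om_root8 A N HA HNn). fold q in H. unfold t, K''.
      assert (cc * 1 <= cc * q) by (apply Rmult_le_compat_l; unfold cc; lra). lra. }
    assert (HsLN : sqrt (L * INR N) = sqrt L * sqrt (INR N)) by (apply sqrt_mult; lra).
    assert (Has : Rabs (mag N k - m) = Rabs s / (sqrt L * sqrt (INR N))).
    { unfold s, score. rewrite Rabs_mult, HsLN, (Rabs_pos_eq (sqrt L * sqrt (INR N))) by (apply Rmult_le_pos; lra).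
      field. lra. }
    set (a := Rabs (mag N k - m) + 2 / INR N) in *.
    assert (Ha0 : 0 <= a).
    { unfold a. assert (H := Rabs_pos (mag N k - m)). assert (0 < 2 / INR N) by (apply Rdiv_lt_0_compat; lra). lra. }
    assert (Hat : a <= t / (sqrt L * sqrt (INR N))).
    { unfold a. rewrite Has. replace (2 / INR N) with ((2 * sqrt L / sqrt (INR N)) / (sqrt L * sqrt (INR N))).
      2:{ rewrite <- HssN at 3. field. lra. }
      unfold Rdiv at 1 2 4. rewrite <- Rmult_plus_distr_r. apply Rmult_le_compat_r.
      { left; apply Rinv_0_lt_compat. now apply Rmult_lt_0_compat. }
      unfold t, cc. assert (2 * sqrt L / sqrt (INR N) <= 2 * sqrt L).
      { apply Rle_div_l; [easy|]. assert (2 * sqrt L * 1 <= 2 * sqrt L * sqrt (INR N)) by (apply Rmult_le_compat_l; lra). lra. }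
      lra. }
    assert (HKd : 0 < K'' / (sqrt L * d)) by (apply Rdiv_lt_0_compat; [lra|now apply Rmult_lt_0_compat]).
    assert (HKK : 0 <= K' * K'' ^ 3) by (apply Rmult_le_pos; [easy|apply pow_le; lra]).
    assert (Had : a <= d).
    { eapply Rle_trans; [apply Hat|]. apply Rle_div_l; [now apply Rmult_lt_0_compat|].
      eapply Rle_trans; [apply HtK|]. rewrite Hq3.
      assert (J : K'' / (sqrt L * d) * (sqrt L * d) = K'') by (field; lra).
      assert (J2 : K'' <= q * (sqrt L * d)).
      { rewrite <- J. apply Rmult_le_compat_r; [|lra]. apply Rmult_le_pos; lra. }
      assert (Hqq : q ^ 2 <= q ^ 4) by (apply Rle_pow; [easy|lia]).
      apply (Rmult_le_compat_r q) in J2; [|lra].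
      apply Rle_trans with (sqrt L * d * q ^ 2); [lra|].
      replace (d * (sqrt L * q ^ 4)) with (sqrt L * d * q ^ 4) by ring.
      apply Rmult_le_compat_l; [apply Rmult_le_pos; lra|easy]. }
    specialize (Hw Had).
    set (e := ln (weight b p N k) + s ^ 2 / 2 - r0) in *.
    assert (He : Rabs e <= K' * t ^ 3 / sqrt (INR N)).
    { eapply Rle_trans; [apply Hw|].
      set (a1 := t / (sqrt L * sqrt (INR N))) in *.
      assert (a ^ 2 <= a1 ^ 2) by (apply pow_incr; lra).
      assert (0 < / INR N) by now apply Rinv_0_lt_compat.
      assert (0 <= a ^ 2) by apply pow2_ge_0.
      apply Rle_trans with (K * (/ INR N + a1 ^ 2) * (INR N * a1)).
      - apply Rmult_le_compat.
        + apply Rmult_le_pos; lra.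
        + apply Rmult_le_pos; lra.
        + apply Rmult_le_compat_l; lra.
        + apply Rmult_le_compat_l; lra.
      - assert (Ea : a1 ^ 2 = t ^ 2 * / L * / INR N).
        { unfold a1. replace ((t / (sqrt L * sqrt (INR N))) ^ 2) with (t ^ 2 / (sqrt L * sqrt L * (sqrt (INR N) * sqrt (INR N)))) by (field; lra).
          rewrite HssL, HssN. field. lra. }
        assert (Eb : INR N * a1 = t * sqrt (INR N) / sqrt L).
        { unfold a1. transitivity (sqrt (INR N) * sqrt (INR N) * (t / (sqrt L * sqrt (INR N)))); [now rewrite HssN|field; lra]. }
        rewrite Ea, Eb.
        replace (K * (/ INR N + t ^ 2 * / L * / INR N) * (t * sqrt (INR N) / sqrt L)) with
          (K / sqrt L * (t + t ^ 3 * / L) * (sqrt (INR N) / INR N)) by (field; lra).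
        replace (sqrt (INR N) / INR N) with (/ sqrt (INR N)) by (apply (Rmult_eq_reg_r (sqrt (INR N) * sqrt (INR N))); [rewrite HssN at 2; field; lra|rewrite HssN; lra]).
        unfold K', Rdiv. apply Rmult_le_compat_r; [left; now apply Rinv_0_lt_compat|].
        replace (K * (1 + / L) * / sqrt L * t ^ 3) with (K * / sqrt L * (t ^ 3 + t ^ 3 * / L)) by ring.
        apply Rmult_le_compat_l.
        + apply Rmult_le_pos; [easy|]. left; now apply Rinv_0_lt_compat.
        + assert (t ^ 1 <= t ^ 3) by (apply Rle_pow; [easy|lia]). lra. }
    assert (He2 : Rabs e <= / 2).
    { eapply Rle_trans; [apply He|]. apply Rle_div_l; [easy|]. rewrite Hq3.
      apply Rle_trans with (K' * (K'' * q) ^ 3).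
      - apply Rmult_le_compat_l; [easy|]. apply pow_incr. lra.
      - replace (K' * (K'' * q) ^ 3) with (K' * K'' ^ 3 * q ^ 3) by ring.
        replace (/ 2 * q ^ 4) with (q / 2 * q ^ 3) by field.
        apply Rmult_le_compat_r; [apply pow_le; lra|lra]. }
    assert (Hwe : weight b p N k / exp r0 = gauss s * exp e).
    { unfold gauss. rewrite <- exp_plus. replace (- s ^ 2 / 2 + e) with (ln (weight b p N k) + - r0) by (unfold e; field).
      rewrite exp_plus, exp_Ropp, exp_ln by apply weight_pos. easy. }
    rewrite Hwe. replace (gauss s * exp e - gauss s) with (gauss s * (exp e - 1)) by ring.
    assert (Hg := gauss_pos s).
    rewrite Rabs_mult, (Rabs_pos_eq (gauss s)) by lra.
    assert (Hem := exp_minus_1_bound e He2).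
    assert (Hcube := gauss_cube s cc ltac:(unfold cc; lra)). fold t in Hcube.
    apply Rle_trans with (gauss s * (2 * (K' * t ^ 3 / sqrt (INR N)))).
    { apply Rmult_le_compat_l; lra. }
    replace (gauss s * (2 * (K' * t ^ 3 / sqrt (INR N)))) with ((2 * K') * (gauss s * t ^ 3) / sqrt (INR N)) by (field; lra).
    unfold Rdiv. apply Rmult_le_compat_r; [left; now apply Rinv_0_lt_compat|].
    apply Rle_trans with ((2 * K') * (27 * exp (cc + / 2))); [apply Rmult_le_compat_l; lra|]. unfold C. lra.
  - apply exp_le_mono. unfold r0.
    assert (Hcr := ln_weight_crude b p N k0 ltac:(lia) HNn Hk0). apply Rabs_le_between in Hcr.
    assert (H2N : 2 / INR N <= d3).
    { apply Rle_div_l; [easy|]. assert (2 / d3 * d3 = 2) by (field; lra). nra. }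
    assert (Hab : Rabs (mag N k0 - m) <= 2 / INR N) by (rewrite Rabs_left1; lra).
    specialize (Ht (mag N k0) ltac:(lra)). rewrite Hd in Ht. apply Rabs_le_between in Ht.
    assert (Hsq : (mag N k0 - m) ^ 2 <= (2 / INR N) ^ 2).
    { rewrite <- pow2_abs. apply pow_incr. split; [apply Rabs_pos|easy]. }
    (* At distance at most [2/N] from the critical point, [N (H m - H x)] is bounded by a
       constant. *)
    assert (HNK : INR N * (K3 * (mag N k0 - m) ^ 2) <= 4 * K3).
    { apply Rle_trans with (INR N * (K3 * (2 / INR N) ^ 2)).
      - apply Rmult_le_compat_l; [lra|]. apply Rmult_le_compat_l; lra.
      - replace (INR N * (K3 * (2 / INR N) ^ 2)) with (4 * K3 / INR N) by (field; lra).
        apply Rle_div_l; [easy|]. nra. }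
    assert (INR N * (Hfun b p m - K3 * (mag N k0 - m) ^ 2) <= INR N * Hfun b p (mag N k0)).
    { apply Rmult_le_compat_l; lra. }
    assert (0 <= score L m N k0 ^ 2) by apply pow2_ge_0.
    unfold C. lra.
Qed.

(** * Mass away from the maximizers *)

Lemma Hfun_opp_even b p x : Nat.even p = true -> Hfun b p (- x) = Hfun b p x.
Proof.
  intros H. apply Nat.even_spec in H as [q ->]. unfold Hfun, Ient.
  rewrite !pow_mult. replace ((- x) ^ 2) with (x ^ 2) by ring.
  replace (1 + - x) with (1 - x) by ring. replace (1 - - x) with (1 + x) by ring. ring.
Qed.

Lemma Hfun_opp_odd b p x : Nat.even p = false -> Hfun b p (- x) = Hfun b p x - 2 * b * x ^ p.
Proof.
  intros H. assert (Ho : Nat.odd p = true) by (unfold Nat.odd; now rewrite H).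
  apply Nat.odd_spec in Ho as [q ->]. unfold Hfun, Ient.
  rewrite !pow_add, !pow_mult. replace ((- x) ^ 2) with (x ^ 2) by ring.
  replace (1 + - x) with (1 - x) by ring. replace (1 - - x) with (1 + x) by ring. ring.
Qed.

(** For odd [p] and [x < 0], reflection costs [2 b |x|^p]: a fixed loss if [|x| >= m/2], while
    otherwise [|x|] is at distance at least [m/2] from [m] and the quadratic bound gives a fixed
    loss. The division by 4 is due to [(x - m)^2 <= 4]. *)
Lemma Hfun_quadratic_global b p m : (3 <= p)%nat -> 0 < m < 1 -> 0 < b ->
  (forall y, 0 <= y <= 1 -> Hfun b p y <= Hfun b p m) -> 0 < Hfun b p m ->
  exists c, 0 < c /\ forall x, -1 <= x <= 1 ->
    Hfun b p x <= Hfun b p m - c * (x - m) ^ 2 \/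
    (Nat.even p = true /\ Hfun b p x <= Hfun b p m - c * (- x - m) ^ 2).
Proof.
  intros Hp Hm Hb Hmax HH.
  destruct (Hfun_quadratic_max b p m Hp Hm Hmax HH) as [c [Hc Hq]].
  set (g := Rmin (2 * b * (m / 2) ^ p) (c * (m / 2) ^ 2)).
  assert (Hmp : 0 < (m / 2) ^ p) by (apply pow_lt; lra).
  assert (Hm2 : 0 < (m / 2) ^ 2) by (apply pow_lt; lra).
  assert (Hg1 : g <= 2 * b * (m / 2) ^ p) by apply Rmin_l.
  assert (Hg2 : g <= c * (m / 2) ^ 2) by apply Rmin_r.
  assert (Hg : 0 < g).
  { apply Rmin_case; [|apply Rmult_lt_0_compat; lra]. apply Rmult_lt_0_compat; lra. }
  assert (M1 := Rmin_l c (g / 4)). assert (M2 := Rmin_r c (g / 4)).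
  exists (Rmin c (g / 4)). split; [apply Rmin_case; lra|].
  set (c' := Rmin c (g / 4)) in *.
  intros x Hx. destruct (Rle_lt_dec 0 x) as [H0|H0].
  - left. specialize (Hq x ltac:(lra)). assert (0 <= (x - m) ^ 2) by apply pow2_ge_0. nra.
  - specialize (Hq (- x) ltac:(lra)). assert (0 <= (- x - m) ^ 2) by apply pow2_ge_0.
    destruct (Nat.even p) eqn:He.
    + right. split; [easy|]. rewrite (Hfun_opp_even b p x He) in Hq. nra.
    + left. rewrite (Hfun_opp_odd b p x He) in Hq.
      assert (Hx4 : (x - m) ^ 2 <= 4) by (simpl; nra).
      assert (Hxm : 0 <= (x - m) ^ 2) by apply pow2_ge_0.
      assert (Hcx : c' * (x - m) ^ 2 <= g).
      { apply Rle_trans with (g / 4 * 4); [|lra]. apply Rle_trans with (g / 4 * (x - m) ^ 2); [apply Rmult_le_compat_r; lra|apply Rmult_le_compat_l; lra]. }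
      assert (E := Hfun_opp_odd b p (- x) He). rewrite Ropp_involutive in E.
      assert (Q := Hfun_opp_odd b p x He).
      enough (Hfun b p x <= Hfun b p m - g) by lra.
      assert (Hxp : 0 <= (- x) ^ p) by (apply pow_le; lra).
      destruct (Rle_lt_dec (m / 2) (- x)) as [H1|H1].
      * assert ((m / 2) ^ p <= (- x) ^ p) by (apply pow_incr; lra).
        assert (2 * b * (m / 2) ^ p <= 2 * b * (- x) ^ p) by (apply Rmult_le_compat_l; lra).
        assert (0 <= c * (- x - m) ^ 2) by (apply Rmult_le_pos; lra). lra.
      * assert ((m / 2) ^ 2 <= (- x - m) ^ 2) by (simpl; nra).
        assert (c * (m / 2) ^ 2 <= c * (- x - m) ^ 2) by (apply Rmult_le_compat_l; lra).
        assert (0 <= 2 * b * (- x) ^ p) by (apply Rmult_le_pos; lra). lra.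
Qed.

Lemma weight_mirror b p N k : Nat.even p = true -> (k <= N)%nat -> weight b p N (N - k) = weight b p N k.
Proof.
  intros He Hk. unfold weight. rewrite <- pascal_step1 by easy.
  rewrite minus_INR by easy. replace (2 * (INR N - INR k) - INR N) with (- (2 * INR k - INR N)) by ring.
  now rewrite energy_even.
Qed.

(** Outside the window [c N (x - m)^2 >= (c A / L) ln N >= 6 ln N]. The crude bounds for the weight
    and for [c0] lose [2 ln N] each, so [N^-2] survives; this is the origin of the 6. *)
Lemma weight_far b p m A c L N k C c0 : (1 <= p)%nat -> (1 <= N)%nat -> (k <= N)%nat -> 0 < L -> 0 < c -> 0 < A ->
  6 * L <= c * A ->
  Hfun b p (mag N k) <= Hfun b p m - c * (mag N k - m) ^ 2 ->
  exp (INR N * (ln 2 + Hfun b p m) - C - 2 * (1 + ln (INR N))) <= c0 ->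
  om A N < Rabs (score L m N k) ->
  weight b p N k / c0 <= exp (4 + C) / INR N ^ 2.
Proof.
  intros Hp HN Hk HL Hc HA HcA HH Hc0 Hs.
  assert (HN0 : 0 < INR N) by (apply lt_0_INR; lia).
  assert (Hln : 0 <= ln (INR N)) by (rewrite <- ln_1; apply ln_le; [lra|apply (le_INR 1); lia]).
  destruct (om_spec A N HA HN) as [Ho1 [Ho2 _]].
  assert (Hsq : A * ln (INR N) <= L * INR N * (mag N k - m) ^ 2).
  { rewrite <- Ho2. replace (L * INR N * (mag N k - m) ^ 2) with (score L m N k ^ 2).
    - rewrite <- (pow2_abs (score L m N k)). apply pow_incr. lra.
    - unfold score. rewrite Rpow_mult_distr, pow2_sqrt; [easy|]. apply Rmult_le_pos; lra. }
  assert (H6 : 6 * ln (INR N) <= INR N * (c * (mag N k - m) ^ 2)).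
  { apply (Rmult_le_reg_l L); [easy|].
    apply Rle_trans with (c * (A * ln (INR N))).
    - replace (c * (A * ln (INR N))) with (c * A * ln (INR N)) by ring.
      replace (L * (6 * ln (INR N))) with (6 * L * ln (INR N)) by ring. now apply Rmult_le_compat_r.
    - replace (L * (INR N * (c * (mag N k - m) ^ 2))) with (c * (L * INR N * (mag N k - m) ^ 2)) by ring.
      apply Rmult_le_compat_l; lra. }
  assert (Hcr := ln_weight_crude b p N k Hp HN Hk). apply Rabs_le_between in Hcr.
  assert (HNH : INR N * Hfun b p (mag N k) <= INR N * (Hfun b p m - c * (mag N k - m) ^ 2)) by (apply Rmult_le_compat_l; lra).
  assert (Hc0p : 0 < c0) by (eapply Rlt_le_trans; [apply exp_pos|apply Hc0]).
  apply Rle_div_l; [easy|].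
  rewrite <- (exp_ln (weight b p N k)) by apply weight_pos.
  assert (HNe : exp (4 + C) / INR N ^ 2 = exp (4 + C - 2 * ln (INR N))).
  { replace (4 + C - 2 * ln (INR N)) with (4 + C + (- ln (INR N) + - ln (INR N))) by ring.
    rewrite (exp_plus (4 + C)), (exp_plus (- ln (INR N)) (- ln (INR N))), exp_Ropp, exp_ln by easy. field. lra. }
  rewrite HNe.
  apply Rle_trans with (exp (4 + C - 2 * ln (INR N)) * exp (INR N * (ln 2 + Hfun b p m) - C - 2 * (1 + ln (INR N)))).
  - rewrite <- exp_plus. apply exp_le_mono. lra.
  - apply Rmult_le_compat_l; [left; apply exp_pos|easy].
Qed.

(** * The window *)

Lemma sum_reverse (f : nat -> R) (N : nat) : sum_f_R0 (fun k => f (N - k)%nat) N = sum_f_R0 f N.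
Proof.
  revert f; induction N as [|N IH]; intros f; [easy|].
  rewrite decomp_sum by lia. cbn [Nat.pred]. rewrite (tech5 f), <- (IH f).
  rewrite (Rplus_comm (f (S N - 0)%nat)). reflexivity.
Qed.

Lemma sum_le_const (f : nat -> R) (B : R) (N : nat) : (forall k, (k <= N)%nat -> f k <= B) ->
  sum_f_R0 f N <= INR (S N) * B.
Proof.
  intros H. induction N as [|N IH]; [simpl; rewrite Rmult_1_l; now apply H|].
  rewrite tech5. specialize (IH ltac:(intros; apply H; lia)). specialize (H (S N) ltac:(lia)).
  rewrite (S_INR (S N)). lra.
Qed.

Lemma is_derive_invert p x : (3 <= p)%nat -> 0 < x < 1 -> is_derive (invert p) x (phi p x / x ^ p / INR p).
Proof.
  intros Hp Hx. assert (0 < INR p) by (apply lt_0_INR; lia).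
  apply (is_derive_ext (fun x => / INR p * hr p x)).
  - intros t. unfold invert, hr, Rdiv. rewrite Rinv_mult. eqR. ring.
  - evar_last; [apply (is_derive_scal (hr p)), is_derive_hr; easy|]. field.
    split; [apply pow_nonzero; lra|lra].
Qed.

Lemma eventually_om_le A L r : 0 < A -> 0 < L -> 0 < r ->
  exists N0, forall N, (N0 <= N)%nat -> om A N <= sqrt (L * INR N) * r.
Proof.
  intros HA HL Hr. assert (HsL : 0 < sqrt L) by now apply sqrt_lt_R0.
  destruct (eventually_root8 (1 + (1 + 8 * A) / (sqrt L * r))) as [N0 HN0].
  exists (S N0). intros N HN. specialize (HN0 N ltac:(lia)).
  assert (HNn : (1 <= N)%nat) by lia.
  destruct (root8_spec N HNn) as [Hq1 [_ Hq3]].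
  eapply Rle_trans; [now apply om_root8|]. set (q := root8 N) in *.
  rewrite sqrt_mult by (try apply pos_INR; lra).
  assert (J : (1 + 8 * A) / (sqrt L * r) * (sqrt L * r) = 1 + 8 * A) by (field; lra).
  assert (Hsr : 0 < sqrt L * r) by now apply Rmult_lt_0_compat.
  assert (J2 : 1 + 8 * A <= q * (sqrt L * r)).
  { rewrite <- J. apply Rmult_le_compat_r; lra. }
  apply (Rmult_le_compat_r q) in J2; [|lra].
  assert (Hqq : q ^ 2 <= q ^ 4) by (apply Rle_pow; [easy|lia]).
  apply Rle_trans with (sqrt L * r * q ^ 2); [lra|]. rewrite Hq3.
  replace (sqrt L * q ^ 4 * r) with (sqrt L * r * q ^ 4) by ring.
  apply Rmult_le_compat_l; lra.
Qed.

Lemma score_near L m N k r : 0 < L -> (1 <= N)%nat ->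
  Rabs (score L m N k) <= sqrt (L * INR N) * r -> Rabs (mag N k - m) <= r.
Proof.
  intros HL HN H. assert (HN0 : 0 < INR N) by (apply lt_0_INR; lia).
  assert (Hs : 0 < sqrt (L * INR N)) by (apply sqrt_lt_R0, Rmult_lt_0_compat; lra).
  unfold score in H. rewrite Rabs_mult, (Rabs_pos_eq (sqrt _)) in H by lra.
  now apply Rmult_le_reg_l in H.
Qed.

Lemma mle_window b p m A : (3 <= p)%nat -> 0 < m < 1 -> dH b p m = 0 -> d2H b p m < 0 -> 0 < A ->
  let L := - d2H b p m in
  exists C N0, 0 < C /\ forall N X bh k, (N0 <= N)%nat -> In X (configs N) ->
    ((exists b, is_mple p X b) -> is_mple p X bh) ->
    k = npos X \/ (Nat.even p = true /\ k = (N - npos X)%nat) ->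
    Rabs (score L m N k) <= om A N ->
    Rabs (sqrt (INR N) * (bh - b) - sqrt L / (INR p * m ^ (p - 1)) * score L m N k) <= C * ln (INR N) / sqrt (INR N).
Proof.
  intros Hp Hm Hd H2 HA L. assert (HL : 0 < L) by (unfold L; lra).
  assert (Hp0 : 0 < INR p) by (apply lt_0_INR; lia).
  assert (HsL : 0 < sqrt L) by now apply sqrt_lt_R0.
  assert (HssL : sqrt L * sqrt L = L) by (apply sqrt_sqrt; lra).
  assert (Hmp : 0 < m ^ (p - 1)) by (apply pow_lt; lra).
  assert (Hr : 0 < Rmin m (1 - m)) by (apply Rmin_case; lra).
  assert (B1 := Rmin_l m (1 - m)). assert (B2 := Rmin_r m (1 - m)).
  destruct (mple_bracket p m Hp Hm) as [C1 [N1 [HC1 Hbr]]].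
  destruct (taylor2_local (invert p) (fun x => phi p x / x ^ p / INR p) m) as [d [K [Hd0 [HK Ht]]]].
  { exists (mkposreal _ Hr). intros y Hy.
    assert (Hy' : Rabs (y - m) < Rmin m (1 - m)) by exact Hy. apply Rabs_def2 in Hy'.
    apply is_derive_invert; [easy|lra]. }
  { apply (ex_derive_ext (fun x => / INR p * (phi p x / x ^ p))).
    - intros t. eqR. unfold Rdiv. ring.
    - apply ex_derive_scal. apply (ex_derive_div (phi p) (fun x => x ^ p)).
      + eexists; apply is_derive_phi; [easy|lra].
      + auto_derive. easy.
      + apply pow_nonzero. lra. }
  assert (Hinv : invert p m = b).
  { unfold invert. unfold dH in Hd. replace (ath m) with (b * (INR p * m ^ (p - 1))) by lra. field. lra. }
  assert (Hphi : phi p m = m * L).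
  { unfold L, d2H, phi, dH in *. replace (ath m) with (b * (INR p * m ^ (p - 1))) by lra.
    replace (p - 1)%nat with (S (p - 2)) by lia. change (m ^ S (p - 2)) with (m * m ^ (p - 2)).
    field. nra. }
  assert (Hslope : phi p m / m ^ p / INR p = L / (INR p * m ^ (p - 1))).
  { rewrite Hphi. replace p with (S (p - 1)) at 1 by lia. simpl (m ^ S _). field. lra. }
  rewrite Hslope, Hinv in Ht.
  set (r := Rmin (Rmin m (1 - m) / 2) d).
  assert (Hr0 : 0 < r) by (apply Rmin_case; lra).
  assert (Hr1 : r <= Rmin m (1 - m) / 2) by apply Rmin_l. assert (Hr2 : r <= d) by apply Rmin_r.
  destruct (eventually_om_le A L r HA HL Hr0) as [N2 HN2].
  destruct eventually_ln_ge_1 as [N3 HN3].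
  assert (HKA : 0 <= K * A / L) by (apply Rmult_le_pos; [apply Rmult_le_pos; lra|left; now apply Rinv_0_lt_compat]).
  (* [C1] comes from the bracket for the maximizer, and [K * A / L] from the Taylor remainder of
     [invert] with [(x - m)^2 <= A ln N / (L N)]. *)
  exists (C1 + K * A / L), (1 + N1 + N2 + N3)%nat. split; [lra|].
  intros N X bh k HN HX Hbh Hk Hs.
  specialize (HN2 N ltac:(lia)). specialize (HN3 N ltac:(lia)).
  assert (HNn : (1 <= N)%nat) by lia.
  assert (HN0 : 0 < INR N) by (apply lt_0_INR; lia).
  assert (HsN : 0 < sqrt (INR N)) by now apply sqrt_lt_R0.
  assert (HssN : sqrt (INR N) * sqrt (INR N) = INR N) by (apply sqrt_sqrt; lra).
  destruct (om_spec A N HA HNn) as [Ho1 [Ho2 _]].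
  set (s := score L m N k) in *.
  assert (HsLN : sqrt (L * INR N) = sqrt L * sqrt (INR N)) by (apply sqrt_mult; lra).
  assert (Hxs : mag N k - m = s / (sqrt L * sqrt (INR N))).
  { unfold s, score. rewrite HsLN. field. lra. }
  assert (Hsp : 0 < sqrt L * sqrt (INR N)) by now apply Rmult_lt_0_compat.
  assert (Hxr : Rabs (mag N k - m) <= r) by (apply (score_near L m N k r HL HNn); fold s; lra).
  specialize (Hbr N X bh k ltac:(lia) HX Hbh Hk ltac:(lra)).
  specialize (Ht (mag N k) ltac:(lra)).
  replace (sqrt (INR N) * (bh - b) - sqrt L / (INR p * m ^ (p - 1)) * s) with
    (sqrt (INR N) * ((bh - invert p (mag N k)) + (invert p (mag N k) - b - L / (INR p * m ^ (p - 1)) * (mag N k - m)))).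
  2:{ rewrite Hxs. rewrite <- HssL at 1. field. lra. }
  rewrite Rabs_mult, (Rabs_pos_eq (sqrt (INR N))) by lra.
  apply Rle_trans with (sqrt (INR N) * (C1 / INR N + K * (mag N k - m) ^ 2)).
  { apply Rmult_le_compat_l; [lra|]. eapply Rle_trans; [apply Rabs_triang|]. lra. }
  assert (Hs2 : s ^ 2 <= A * ln (INR N)).
  { rewrite <- Ho2, <- pow2_abs. apply pow_incr. split; [apply Rabs_pos|easy]. }
  assert (Hx2 : (mag N k - m) ^ 2 = s ^ 2 / (L * INR N)).
  { rewrite Hxs. replace ((s / (sqrt L * sqrt (INR N))) ^ 2) with (s ^ 2 / (sqrt L * sqrt L * (sqrt (INR N) * sqrt (INR N)))) by (field; lra).
    now rewrite HssL, HssN. }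
  rewrite Hx2.
  replace (sqrt (INR N) * (C1 / INR N + K * (s ^ 2 / (L * INR N)))) with ((C1 + K / L * s ^ 2) / sqrt (INR N)).
  2:{ apply (Rmult_eq_reg_r (sqrt (INR N) * sqrt (INR N))); [rewrite HssN at 2; field; lra|rewrite HssN; lra]. }
  unfold Rdiv at 1. apply Rmult_le_compat_r; [left; now apply Rinv_0_lt_compat|].
  assert (K / L * s ^ 2 <= K / L * (A * ln (INR N))).
  { apply Rmult_le_compat_l; [|easy]. apply Rmult_le_pos; [easy|left; now apply Rinv_0_lt_compat]. }
  replace ((C1 + K * A / L) * ln (INR N)) with (C1 * ln (INR N) + K / L * (A * ln (INR N))) by (field; lra).
  assert (C1 * 1 <= C1 * ln (INR N)) by (apply Rmult_le_compat_l; lra). lra.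
Qed.

(** Indicator of the part of the window up to [t], nested like the summand of [riemann_gauss] so
    that the two sums match term by term. *)
Definition win (A L m : R) (N : nat) (t : R) (k : nat) : R :=
  if Rle_dec (- om A N) (score L m N k) then
    if Rle_dec (score L m N k) (Rmin t (om A N)) then 1 else 0 else 0.

Lemma win_1 A L m N t k : Rabs (score L m N k) <= om A N -> score L m N k <= t -> win A L m N t k = 1.
Proof.
  intros H1 H2. apply Rabs_le_between in H1. unfold win.
  assert (score L m N k <= Rmin t (om A N)) by (apply Rmin_glb; lra).
  destruct (Rle_dec (- om A N) _); [|lra]. destruct (Rle_dec (score L m N k) _); lra.
Qed.

Lemma win_cases A L m N t k :
  (win A L m N t k = 1 /\ Rabs (score L m N k) <= om A N /\ score L m N k <= t) \/
  (win A L m N t k = 0 /\ (om A N < Rabs (score L m N k) \/ t < score L m N k)).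
Proof.
  destruct (Rle_lt_dec (Rabs (score L m N k)) (om A N)) as [H1|H1].
  - destruct (Rle_lt_dec (score L m N k) t) as [H2|H2].
    + left. split; [now apply win_1|easy].
    + right. split; [|now right]. unfold win.
      destruct (Rle_dec (- om A N) _); [|easy]. destruct (Rle_dec (score L m N k) _) as [H|]; [|easy].
      assert (H3 := Rmin_l t (om A N)). lra.
  - right. split; [|now left]. unfold win.
    destruct (Rle_dec (- om A N) _); [|easy]. destruct (Rle_dec (score L m N k) _) as [H|]; [|easy].
    assert (H3 := Rmin_r t (om A N)). assert (Rabs (score L m N k) <= om A N) by (apply Rabs_le; lra). lra.
Qed.

(** The value is [N^(-A/2)], so [A >= 1] makes the Gaussian mass cut off by the window
    [O(1 / sqrt N)]. *)
Lemma gauss_om A N : 1 <= A -> (1 <= N)%nat -> gauss (om A N) <= / sqrt (INR N).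
Proof.
  intros HA HN. destruct (om_spec A N ltac:(lra) HN) as [_ [H _]].
  assert (HN0 : 0 < INR N) by (apply lt_0_INR; lia).
  assert (HsN : 0 < sqrt (INR N)) by now apply sqrt_lt_R0.
  assert (Hln : 0 <= ln (INR N)) by (rewrite <- ln_1; apply ln_le; [lra|apply (le_INR 1); lia]).
  unfold gauss. rewrite <- (exp_ln (/ sqrt (INR N))) by now apply Rinv_0_lt_compat.
  assert (Hl2 : ln (INR N) = 2 * ln (sqrt (INR N))).
  { rewrite <- (sqrt_sqrt (INR N)) at 1 by lra. rewrite ln_mult by easy. ring. }
  apply exp_le_mono. rewrite ln_Rinv by easy.
  replace (- om A N ^ 2) with (- (om A N ^ 2)) by ring. rewrite H. nra.
Qed.

(** The factor [q = h / c0], with [h] the spacing of the scores, turns the sum over levels into a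
    Riemann sum. All three clauses share this [q], which lets it cancel in the final quotient. *)
Lemma window_sum b p m A : (3 <= p)%nat -> 0 < m < 1 -> dH b p m = 0 -> d2H b p m < 0 -> 1 <= A ->
  let L := - d2H b p m in
  exists C N0, 0 < C /\ forall N, (N0 <= N)%nat -> exists q, 0 < q /\
    (forall t, Rabs (q * sum_f_R0 (fun k => weight b p N k * win A L m N t k) N - Phi t)
       <= C * ln (INR N) / sqrt (INR N)) /\
    Rabs (q * sum_f_R0 (fun k => weight b p N k * win A L m N (om A N) k) N - sqrt (2 * PI))
       <= C * ln (INR N) / sqrt (INR N) /\
    (forall c k, (k <= N)%nat -> 0 < c -> 6 * L <= c * A ->
       Hfun b p (mag N k) <= Hfun b p m - c * (mag N k - m) ^ 2 ->
       om A N < Rabs (score L m N k) -> q * weight b p N k <= C / INR N ^ 2).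
Proof.
  intros Hp Hm Hd H2 HA1 L. assert (HL : 0 < L) by (unfold L; lra). assert (HA : 0 < A) by lra.
  assert (HsL : 0 < sqrt L) by now apply sqrt_lt_R0.
  destruct (weight_local b p m A Hp Hm Hd H2 HA) as [C [N1 [HC Hloc]]]. fold L in Hloc.
  set (r := Rmin m (1 - m)). assert (Hr : 0 < r) by (apply Rmin_case; lra).
  assert (R1 : r <= m) by apply Rmin_l. assert (R2 : r <= 1 - m) by apply Rmin_r.
  destruct (eventually_om_le A L r HA HL Hr) as [N2 HN2].
  destruct eventually_ln_ge_1 as [N3 HN3].
  destruct (eventually_root8 (2 * sqrt L + C)) as [N4 HN4].
  (* The product bounds [2 om (h + e)] using [om <= (1 + A) ln N]; [8 sqrt L] bounds the two
     boundary cells; half of the 4 pays for the lower tail [Phi (-om)], the other half for values of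
     [t] outside the window. *)
  set (C2 := 2 * (1 + A) * (2 * sqrt L + C) + 8 * sqrt L + 4).
  assert (HA2 : 0 < (1 + A) * (2 * sqrt L + C)) by (apply Rmult_lt_0_compat; lra).
  set (C3 := 2 * sqrt L * exp (4 + C)). assert (He4 := exp_pos (4 + C)).
  assert (HC3 : 0 < C3) by (unfold C3; apply Rmult_lt_0_compat; lra).
  exists (C2 + C3), (1 + N1 + N2 + N3 + N4)%nat. split; [unfold C2; lra|].
  intros N HN. specialize (HN2 N ltac:(lia)). specialize (HN3 N ltac:(lia)). specialize (HN4 N ltac:(lia)).
  destruct (Hloc N ltac:(lia)) as [c0 [Hc0 [Hw Hlow]]].
  assert (HNn : (1 <= N)%nat) by lia.
  assert (HN0 : 0 < INR N) by (apply lt_0_INR; lia).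
  assert (HsN : 0 < sqrt (INR N)) by now apply sqrt_lt_R0.
  assert (HssN : sqrt (INR N) * sqrt (INR N) = INR N) by (apply sqrt_sqrt; lra).
  destruct (root8_spec N HNn) as [Hq1 [_ Hq3]]. set (q8 := root8 N) in *.
  destruct (om_spec A N HA HNn) as [Ho1 [Ho2 Ho3]].
  assert (Hoi : 0 < / sqrt (INR N)) by now apply Rinv_0_lt_compat.
  assert (HsLN : sqrt (L * INR N) = sqrt L * sqrt (INR N)) by (apply sqrt_mult; lra).
  set (h := 2 * sqrt L / sqrt (INR N)).
  assert (Hh : 0 < h) by (unfold h; apply Rdiv_lt_0_compat; lra).
  assert (Hstep : forall k, score L m N (S k) = score L m N k + h).
  { intros k. unfold score, h. rewrite mag_S, HsLN by easy.
    apply (Rmult_eq_reg_r (sqrt (INR N))); [|lra].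
    replace ((sqrt L * sqrt (INR N) * (mag N k - m) + 2 * sqrt L / sqrt (INR N)) * sqrt (INR N)) with
     (sqrt L * (sqrt (INR N) * sqrt (INR N)) * (mag N k - m) + 2 * sqrt L) by (field; lra).
    replace (sqrt L * sqrt (INR N) * (mag N k + 2 / INR N - m) * sqrt (INR N)) with
     (sqrt L * (sqrt (INR N) * sqrt (INR N)) * (mag N k + 2 / INR N - m)) by ring.
    rewrite HssN. field. lra. }
  assert (Homr : om A N <= sqrt L * sqrt (INR N) * r).
  { now rewrite <- HsLN. }
  assert (Hsp : 0 < sqrt L * sqrt (INR N)) by now apply Rmult_lt_0_compat.
  assert (Hs0 : score L m N 0 <= - om A N).
  { unfold score. rewrite HsLN. replace (mag N 0) with (-1) by (unfold mag; simpl; field; lra).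
    assert (sqrt L * sqrt (INR N) * r <= sqrt L * sqrt (INR N) * (1 + m)) by (apply Rmult_le_compat_l; lra). lra. }
  assert (HsN1 : om A N <= score L m N (S N)).
  { rewrite Hstep. unfold score. rewrite HsLN. replace (mag N N) with 1 by (unfold mag; field; lra).
    assert (sqrt L * sqrt (INR N) * r <= sqrt L * sqrt (INR N) * (1 - m)) by (apply Rmult_le_compat_l; lra). lra. }
  assert (HCe : 0 < C / sqrt (INR N)) by (apply Rdiv_lt_0_compat; lra).
  assert (HCe1 : C / sqrt (INR N) <= 1).
  { apply Rle_div_l; [easy|]. rewrite Hq3. assert (q8 ^ 1 <= q8 ^ 4) by (apply Rle_pow; [easy|lia]). lra. }
  assert (Hq : 0 < h / c0) by (now apply Rdiv_lt_0_compat).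
  assert (Hsum : forall t, h / c0 * sum_f_R0 (fun k => weight b p N k * win A L m N t k) N =
     sum_f_R0 (fun k => if Rle_dec (- om A N) (score L m N k) then
        if Rle_dec (score L m N k) (Rmin t (om A N)) then h * (weight b p N k / c0) else 0 else 0) N).
  { intros t. rewrite scal_sum. apply sum_eq. intros k Hk. unfold win.
    destruct (Rle_dec _ _); [destruct (Rle_dec _ _)|]; field; lra. }
  assert (Hg := gauss_om A N HA1 HNn).
  assert (Htail := Phi_tail (om A N) Ho1).
  assert (Hopp := Phi_opp (om A N)).
  assert (Hmain : forall t, - om A N <= t <= om A N ->
     Rabs (h / c0 * sum_f_R0 (fun k => weight b p N k * win A L m N t k) N - Phi t) <= (C2 - 2) * ln (INR N) / sqrt (INR N)).
  { intros t Ht. rewrite Hsum, (Rmin_left t) by lra.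
    assert (HR := riemann_gauss N (score L m N) h (om A N) (C / sqrt (INR N)) t (fun k => weight b p N k / c0)
       ltac:(lra) ltac:(lra) Ht Hstep Hs0 HsN1).
    cbv beta in HR.
    assert (HR' := HR (fun k Hk Hsk => Hw k Hk (Rabs_le _ _ Hsk))). clear HR.
    match goal with |- Rabs (?x - Phi t) <= _ => set (S1 := x) in * end.
    replace (S1 - Phi t) with (S1 - (Phi t - Phi (- om A N)) + - Phi (- om A N)) by ring.
    eapply Rle_trans; [apply Rabs_triang|]. rewrite Rabs_Ropp, (Rabs_pos_eq (Phi (- om A N))) by lra.
    eapply Rle_trans; [apply Rplus_le_compat; [apply HR'|apply Htail]|].
    assert (E1 : h + C / sqrt (INR N) = (2 * sqrt L + C) * / sqrt (INR N)) by (unfold h; field; lra).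
    assert (Hol : om A N <= (1 + A) * ln (INR N)) by lra.
    assert (T1 : 2 * om A N * (h + C / sqrt (INR N)) <= 2 * ((1 + A) * ln (INR N)) * ((2 * sqrt L + C) * / sqrt (INR N))).
    { rewrite E1. apply Rmult_le_compat_r; [apply Rmult_le_pos; lra|]. lra. }
    assert (T2 : 2 * (h * (1 + C / sqrt (INR N))) <= 8 * sqrt L * / sqrt (INR N)).
    { replace (8 * sqrt L * / sqrt (INR N)) with (2 * (h * 2)) by (unfold h; field; lra).
      apply Rmult_le_compat_l; [lra|]. apply Rmult_le_compat_l; lra. }
    assert (T3 : 8 * sqrt L * / sqrt (INR N) <= 8 * sqrt L * / sqrt (INR N) * ln (INR N)).
    { rewrite <- (Rmult_1_r (8 * sqrt L * / sqrt (INR N))) at 1. apply Rmult_le_compat_l; [|easy]. apply Rmult_le_pos; lra. }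
    assert (T4 : / sqrt (INR N) <= / sqrt (INR N) * ln (INR N)).
    { rewrite <- (Rmult_1_r (/ sqrt (INR N))) at 1. apply Rmult_le_compat_l; lra. }
    unfold C2, Rdiv. lra. }
  assert (T4 : / sqrt (INR N) <= ln (INR N) / sqrt (INR N)).
  { unfold Rdiv. rewrite <- (Rmult_1_l (/ sqrt (INR N))) at 1. apply Rmult_le_compat_r; lra. }
  assert (T5 : 0 <= C3 * ln (INR N) / sqrt (INR N)).
  { apply Rmult_le_pos; [apply Rmult_le_pos; lra|lra]. }
  assert (T6 : (C2 + C3) * ln (INR N) / sqrt (INR N) = (C2 - 2) * ln (INR N) / sqrt (INR N) + 2 * (ln (INR N) / sqrt (INR N)) + C3 * ln (INR N) / sqrt (INR N)) by (field; lra).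
  assert (T7 : 0 <= (C2 - 2) * ln (INR N) / sqrt (INR N)).
  { apply Rmult_le_pos; [apply Rmult_le_pos; unfold C2; lra|lra]. }
  assert (Hmo := Hmain (om A N) ltac:(lra)). apply Rabs_le_between in Hmo.
  assert (Htop : forall t, om A N <= t -> 0 <= Phi t - Phi (om A N) <= sqrt (2 * PI) - Phi (om A N)).
  { intros t Ht. assert (Hi := Phi_increasing _ _ Ht). assert (H0 := Phi_opp t).
    destruct (Phi_tail t ltac:(lra)) as [H1 _]. lra. }
  exists (h / c0). split; [easy|]. split; [|split].
  (* Below the window the sum is empty and [Phi t] is a tail; above it the sum no longer depends on
     [t] and [Phi] changes only by a tail. *)
  - intros t. rewrite T6. destruct (Rlt_le_dec t (- om A N)) as [H1|H1]; [|destruct (Rle_lt_dec t (om A N)) as [H3|H3]].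
    + rewrite Hsum. rewrite (sum_eq _ (fun _ => 0)).
      * rewrite sum_cte, Rmult_0_l, Rminus_0_l, Rabs_Ropp.
        assert (Hi := Phi_increasing t (- om A N) ltac:(lra)).
        assert (H0 := Phi_tail (- t) ltac:(lra)). rewrite Ropp_involutive in H0. rewrite Rabs_pos_eq; lra.
      * intros k Hk. destruct (Rle_dec _ _) as [H4|]; [|easy]. destruct (Rle_dec _ _) as [H5|]; [|easy].
        assert (H6 := Rmin_l t (om A N)). lra.
    + specialize (Hmain t ltac:(lra)). lra.
    + assert (Et : h / c0 * sum_f_R0 (fun k => weight b p N k * win A L m N t k) N =
        h / c0 * sum_f_R0 (fun k => weight b p N k * win A L m N (om A N) k) N).
      { rewrite !Hsum. now rewrite (Rmin_right t), (Rmin_right (om A N)) by lra. }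
      rewrite Et. specialize (Htop t ltac:(lra)). apply Rabs_le. lra.
  - rewrite T6. apply Rabs_le. lra.
  - intros c k Hk Hc HcA HH Hfar.
    assert (Hf := weight_far b p m A c L N k C c0 ltac:(lia) HNn Hk HL Hc HA HcA HH Hlow Hfar).
    replace (h / c0 * weight b p N k) with (h * (weight b p N k / c0)) by (field; lra).
    assert (HN2p : 0 < INR N ^ 2) by (apply pow_lt; lra).
    assert (HsNge : 1 <= sqrt (INR N)) by (rewrite Hq3; now apply pow_R1_Rle).
    assert (Hh2 : h <= 2 * sqrt L).
    { unfold h. apply Rle_div_l; [easy|]. rewrite <- (Rmult_1_r (2 * sqrt L)) at 1. apply Rmult_le_compat_l; lra. }
    assert (Hwc : 0 < weight b p N k / c0) by (apply Rdiv_lt_0_compat; [apply weight_pos|easy]).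
    apply Rle_trans with (2 * sqrt L * (exp (4 + C) / INR N ^ 2)).
    + apply Rmult_le_compat; lra.
    + replace (2 * sqrt L * (exp (4 + C) / INR N ^ 2)) with (C3 / INR N ^ 2) by (unfold C3; field; lra).
      unfold Rdiv. apply Rmult_le_compat_r; [left; now apply Rinv_0_lt_compat|]. unfold C2. lra.
Qed.

(** * Assembly of the Berry-Esseen bound *)

Lemma ratio_perturbation G P y T e : 2 <= G -> 0 <= P <= G -> 0 <= e <= 1 ->
  Rabs (y - P) <= e -> Rabs (T - G) <= e -> Rabs (y / T - P / G) <= 2 * e.
Proof.
  intros HG HP He Hy HT.
  assert (HT1 : 1 <= T) by (apply Rabs_le_between in HT; lra).
  replace (y / T - P / G) with (((y - P) * G + P * (G - T)) / (T * G)) by (field; lra).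
  unfold Rdiv. rewrite Rabs_mult, Rabs_inv, (Rabs_pos_eq (T * G)) by nra.
  apply Rle_div_l; [nra|].
  eapply Rle_trans; [apply Rabs_triang|]. rewrite !Rabs_mult, (Rabs_pos_eq G), (Rabs_pos_eq P), (Rabs_minus_sym G) by lra.
  assert (Rabs (y - P) * G <= e * G) by (apply Rmult_le_compat_r; lra).
  assert (P * Rabs (T - G) <= G * e) by (apply Rmult_le_compat; try lra; apply Rabs_pos).
  assert (1 * (e * G) <= T * (e * G)) by (apply Rmult_le_compat_r; [apply Rmult_le_pos|]; lra).
  lra.
Qed.

Lemma sum_nonneg (f : nat -> R) (N : nat) : (forall k, (k <= N)%nat -> 0 <= f k) -> 0 <= sum_f_R0 f N.
Proof.
  intros H. induction N as [|N IH]; simpl; [now apply H|].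
  assert (H1 := H (S N) ltac:(lia)). specialize (IH ltac:(intros; apply H; lia)). lra.
Qed.

Theorem theorem3p3 (p : nat) (beta : R) (m : R)
  (bhat : nat -> list R -> R) :
  (3 <= p)%nat ->
  Rbar_lt (beta_star p) (Finite beta) ->
  (* m = m_*, the positive global maximizer of H_{beta,0,p} on [-1,1] *)
  0 < m < 1 ->
  (forall y, -1 <= y <= 1 -> Hfun beta p y <= Hfun beta p m) ->
  (* bhat N is a maximum pseudolikelihood estimate whenever a maximizer exists *)
  (forall N X, In X (configs N) -> (exists b, is_mple p X b) -> is_mple p X (bhat N X)) ->
  exists C : R, exists N0 : nat,
    forall N : nat, (N0 <= N)%nat -> forall x : R,
      Rabs (cdf_stat beta p N (bhat N) x
            - normal_cdf (- Derive_n (Hfun beta p) 2 m / (INR p ^ 2 * m ^ (2 * p - 2))) x)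
      <= C * ln (INR N) / sqrt (INR N).
Proof.
  intros Hp Hbeta Hm Hmax Hbhat.
  destruct (Hfun_max_pos beta p m Hp Hbeta Hmax) as [Hb HH].
  assert (Hmax' : forall y, 0 <= y <= 1 -> Hfun beta p y <= Hfun beta p m) by (intros; apply Hmax; lra).
  assert (Hd : dH beta p m = 0) by now apply max_critical.
  assert (Hphi : 0 < phi p m) by (apply (critical_phi_pos beta); lra || easy).
  assert (H2 := d2H_neg beta p m Hp Hm Hd Hphi).
  destruct (Hfun_quadratic_global beta p m Hp Hm Hb Hmax' HH) as [c [Hc Hglob]].
  rewrite Derive_n_Hfun by lra.
  set (L := - d2H beta p m). assert (HL : 0 < L) by (unfold L; lra).
  assert (HLc : 0 < 6 * L / c) by (apply Rdiv_lt_0_compat; lra).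
  (* The quotient meets the requirement of [weight_far]; the added 1 gives [A >= 1] for the Gaussian
     tail. *)
  set (A := 6 * L / c + 1).
  assert (HA : 1 <= A) by (unfold A; lra). assert (HA0 : 0 < A) by lra.
  assert (HcA : 6 * L <= c * A).
  { unfold A. replace (c * (6 * L / c + 1)) with (6 * L + c) by (field; lra). lra. }
  destruct (mle_window beta p m A Hp Hm Hd H2 HA0) as [C1 [N1 [HC1 Hmle]]]. fold L in Hmle.
  destruct (window_sum beta p m A Hp Hm Hd H2 HA) as [C2 [N2 [HC2 Hsum]]]. fold L in Hsum.
  assert (Hm2 : 0 < m / 2) by lra.
  (* Radius [m / 2] separates the windows around [m] and [-m]. *)
  destruct (eventually_om_le A L (m / 2) HA0 HL Hm2) as [N3 HN3].
  destruct eventually_ln_ge_1 as [N4 HN4].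
  assert (Hp0 : 0 < INR p) by (apply lt_0_INR; lia).
  assert (Hmp : 0 < m ^ (p - 1)) by (apply pow_lt; lra).
  set (v := L / (INR p ^ 2 * m ^ (2 * p - 2))).
  set (sv := sqrt L / (INR p * m ^ (p - 1))).
  assert (HsL : 0 < sqrt L) by now apply sqrt_lt_R0.
  assert (Hsv : 0 < sv) by (apply Rdiv_lt_0_compat; [easy|now apply Rmult_lt_0_compat]).
  assert (Hv2 : v = sv ^ 2).
  { unfold v, sv. replace (2 * p - 2)%nat with ((p - 1) * 2)%nat by lia. rewrite pow_mult.
    replace L with (sqrt L ^ 2) at 1 by (apply pow2_sqrt; lra). field. lra. }
  assert (Hv : 0 < v) by (rewrite Hv2; now apply pow_lt).
  assert (Hsqv : sqrt v = sv) by (rewrite Hv2; apply sqrt_pow2; lra).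
  (* Contributions of the estimator error, of the window, and of the far levels. *)
  set (C := C1 / sv + C2 + 2 * C2).
  assert (HC1s : 0 < C1 / sv) by now apply Rdiv_lt_0_compat.
  assert (HC : 0 < C) by (unfold C; lra).
  destruct (eventually_root8 (8 * C)) as [N5 HN5].
  exists (2 * C), (1 + N1 + N2 + N3 + N4 + N5)%nat. intros N HN x.
  specialize (HN3 N ltac:(lia)). specialize (HN4 N ltac:(lia)). specialize (HN5 N ltac:(lia)).
  assert (HNn : (1 <= N)%nat) by lia.
  assert (HN0 : 0 < INR N) by (apply lt_0_INR; lia).
  assert (HN1 : 1 <= INR N) by (apply (le_INR 1); lia).
  assert (HsN : 0 < sqrt (INR N)) by now apply sqrt_lt_R0.
  assert (HssN : sqrt (INR N) * sqrt (INR N) = INR N) by (apply sqrt_sqrt; lra).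
  destruct (Hsum N ltac:(lia)) as [q [Hq [Hwin [Htot Hfar]]]].
  rewrite normal_cdf_Phi, Hsqv by easy.
  set (t := x / sv).
  set (e := C1 / sv * ln (INR N) / sqrt (INR N)).
  set (E := C2 * ln (INR N) / sqrt (INR N)) in *.
  (* Switches on the mirror window around [-m], which carries mass only for even [p]; both parities
     are then treated at once. *)
  set (cE := if Nat.even p then 1 else 0).
  assert (HcE : 0 <= cE <= 1) by (unfold cE; destruct (Nat.even p); lra).
  assert (He0 : 0 <= e).
  { unfold e. apply Rmult_le_pos; [apply Rmult_le_pos; lra|left; now apply Rinv_0_lt_compat]. }
  assert (HE0 : 0 <= E).
  { unfold E. apply Rmult_le_pos; [apply Rmult_le_pos; lra|left; now apply Rinv_0_lt_compat]. }
  assert (Hdisj : forall k, (k <= N)%nat -> Rabs (score L m N k) <= om A N -> om A N < Rabs (score L m N (N - k))).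
  { intros k Hk H1. destruct (Rlt_le_dec (om A N) (Rabs (score L m N (N - k)))) as [|H3]; [easy|exfalso].
    assert (Q1 := score_near L m N k (m / 2) HL HNn ltac:(lra)).
    assert (Q2 := score_near L m N (N - k) (m / 2) HL HNn ltac:(lra)).
    rewrite mag_opp in Q2 by easy. apply Rabs_le_between in Q1. apply Rabs_le_between in Q2. lra. }
  assert (Hdisj' : forall k, (k <= N)%nat -> Rabs (score L m N (N - k)) <= om A N -> om A N < Rabs (score L m N k)).
  { intros k Hk H1. assert (Q := Hdisj (N - k)%nat ltac:(lia) H1). now replace (N - (N - k))%nat with k in Q by lia. }
  (* Indicator of the levels outside all active windows, since the window and its mirror image are
     disjoint. *)
  set (far := fun k => 1 - win A L m N (om A N) k - cE * win A L m N (om A N) (N - k)).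
  assert (Hwo : forall k, (win A L m N (om A N) k = 1 /\ Rabs (score L m N k) <= om A N) \/
     (win A L m N (om A N) k = 0 /\ om A N < Rabs (score L m N k))).
  { intros k. destruct (win_cases A L m N (om A N) k) as [[W1 [W2 W3]]|[W1 W2]]; [left; easy|right].
    split; [easy|]. destruct W2 as [|W2]; [easy|]. assert (Ha := Rle_abs (score L m N k)). lra. }
  assert (Hfar01 : forall k, (k <= N)%nat -> 0 <= far k <= 1).
  { intros k Hk. unfold far. destruct (Hwo k) as [[W1 W2]|[W1 W2]], (Hwo (N - k)%nat) as [[W3 W4]|[W3 W4]];
      rewrite W1, W3; try lra. assert (Hx := Hdisj k Hk W2). lra. }
  (* If the bound on [H] is quadratic around [m], the far estimate applies to [k]. If it is
     quadratic around [-m], either [N - k] lies in the window and [far] vanishes, or the far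
     estimate for [N - k] is carried over by symmetry. *)
  assert (Hfarw : forall k, (k <= N)%nat -> q * (weight beta p N k * far k) <= C2 / INR N ^ 2).
  { intros k Hk. assert (Hwk := weight_pos beta p N k).
    assert (HN2p : 0 < C2 / INR N ^ 2) by (apply Rdiv_lt_0_compat; [easy|now apply pow_lt]).
    assert (Hf01 := Hfar01 k Hk).
    assert (Hle : q * (weight beta p N k * far k) <= q * weight beta p N k).
    { apply Rmult_le_compat_l; [lra|]. rewrite <- (Rmult_1_r (weight beta p N k)) at 2. apply Rmult_le_compat_l; lra. }
    destruct (Hwo k) as [[W1 W2]|[W1 W2]].
    { assert (Hz : far k <= 0).
      { unfold far. rewrite W1. destruct (Hwo (N - k)%nat) as [[W3 _]|[W3 _]]; rewrite W3; lra. }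
      replace (far k) with 0 by lra. lra. }
    destruct (Hglob (mag N k) (mag_bounds N k HNn Hk)) as [Hg|[Hev Hg]].
    - eapply Rle_trans; [apply Hle|]. now apply (Hfar c).
    - destruct (Hwo (N - k)%nat) as [[W3 W4]|[W3 W4]].
      + replace (far k) with 0; [lra|]. unfold far, cE. rewrite W1, W3, Hev. lra.
      + eapply Rle_trans; [apply Hle|]. rewrite <- (weight_mirror beta p N k Hev Hk).
        apply (Hfar c); try easy; [lia|]. rewrite mag_opp, Hfun_opp_even by easy. exact Hg. }
  set (W := fun t => sum_f_R0 (fun k => weight beta p N k * win A L m N t k) N) in *.
  set (F := sum_f_R0 (fun k => weight beta p N k * far k) N).
  assert (HF : 0 <= q * F <= 2 * E).
  { split.
    - apply Rmult_le_pos; [lra|]. apply sum_nonneg. intros k Hk.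
      apply Rmult_le_pos; [left; apply weight_pos|apply Hfar01, Hk].
    - unfold F. rewrite scal_sum.
      rewrite (sum_eq _ (fun k => q * (weight beta p N k * far k))) by (intros; ring).
      eapply Rle_trans; [apply (sum_le_const _ (C2 / INR N ^ 2)); exact Hfarw|].
      rewrite S_INR. unfold E.
      replace ((INR N + 1) * (C2 / INR N ^ 2)) with (C2 * ((INR N + 1) / (INR N * (sqrt (INR N) * sqrt (INR N))))) by (rewrite HssN; field; lra).
      replace (2 * (C2 * ln (INR N) / sqrt (INR N))) with (C2 * (2 * ln (INR N) / sqrt (INR N))) by (field; lra).
      apply Rmult_le_compat_l; [lra|].
      assert (HsN1 : 1 <= sqrt (INR N)) by (rewrite <- sqrt_1; now apply sqrt_le_1_alt).
      apply Rle_div_l; [now repeat apply Rmult_lt_0_compat|].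
      replace (2 * ln (INR N) / sqrt (INR N) * (INR N * (sqrt (INR N) * sqrt (INR N)))) with (2 * ln (INR N) * (INR N * sqrt (INR N))) by (field; lra).
      assert (INR N * 1 <= INR N * sqrt (INR N)) by (apply Rmult_le_compat_l; lra).
      assert (1 * (INR N * sqrt (INR N)) <= ln (INR N) * (INR N * sqrt (INR N))) by (apply Rmult_le_compat_r; lra).
      lra. }
  assert (Hmir : forall f : nat -> R, cE * sum_f_R0 (fun k => weight beta p N k * f (N - k)%nat) N
     = cE * sum_f_R0 (fun k => weight beta p N k * f k) N).
  { intros f. unfold cE. destruct (Nat.even p) eqn:Hev; [|now rewrite !Rmult_0_l]. f_equal.
    rewrite <- (sum_reverse (fun k => weight beta p N k * f k)). apply sum_eq. intros k Hk.
    now rewrite weight_mirror. }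
  assert (Hsplit : forall t g, sum_f_R0 (fun k => weight beta p N k * (win A L m N t k + cE * win A L m N t (N - k) + g k)) N
     = (1 + cE) * W t + sum_f_R0 (fun k => weight beta p N k * g k) N).
  { intros t' g.
    rewrite (sum_eq _ (fun k => (weight beta p N k * win A L m N t' k + cE * (weight beta p N k * win A L m N t' (N - k))) + weight beta p N k * g k)) by (intros; ring).
    rewrite !sum_plus. f_equal. rewrite Rmult_plus_distr_r, Rmult_1_l. f_equal.
    unfold W. rewrite <- Hmir, scal_sum. apply sum_eq. intros; ring. }
  (* Shifting [t] by [e] absorbs the error of the linearized estimator. Far levels count fully in
     [up] and not at all in [lo], since the estimate is uncontrolled there; the [+ 0] gives [lo] the
     shape of [Hsplit]. *)
  set (lo := fun k => win A L m N (t - e) k + cE * win A L m N (t - e) (N - k) + 0).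
  set (up := fun k => win A L m N (t + e) k + cE * win A L m N (t + e) (N - k) + far k).
  assert (Hbd : forall X, In X (configs N) ->
     lo (npos X) <= (if Rle_dec (sqrt (INR N) * (bhat N X - beta)) x then 1 else 0) <= up (npos X)).
  { intros X HX. destruct (configs_spec N X HX) as [HXl _].
    assert (Hk : (npos X <= N)%nat) by (rewrite <- HXl; apply npos_le).
    set (k := npos X) in *.
    assert (Hloc : forall j, j = npos X \/ (Nat.even p = true /\ j = (N - npos X)%nat) ->
       Rabs (score L m N j) <= om A N ->
       (score L m N j <= t - e -> sqrt (INR N) * (bhat N X - beta) <= x) /\
       (sqrt (INR N) * (bhat N X - beta) <= x -> score L m N j <= t + e)).
    { intros j Hj Hs. assert (Hl := Hmle N X (bhat N X) j ltac:(lia) HX (Hbhat N X HX) Hj Hs).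
      fold sv in Hl. apply Rabs_le_between in Hl.
      assert (Ex : x = sv * t) by (unfold t; field; lra).
      assert (Ee : C1 * ln (INR N) / sqrt (INR N) = sv * e) by (unfold e; field; lra).
      rewrite Ee in Hl. rewrite Ex. split; intros H.
      - assert (sv * score L m N j <= sv * (t - e)) by (apply Rmult_le_compat_l; lra). lra.
      - apply (Rmult_le_reg_l sv); [easy|]. lra. }
    assert (Hw01 : forall t j, 0 <= win A L m N t j <= 1).
    { intros t' j. destruct (win_cases A L m N t' j) as [[-> _]|[-> _]]; lra. }
    split.
    - unfold lo. rewrite Rplus_0_r.
      destruct (win_cases A L m N (t - e) k) as [[W1 [W2 W3]]|[W1 _]].
      + destruct (Hloc k (or_introl eq_refl) W2) as [Hl _]. specialize (Hl W3).
        assert (W4 : win A L m N (t - e) (N - k) = 0).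
        { destruct (win_cases A L m N (t - e) (N - k)) as [[_ [W5 _]]|[W5 _]]; [|easy].
          assert (Q := Hdisj k Hk W2). lra. }
        rewrite W1, W4. destruct (Rle_dec _ x); lra.
      + rewrite W1. unfold cE. destruct (Nat.even p) eqn:Hev; [|destruct (Rle_dec _ x); lra].
        destruct (win_cases A L m N (t - e) (N - k)) as [[W4 [W5 W6]]|[W4 _]]; rewrite W4.
        * destruct (Hloc (N - k)%nat (or_intror (conj eq_refl eq_refl)) W5) as [Hl _]. specialize (Hl W6).
          destruct (Rle_dec _ x); lra.
        * destruct (Rle_dec _ x); lra.
    - assert (Hf := Hfar01 k Hk). assert (Ha := Hw01 (t + e) k). assert (Hb' := Hw01 (t + e) (N - k)%nat).
      assert (Hcb : 0 <= cE * win A L m N (t + e) (N - k)) by (apply Rmult_le_pos; lra).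
      unfold up. destruct (Rle_dec _ x) as [Hle|]; [|lra].
      destruct (Hwo k) as [[W1 W2]|[W1 W2]].
      + destruct (Hloc k (or_introl eq_refl) W2) as [_ Hl]. specialize (Hl Hle).
        rewrite (win_1 A L m N (t + e) k) by easy. lra.
      + destruct (Nat.even p) eqn:Hev.
        * destruct (Hwo (N - k)%nat) as [[W3 W4]|[W3 W4]].
          -- destruct (Hloc (N - k)%nat (or_intror (conj eq_refl eq_refl)) W4) as [_ Hl]. specialize (Hl Hle).
             rewrite (win_1 A L m N (t + e) (N - k)) by easy. unfold cE. lra.
          -- unfold far. rewrite W1, W3. lra.
        * unfold far, cE. rewrite W1. lra. }
  destruct (cdf_stat_bounds beta p N (bhat N) x lo up Hbd) as [Hcl Hcu].
  (* At [t = om] the window, its mirror image and the far part add up to 1. *)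
  assert (HZ : sum_f_R0 (weight beta p N) N = (1 + cE) * W (om A N) + F).
  { unfold F. rewrite <- Hsplit. apply sum_eq. intros k Hk. unfold far. ring. }
  unfold lo in Hcl. unfold up in Hcu. rewrite Hsplit, HZ in Hcl, Hcu. fold F in Hcu.
  rewrite (sum_eq _ (fun _ => 0)) in Hcl by (intros; ring). rewrite sum_cte, Rmult_0_l, Rplus_0_r in Hcl.
  (* The window and its mirror image multiply both numerator and total by [1 + cE]; dividing this
     out leaves the far mass scaled by it. *)
  set (f := q * F / (1 + cE)).
  assert (Hf : 0 <= f <= 2 * E).
  { unfold f. split; [apply Rmult_le_pos; [lra|left; apply Rinv_0_lt_compat; lra]|].
    apply Rle_div_l; [lra|]. assert (0 <= 2 * E * cE) by (apply Rmult_le_pos; lra). lra. }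
  set (T := q * W (om A N) + f).
  set (eta := C * ln (INR N) / sqrt (INR N)).
  assert (Heta : e + E + 2 * E = eta) by (unfold e, E, eta, C; field; lra).
  (* Keeps the normalized total [T] at least 1, since [G >= 2]. *)
  assert (Heta1 : eta <= 1).
  { unfold eta. destruct (root8_spec N HNn) as [Hr1 [Hr2 Hr3]]. apply Rle_div_l; [easy|].
    rewrite Hr3. assert (Hr4 : root8 N ^ 2 <= root8 N ^ 4) by (apply Rle_pow; [easy|lia]).
    assert (C * ln (INR N) <= C * (8 * root8 N)) by (apply Rmult_le_compat_l; lra).
    assert (8 * C * root8 N <= root8 N * root8 N) by (apply Rmult_le_compat_r; lra). lra. }
  set (G := sqrt (2 * PI)) in *.
  assert (HG : 2 <= G) by apply sqrt_2PI_ge.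
  assert (HT : Rabs (T - G) <= eta).
  { unfold T. fold (W (om A N)) in Htot. apply Rabs_le_between in Htot. apply Rabs_le. lra. }
  assert (HTpos : 0 < T) by (apply Rabs_le_between in HT; lra).
  assert (HWT : (1 + cE) * W (om A N) + F = (1 + cE) / q * T) by (unfold T, f; field; lra).
  rewrite HWT in Hcl, Hcu.
  assert (Hlow : (1 + cE) * W (t - e) / ((1 + cE) / q * T) = q * W (t - e) / T) by (field; lra).
  assert (Hupp : ((1 + cE) * W (t + e) + F) / ((1 + cE) / q * T) = (q * W (t + e) + f) / T) by (unfold f; field; lra).
  rewrite Hlow in Hcl. rewrite Hupp in Hcu.
  assert (HPt : 0 <= Phi t <= G).
  { assert (Hop := Phi_opp t). fold G in Hop. destruct (Rle_lt_dec 0 t) as [H0|H0].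
    - assert (Q := Phi_tail t H0). assert (Q2 := Phi_tail 0 (Rle_refl 0)). rewrite Ropp_0 in Q2.
      assert (Q3 := Phi_increasing 0 t H0). lra.
    - assert (Q := Phi_tail (- t) ltac:(lra)). rewrite Ropp_involutive in Q.
      assert (Q3 := Phi_increasing t (- t) ltac:(lra)). lra. }
  assert (HL1 : Rabs (q * W (t - e) - Phi t) <= eta).
  { assert (Q := Hwin (t - e)). fold (W (t - e)) in Q. assert (Q2 := Phi_lipschitz t (t - e)).
    replace (t - e - t) with (- e) in Q2 by ring. rewrite Rabs_Ropp, (Rabs_pos_eq e) in Q2 by easy.
    apply Rabs_le_between in Q. apply Rabs_le_between in Q2. apply Rabs_le. lra. }
  assert (HU1 : Rabs (q * W (t + e) + f - Phi t) <= eta).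
  { assert (Q := Hwin (t + e)). fold (W (t + e)) in Q. assert (Q2 := Phi_lipschitz t (t + e)).
    replace (t + e - t) with e in Q2 by ring. rewrite (Rabs_pos_eq e) in Q2 by easy.
    apply Rabs_le_between in Q. apply Rabs_le_between in Q2. apply Rabs_le. lra. }
  assert (R1 := ratio_perturbation G (Phi t) _ T eta HG HPt ltac:(lra) HL1 HT).
  assert (R2 := ratio_perturbation G (Phi t) _ T eta HG HPt ltac:(lra) HU1 HT).
  replace (2 * C * ln (INR N) / sqrt (INR N)) with (2 * eta) by (unfold eta; field; lra).
  apply Rabs_le_between in R1. apply Rabs_le_between in R2. apply Rabs_le. lra.
Qed.
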